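(* Let $x_l<x_r$ be real, $\mathcal D=(x_l,x_r)$, let $\alpha,\beta,\gamma$ satisfy (A1)–(A5) of the context, and let $(a:b)=\begin{pmatrix} a_{11} & a_{12} & b_{11} & b_{12} \\ a_{21} & a_{22} & b_{21} & b_{22} \end{pmatrix}$ have rank $2$ and satisfy one of the Boundary Cases 1–4 of the context (in Boundary Case 4, assume also (A6)). The Sturm–Liouville problem $$\alpha(x)\left(\beta(x)y'\right)'+\gamma(x)y=\lambda y,$$ with boundary conditions $$a_{11}y(x_l)+a_{12}y'(x_l)+b_{11}y(x_r)+b_{12}y'(x_r)=0,\qquad a_{21}y(x_l)+a_{22}y'(x_l)+b_{21}y(x_r)+b_{22}y'(x_r)=0,$$ has the eigenfunctions $$X_m(x)=\frac{C_m}{\sqrt{(\beta\mathfrak n)(\kappa_m,x)}}\sum_{n=0}^\infty\mathcal C_n^{(x_l,x)}(\kappa_m)+\frac{S_m}{\sqrt{(\beta\mathfrak n)(\kappa_m,x)}}\sum_{n=0}^\infty\mathcal S_n^{(x_l,x)}(\kappa_m)$$ corresponding to the eigenvalues $\lambda_m=-\kappa_m^2$, where $\{\kappa_m\}_{m=1}^\infty$ are the zeros of $$\Delta(k)=2i\,\Xi(k)\left(\mathfrak a(k)+\sum_{n=0}^\infty\mathfrak c_n(k)\mathcal C_n^{(x_l,x_r)}(k)+\sum_{n=0}^\infty\mathfrak s_n(k)\mathcal S_n^{(x_l,x_r)}(k)\right).$$ Here $$C_m=-\frac{a_{12}\kappa_m\mathfrak n(\kappa_m,x_l)}{\sqrt{(\beta\mathfrak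 n)(\kappa_m,x_l)}}-\frac{b_{11}}{\sqrt{(\beta\mathfrak n)(\kappa_m,x_r)}}\sum_{n=0}^\infty\mathcal S_n^{(x_l,x_r)}(\kappa_m)-\frac{b_{12}\kappa_m\mathfrak n(\kappa_m,x_r)}{\sqrt{(\beta\mathfrak n)(\kappa_m,x_r)}}\sum_{n=0}^\infty(-1)^n\mathcal C_n^{(x_l,x_r)}(\kappa_m),$$ $$S_m=\frac{a_{11}}{\sqrt{(\beta\mathfrak n)(\kappa_m,x_l)}}+\frac{b_{11}}{\sqrt{(\beta\mathfrak n)(\kappa_m,x_r)}}\sum_{n=0}^\infty\mathcal C_n^{(x_l,x_r)}(\kappa_m)-\frac{b_{12}\kappa_m\mathfrak n(\kappa_m,x_r)}{\sqrt{(\beta\mathfrak n)(\kappa_m,x_r)}}\sum_{n=0}^\infty(-1)^n\mathcal S_n^{(x_l,x_r)}(\kappa_m).$$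
   Context: Conventions. $\arg(\cdot)\in[-\pi/2,3\pi/2)$. $\mathrm{AC}(I)$ is the space of functions that are locally absolutely continuous on the closure of $I$. A prime denotes the derivative with respect to the spatial variable. $(a:b)_{i,j}$ denotes the determinant of the $2\times2$ submatrix of $(a:b)$ formed by columns $i$ and $j$. Assumptions on the coefficients: (A1) $\sup_{x\in\mathcal D}|\arg(\alpha(x)\beta(x))|<\pi/2$; (A2) $\alpha,\beta\in\mathrm{AC}(\mathcal D)$; (A3) $\inf_{x\in\mathcal D}|\alpha(x)\beta(x)|>0$; (A4) $\alpha\beta,\gamma\in L^\infty(\mathcal D)$; (A5) $\beta'/\beta-\alpha'/\alpha\in L^1(\mathcal D)$ and $\gamma'\in L^1(\mathcal D)$. Additional assumption used only in Boundary Case 4: (A6) $\beta'/\beta-\alpha'/\alpha\in\mathrm{AC}(\mathcal D)$. Definitions. Write $\alpha=|\alpha|e^{i\theta_\alpha}$, $\beta=|\beta|e^{i\theta_\beta}$ with arguments $\theta_\alpha,\theta_\beta$ chosen to be continuous. Put $\mu(x)=\frac1{\sqrt{\alpha(x)\beta(x)}}=|\alpha(x)\beta(x)|^{-1/2}e^{-\frac i2(\theta_\alpha(x)+\theta_\beta(x))}$, $\mathfrak g(k,x)=\sqrt{1+\gamma(x)/k^2}=|1+\gamma(x)/k^2|^{1/2}e^{\frac i2\arg(1+\gamma(x)/k^2)}$, $\mathfrak n(k,x)=\mu(x)\mathfrak g(k,x)$, $(\beta\mathfrak n)(k,x)=\beta(x)\mathfrak n(k,x)$, $\sqrt{(\beta\mu)(x)}=|\beta(x)/\alpha(x)|^{1/4}e^{\frac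 i4(\theta_\beta(x)-\theta_\alpha(x))}$, $\sqrt{\mathfrak g(k,x)}=|1+\gamma(x)/k^2|^{1/4}e^{\frac i4\arg(1+\gamma(x)/k^2)}$, $\sqrt{(\beta\mathfrak n)(k,x)}=\sqrt{(\beta\mu)(x)}\sqrt{\mathfrak g(k,x)}$, $\mathfrak u(x)=\frac1{\mu(x)}\left(\frac{\beta'(x)}{\beta(x)}-\frac{\alpha'(x)}{\alpha(x)}\right)$, $\mathfrak u_+=\mathfrak u(x_r)+\mathfrak u(x_l)$. Boundary Cases. Let $$m_{\mathfrak c_0}=\frac{(a:b)_{1,4}}{\mu(x_l)}-\frac{(a:b)_{2,3}}{\mu(x_r)},\quad m_{\mathfrak c_1}=\frac{(a:b)_{1,4}}{\mu(x_l)}+\frac{(a:b)_{2,3}}{\mu(x_r)},\quad m_{\mathfrak s}=\frac{(a:b)_{1,3}}{\mu(x_l)\mu(x_r)}.$$ Case 1: $(a:b)_{2,4}\ne0$. Case 2: $(a:b)_{2,4}=0$ and $m_{\mathfrak c_0}\ne0$. Case 3: $(a:b)_{2,4}=0$, $m_{\mathfrak c_0}=0$, $m_{\mathfrak c_1}=0$ and $(a:b)_{1,3}\ne0$. Case 4: $(a:b)_{2,4}=0$, $m_{\mathfrak c_0}=0$, $m_{\mathfrak c_1}\ne0$ and $m_{\mathfrak c_1}\mathfrak u_+-8m_{\mathfrak s}\ne0$. Ingredients of $\Delta$: $\Xi(k)=\exp\left(ik\int_{x_l}^{x_r}\mathfrak n(k,\xi)\,d\xi\right)$, $$\mathfrak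 a(k)=\frac{\beta(x_r)(a:b)_{1,2}+\beta(x_l)(a:b)_{3,4}}{k\sqrt{(\beta\mathfrak n)(k,x_l)}\sqrt{(\beta\mathfrak n)(k,x_r)}},\quad \mathfrak c_n(k)=(-1)^n\frac{(a:b)_{1,4}}{k\,\mathfrak n(k,x_l)}-\frac{(a:b)_{2,3}}{k\,\mathfrak n(k,x_r)},\quad \mathfrak s_n(k)=(-1)^n(a:b)_{2,4}+\frac{(a:b)_{1,3}}{k^2\mathfrak n(k,x_l)\mathfrak n(k,x_r)}.$$ $\mathcal C_0^{(a,b)}(k)=\cos\left(k\int_a^b\mathfrak n(k,\xi)\,d\xi\right)$, $\mathcal S_0^{(a,b)}(k)=\sin\left(k\int_a^b\mathfrak n(k,\xi)\,d\xi\right)$, and for $n\ge1$ $$\mathcal C_n^{(a,b)}(k)=\frac1{2^n}\int_{a=y_0<y_1<\cdots<y_n<y_{n+1}=b}\left(\prod_{p=1}^n\frac{(\beta\mathfrak n)'(k,y_p)}{(\beta\mathfrak n)(k,y_p)}\right)\cos\left(k\sum_{p=0}^n(-1)^p\int_{y_p}^{y_{p+1}}\mathfrak n(k,\xi)\,d\xi\right)dy_1\cdots dy_n,$$ and $\mathcal S_n^{(a,b)}(k)$ is given by the same formula with $\cos$ replaced by $\sin$.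
   Formalization: X_m is claimed to be an eigenfunction only if (C_m,S_m)≠(0,0), since otherwise X_m=0; k ranges over k≠0 with 1+γ/k² nonvanishing and its prescribed square root continuous on [x_l,x_r]; that Δ has infinitely many zeros is taken as notation. *)

(* Defs.v *)
From HB Require Import structures.
From mathcomp Require Import all_boot all_order all_algebra.
From mathcomp Require Import all_classical all_reals all_analysis.
From mathcomp.real_closed Require Export complex.
Export Order.TTheory GRing.Theory Num.Theory numFieldNormedType.Exports.

Set Implicit Arguments.
Unset Strict Implicit.
Unset Printing Implicit Defensive.

Local Open Scope classical_set_scope.
Local Open Scope ring_scope.
Local Open Scope complex_scope.

Local Notation Re := complex.Re.
Local Notation Im := complex.Im.

Section ComplexAnalysis.
Context {R : realType}.
Local Notation C := R[i].
Local Notation mu := (@lebesgue_measure R).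
Implicit Types (f g : R -> C) (z : C) (a b x t : R) (D : set R).

Definition cabs z : R := Normc.normc z.

Definition cis t : C := cos t +i* sin t.

Definition cexp z : C := (expR (Re z))%:C * cis (Im z).
Definition ccos z : C := (cexp ('i * z) + cexp (- ('i * z))) / 2%:R.
Definition csin z : C := (cexp ('i * z) - cexp (- ('i * z))) / (2%:R * 'i).

(* The argument in [-pi/2, 3pi/2): the branch cut is the negative imaginary
   axis. The value at z = 0 is irrelevant. *)
Definition carg z : R :=
  xget 0 [set t | - (pi / 2) <= t < 3 * pi / 2 /\ z = (cabs z)%:C * cis t].

Definition cint a b f : C :=
  (\int[mu]_(x in `[a, b]) Re (f x)) +i* (\int[mu]_(x in `[a, b]) Im (f x)).

Definition csum (u : nat -> C) : C :=
  limn (series (fun n => Re (u n))) +i* limn (series (fun n => Im (u n))).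

Definition cderiv f x : C :=
  derive1 (fun t => Re (f t)) x +i* derive1 (fun t => Im (f t)) x.

Definition ccontinuous_on a b f :=
  {within `[a, b], continuous (fun x => Re (f x))} /\
  {within `[a, b], continuous (fun x => Im (f x))}.

(* df is the derivative of f at every point of [a, b], one-sided at a and b. *)
Definition has_deriv_on a b f (df : R -> C) := forall x : R, x \in `[a, b] ->
  (Re (f t) - Re (f x)) / (t - x) @[t --> within `[a, b]%classic x^'] --> Re (df x) /\
  (Im (f t) - Im (f x)) / (t - x) @[t --> within `[a, b]%classic x^'] --> Im (df x).

Definition abs_continuous a b f := forall e : R, 0 < e ->
  exists2 d : R, 0 < d &
    forall (n : nat) (l r : 'I_n -> R),
      (forall i, a <= l i /\ l i <= r i /\ r i <= b) ->
      trivIset setT (fun i => `]l i, r i[%classic) ->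
      \sum_(i < n) (r i - l i) < d ->
      \sum_(i < n) cabs (f (r i) - f (l i)) < e.

Definition L1 D f :=
  mu.-integrable D (fun x => (Re (f x))%:E) /\
  mu.-integrable D (fun x => (Im (f x))%:E).

Definition Linfty D f :=
  measurable_fun D (fun x => Re (f x)) /\
  measurable_fun D (fun x => Im (f x)) /\
  exists M : R, {ae mu, forall x, D x -> cabs (f x) <= M}.

(* Integral of F [:: y_1; ...; y_n] over a < y_1 < ... < y_n < b as an iterated
   integral, y_1 being the innermost variable. *)
Fixpoint simplex_int (n : nat) a b (F : seq R -> C) : C :=
  if n is m.+1 then
    cint a b (fun y => simplex_int m a y (fun ys => F (rcons ys y)))
  else F [::].

End ComplexAnalysis.

Section SturmLiouville.
Context {R : realType}.
Local Notation C := R[i].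
Local Notation mu := (@lebesgue_measure R).
Variables (xl xr : R) (al be ga : R -> C).

Local Notation D := `]xl, xr[%classic.

(* "gamma' in L^1" is a statement about the weak derivative: gamma is
   absolutely continuous with integrable derivative. *)
Record sl_assumptions : Prop := SLAssumptions {
  slA1 : sup [set `|carg (al x * be x)| | x in D] < pi / 2;
  slA2 : abs_continuous xl xr al /\ abs_continuous xl xr be;
  slA3 : 0 < inf [set cabs (al x * be x) | x in D];
  slA4 : Linfty D (fun x => al x * be x) /\ Linfty D ga;
  slA5 : L1 D (fun x => cderiv be x / be x - cderiv al x / al x) /\
         (abs_continuous xl xr ga /\ L1 D (cderiv ga)) }.

Definition continuous_arg (f : R -> C) (th : R -> R) :=
  {within `[xl, xr], continuous th} /\
  forall x, x \in `[xl, xr] -> f x = (cabs (f x))%:C * cis (th x).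

Variables (tha thb : R -> R).

Definition muf (x : R) : C :=
  (cabs (al x * be x) `^ (- 2^-1))%:C * cis (- (tha x + thb x) / 2).

Definition gsq (k : C) (x : R) : C := 1 + ga x / k ^+ 2.

Definition gf (k : C) (x : R) : C :=
  (cabs (gsq k x) `^ 2^-1)%:C * cis (carg (gsq k x) / 2).

Definition nf (k : C) (x : R) : C := muf x * gf k x.
Definition bn (k : C) (x : R) : C := be x * nf k x.

Definition sqrt_bmu (x : R) : C :=
  (cabs (be x / al x) `^ 4^-1)%:C * cis ((thb x - tha x) / 4).
Definition sqrt_g (k : C) (x : R) : C :=
  (cabs (gsq k x) `^ 4^-1)%:C * cis (carg (gsq k x) / 4).
Definition sqrt_bn (k : C) (x : R) : C := sqrt_bmu x * sqrt_g k x.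

(* The k for which the formulas below make sense: k and the radicand
   1 + gamma/k^2 do not vanish, and the prescribed branch of its square root is
   continuous in x. Every k with |k|^2 > sup |gamma| is admissible. *)
Definition admissible (k : C) :=
  k != 0 /\ (forall x, x \in `[xl, xr] -> gsq k x != 0) /\
  ccontinuous_on xl xr (gf k).

(* For ys = [:: y_1; ...; y_n], y_0 = a and y_(n+1) = b:
   sum_(p = 0)^n (-1)^p int_(y_p)^(y_(p+1)) n(k, xi) dxi. *)
Definition phase (k : C) (a b : R) (ys : seq R) : C :=
  let y := nth 0 (a :: rcons ys b) in
  \sum_(p < (size ys).+1) (-1) ^+ p * cint (y p) (y p.+1) (nf k).

Definition CS_ (trig : C -> C) (n : nat) (a b : R) (k : C) : C :=
  (2%:R ^+ n)^-1 * simplex_int n a b (fun ys =>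
    (\prod_(y <- ys) (cderiv (bn k) y / bn k y)) * trig (k * phase k a b ys)).
Definition Cn := CS_ ccos.
Definition Sn := CS_ csin.

Variables (a b : 'M[C]_2).

Definition ab : 'M[C]_(2, 4) := row_mx a b.

(* (a:b)_{i,j}, the columns being numbered from 1 to 4. *)
Definition abm (i j : nat) : C :=
  \det (\matrix_(r < 2, c < 2) ab r (inord (if c == 0 then i.-1 else j.-1))).

Definition m_c0 : C := abm 1 4 / muf xl - abm 2 3 / muf xr.
Definition m_c1 : C := abm 1 4 / muf xl + abm 2 3 / muf xr.
Definition m_s : C := abm 1 3 / (muf xl * muf xr).

Definition boundary_case1 := abm 2 4 != 0.
Definition boundary_case2 := abm 2 4 = 0 /\ m_c0 != 0.
Definition boundary_case3 :=
  abm 2 4 = 0 /\ m_c0 = 0 /\ m_c1 = 0 /\ abm 1 3 != 0.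
(* q is the absolutely continuous representative of beta'/beta - alpha'/alpha,
   through which its values at xl and xr are defined. *)
Definition boundary_case4 :=
  abm 2 4 = 0 /\ m_c0 = 0 /\ m_c1 != 0 /\
  exists q : R -> C,
    abs_continuous xl xr q /\
    {ae mu, forall x, D x -> q x = cderiv be x / be x - cderiv al x / al x} /\
    m_c1 * (q xr / muf xr + q xl / muf xl) - 8%:R * m_s != 0.
Definition boundary_case :=
  boundary_case1 \/ boundary_case2 \/ boundary_case3 \/ boundary_case4.

Definition Xi (k : C) : C := cexp ('i * k * cint xl xr (nf k)).

Definition af (k : C) : C :=
  (be xr * abm 1 2 + be xl * abm 3 4) / (k * sqrt_bn k xl * sqrt_bn k xr).

Definition cf (n : nat) (k : C) : C :=
  (-1) ^+ n * (abm 1 4 / (k * nf k xl)) - abm 2 3 / (k * nf k xr).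

Definition sf (n : nat) (k : C) : C :=
  (-1) ^+ n * abm 2 4 + abm 1 3 / (k ^+ 2 * nf k xl * nf k xr).

Definition Delta (k : C) : C :=
  2%:R * 'i * Xi k *
  (af k + csum (fun n => cf n k * Cn n xl xr k)
        + csum (fun n => sf n k * Sn n xl xr k)).

Definition Ccoef (k : C) : C :=
  - (a 0 1 * k * nf k xl / sqrt_bn k xl)
  - b 0 0 / sqrt_bn k xr * csum (fun n => Sn n xl xr k)
  - b 0 1 * k * nf k xr / sqrt_bn k xr
    * csum (fun n => (-1) ^+ n * Cn n xl xr k).

Definition Scoef (k : C) : C :=
  a 0 0 / sqrt_bn k xl
  + b 0 0 / sqrt_bn k xr * csum (fun n => Cn n xl xr k)
  - b 0 1 * k * nf k xr / sqrt_bn k xr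
    * csum (fun n => (-1) ^+ n * Sn n xl xr k).

Definition Xf (k : C) (x : R) : C :=
  Ccoef k / sqrt_bn k x * csum (fun n => Cn n xl x k)
  + Scoef k / sqrt_bn k x * csum (fun n => Sn n xl x k).

(* y solves the differential equation (almost everywhere, with y' and beta y'
   in the usual Sturm-Liouville regularity class) and the boundary conditions. *)
Definition sl_solution (lam : C) (y : R -> C) :=
  exists dy : R -> C,
    has_deriv_on xl xr y dy /\
    abs_continuous xl xr (fun x => be x * dy x) /\
    {ae mu, forall x, D x ->
      al x * cderiv (fun t => be t * dy t) x + ga x * y x = lam * y x} /\
    (forall i : 'I_2,
      a i 0 * y xl + a i 1 * dy xl + b i 0 * y xr + b i 1 * dy xr = 0).

Definition sl_eigenfunction (lam : C) (y : R -> C) :=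
  sl_solution lam y /\ exists2 x, x \in `[xl, xr] & y x != 0.

Definition sl_eigenvalue (lam : C) := exists y, sl_eigenfunction lam y.

End SturmLiouville.

(* Main.v *)
From HB Require Import structures.
Require Import Defs.
From mathcomp Require Import all_boot all_order all_algebra.
From mathcomp Require Import all_classical all_reals all_analysis.
From mathcomp Require Import measurable_realfun lebesgue_integral_differentiation ring lra.
Import Order.TTheory GRing.Theory Num.Theory numFieldNormedType.Exports.

(* Put p = be n, q = p' / p, U = sqrt p y and V = be y' / (k sqrt p). The equation
   becomes U' = k n V + (q / 2) U, V' = - k n U - (q / 2) V almost everywhere, all
   functions being absolutely continuous. Writing cos and sin through exp (+- i .),
   the n-th iterated integral is obtained from the previous one by
     E_n (x) = int_xl^x q(y) / 2 exp (+- i (-1)^n k int_y^x n) E_(n-1) (y) dy,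
   so |E_n| <= K (K int |q|)^n / n!, and differentiating termwise (dominated
   convergence) shows that (sum C_n, - sum (-1)^n S_n) and (sum S_n, sum (-1)^n C_n)
   solve the system, with initial values (1, 0) and (0, 1). Wronskians of solutions
   are constant, hence these two solutions span all others. Up to a nonzero factor,
   Delta is the determinant of the two boundary forms on this basis, and
   (C_m, S_m) is orthogonal to the first row of the boundary matrix.

   Absolute continuity is used through the fundamental theorem of calculus. A
   function with the epsilon-delta property is the difference of two nondecreasing
   ones, its total variation being again absolutely continuous; the Stieltjes measure
   of each is dominated by the Lebesgue measure, and Radon-Nikodym together with
   Lebesgue differentiation gives the derivative. *)

Set Implicit Arguments.
Unset Strict Implicit.
Unset Printing Implicit Defensive.

Local Open Scope classical_set_scope.
Local Open Scope ring_scope.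

(** * Absolutely continuous functions are primitives *)

Section Chain.
Context {R : realType}.
Implicit Types (a b x : R) (L : seq (R * R)) (f : R -> R).

(** Since [q] is merely integrable, the system holds only almost everywhere, and every differential
    identity must be transferred through its integral form. Exponentials replace cos and sin because
    the last segment of the phase then splits off as a factor independent of the inner variables.
    Differentiating [E_n] produces [(-1)^n k n E_n] up to a factor [+- i], so the plain sum
    satisfies no closed equation; it does so together with the alternating sum, which is where [V]
    comes from. The roots enter only through their squares and their continuity: a continuous
    nonvanishing root of an absolutely continuous function is absolutely continuous. For the
    argument in [[-pi/2, 3pi/2)], the quarter argument stays in the right half-plane, so the root of
    [g] inherits the continuity of [g] that admissibility grants. When [C_m] and [S_m] both vanish,
    the first boundary form is zero on every solution and [X_m] is the zero function; hence
    nonvanishing and uniqueness are tied to a nonzero coefficient. *)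

Definition real_abs_continuous a b f := forall e : R, 0 < e ->
  exists2 d : R, 0 < d &
    forall (n : nat) (l r : 'I_n -> R),
      (forall i, a <= l i /\ l i <= r i /\ r i <= b) ->
      trivIset setT (fun i => `]l i, r i[%classic) ->
      \sum_(i < n) (r i - l i) < d ->
      \sum_(i < n) `|f (r i) - f (l i)| < e.

(** Sorted lists are used instead of indexed disjoint families, so that replacing one interval by
    the cells of a partition is a concatenation and disjointness never has to be proved again. *)
Fixpoint chain a b L : bool :=
  if L is (l, r) :: L' then [&& a <= l, l <= r & chain r b L'] else a <= b.

Lemma chain_leL a x b L : x <= a -> chain a b L -> chain x b L.
Proof.
move=> xa; case: L => [|[l r] L] /=; first exact: le_trans.
by move=> /and3P[al -> ->]; rewrite (le_trans xa al).
Qed.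

Lemma chain_bounds a b L : chain a b L -> a <= b /\
  (forall i, (i < size L)%N -> [/\ a <= (nth (0, 0) L i).1,
     (nth (0, 0) L i).1 <= (nth (0, 0) L i).2 & (nth (0, 0) L i).2 <= b]) /\
  (forall i j, (i < j)%N -> (j < size L)%N ->
     (nth (0, 0) L i).2 <= (nth (0, 0) L j).1).
Proof.
elim: L a => [|[l r] L IH] a /=; first by move=> ->; split => //; split.
move=> /and3P[al lr /IH [rb [h1 h2]]]; split; last split.
- exact: le_trans al (le_trans lr rb).
- case=> [_ /=|i]; first by split.
  move=> /h1 [? ? ?]; split => //; exact: le_trans al (le_trans lr _).
- case=> [|i] [|j] //= ij jL; last exact: h2.
  by have [] := h1 j jL.
Qed.

(** Neighbours in a chain may share an end point, which is harmless because the intervals in the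
    definition are open. *)
Lemma chain_AC a b f : real_abs_continuous a b f -> forall e : R, 0 < e ->
  exists2 d : R, 0 < d & forall L, chain a b L ->
    \sum_(p <- L) (p.2 - p.1) < d -> \sum_(p <- L) `|f p.2 - f p.1| < e.
Proof.
move=> fAC e /fAC[d d0 H]; exists d => // L /chain_bounds[_ [h1 h2]].
rewrite !(big_nth (0, 0)) !big_mkord => Ld.
apply: (H _ (fun i => (nth (0, 0) L i).1) (fun i => (nth (0, 0) L i).2)) => //.
  by move=> i; have [] := h1 i (ltn_ord i).
move=> i j _ _ [x [/=]]; rewrite !in_itv/= => /andP[x1 x2] /andP[x3 x4].
apply/val_inj; have [ij|ji|//] := ltngtP (val i) (val j).
  have := h2 _ _ ij (ltn_ord j) => h.
  by have := lt_trans x2 (le_lt_trans h x3); rewrite ltxx.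
have h := h2 _ _ ji (ltn_ord i).
by have := lt_trans x4 (le_lt_trans h x1); rewrite ltxx.
Qed.

Fixpoint pairs x (s : seq R) : seq (R * R) :=
  if s is y :: s' then (x, y) :: pairs y s' else [::].

Lemma variation_pairs a b f s :
  variation a b f s = \sum_(p <- pairs a s) `|f p.2 - f p.1|.
Proof.
rewrite /variation /=; elim: s a => [|y s IH] a /=; first by rewrite big_geq ?big_nil.
rewrite big_nat_recl //= big_cons /= -IH; congr (_ + _).
Qed.

Lemma pairs_length x s : \sum_(p <- pairs x s) (p.2 - p.1) = last x s - x.
Proof.
elim: s x => [|y s IH] x /=; first by rewrite big_nil subrr.
by rewrite big_cons IH /=; ring.
Qed.

Lemma chain_pairs a b l s L : a <= l -> path <%R l s -> chain (last l s) b L ->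
  chain a b (pairs l s ++ L).
Proof.
elim: s a l => [|y s IH] a l al /=; first by move=> _; exact: chain_leL.
by move=> /andP[ly ys] h; rewrite al (ltW ly) /=; exact: IH.
Qed.

Lemma chain_refine a b l r s L2 L1 : itv_partition l r s ->
  chain a b (L2 ++ (l, r) :: L1) -> chain a b (L2 ++ pairs l s ++ L1).
Proof.
move=> [ls /eqP sr]; elim: L2 a => [|[x y] L2 IH] a /=.
  by move=> /and3P[al lr rb]; apply: chain_pairs => //; rewrite sr.
by move=> /and3P[-> -> /IH].
Qed.

Lemma chain_catr a b L2 L1 : chain a b (L2 ++ L1) -> exists c, chain c b L1.
Proof.
elim: L2 a => [|[x y] L2 IH] a /=; first by exists a.
by move=> /and3P[_ _ /IH].
Qed.

Lemma chain_drop a b p L2 L1 : chain a b (L2 ++ p :: L1) -> chain a b (L2 ++ L1).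
Proof.
elim: L2 a => [|[x y] L2 IH] a /=; last by move=> /and3P[-> -> /IH ->].
by case: p => l r /and3P[al lr]; apply: chain_leL; exact: le_trans al lr.
Qed.

Lemma sum_total_variation_ge0 a b f L : chain a b L ->
  (0 <= \sum_(p <- L) total_variation p.1 p.2 f)%E.
Proof.
elim: L a => [|[x y] L IH] a /=; first by rewrite big_nil.
move=> /and3P[_ xy /IH h]; rewrite big_cons; apply: adde_ge0 => //=.
exact: total_variation_ge0.
Qed.

(* The intervals of L1 are replaced one at a time by the cells of an arbitrary
   partition, the supremum over these partitions being taken last. *)
Lemma chain_total_variation a b f (d e : R) :
  (forall L, chain a b L -> \sum_(p <- L) (p.2 - p.1) < d ->
     \sum_(p <- L) `|f p.2 - f p.1| <= e) ->
  forall L1 L2, chain a b (L2 ++ L1) ->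
   \sum_(p <- L2 ++ L1) (p.2 - p.1) < d ->
   ((\sum_(p <- L2) `|f p.2 - f p.1|)%:E +
      \sum_(p <- L1) total_variation p.1 p.2 f <= e%:E)%E.
Proof.
move=> H; elim=> [|[l r] L1 IH] L2 cL dL.
  by rewrite big_nil adde0 lee_fin; apply: H; rewrite -(cats0 L2).
have [c /= /and3P[_ lr rL1]] := chain_catr cL.
have tv0 := sum_total_variation_ge0 f rL1.
rewrite big_cons /=.
set S := (\sum_(p <- L1) total_variation p.1 p.2 f)%E in tv0 *.
set A := \sum_(p <- L2) _.
move: lr; rewrite le_eqVlt => /predU1P[lr|lr].
  (* A degenerate interval is dropped at once: the one-cell partition used below needs [l < r]. *)
  rewrite lr total_variationxx add0e.
  have := IH (L2 ++ [::]); rewrite cats0; apply.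
    exact: chain_drop cL.
  by move: dL; rewrite !big_cat big_cons /= lr subrr add0r.
have key s : itv_partition l r s -> (A%:E + ((variation l r f s)%:E + S) <= e%:E)%E.
  move=> ps; have dL' : \sum_(p <- (L2 ++ pairs l s) ++ L1) (p.2 - p.1) < d.
    move: dL; rewrite !big_cat big_cons /= pairs_length addrA.
    by move: ps => [_ /eqP ->].
  have cL' : chain a b ((L2 ++ pairs l s) ++ L1).
    by rewrite -catA; exact: chain_refine ps cL.
  have := IH _ cL' dL'.
  by rewrite big_cat /= -/A -/S -(variation_pairs l r) EFinD -addeA.
(* [S] can be moved across the inequality only when finite; the bound for the one-cell partition
   already excludes [+oo]. *)
have Sfin : S \is a fin_num.
  rewrite ge0_fin_numE //; have := key _ (itv_partition1 lr).
  by case: S tv0 {IH key} => // r0; rewrite ?ltry // addey // addey.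
rewrite addeCA -leeBrDr ?fin_numD ?Sfin //.
apply: ge_ereal_sup => _ [_ [s ps <-] <-].
rewrite leeBrDr ?fin_numD ?Sfin // addeCA; exact: key.
Qed.

End Chain.

(** * Clamping to a segment, dyadic grids, and open sets approximated from inside *)

Section Monotone.
Context {R : realType}.
Notation mu := (@lebesgue_measure R).

(** Composition with [clamp] extends a function constantly beyond the segment, which turns facts on
    [[a, b]] into facts on the whole line. *)
Definition clamp (a b x : R) : R := Num.max a (Num.min b x).

Lemma clampE (a b x : R) : a <= x -> x <= b -> clamp a b x = x.
Proof. by move=> ax xb; rewrite /clamp (min_idPr xb) (max_idPr ax). Qed.

Lemma clamp_itv (a b x : R) : a <= b -> a <= clamp a b x <= b.
Proof. by move=> ab; rewrite /clamp le_max lexx /= ge_max ab ge_min lexx. Qed.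

Lemma clamp_le (a b x y : R) : x <= y -> clamp a b x <= clamp a b y.
Proof.
move=> xy; rewrite /clamp ge_max le_max lexx /= le_max orbC.
by rewrite le_min ge_min lexx /= ge_min xy orbT.
Qed.

Lemma clamp_lip (a b x y : R) : a <= b ->
  `|clamp a b x - clamp a b y| <= `|x - y|.
Proof.
move=> ab; wlog xy : x y / x <= y.
  move=> H; have [/H//|/ltW/H] := leP x y.
  by rewrite distrC (distrC x).
rewrite distrC (distrC x) !ger0_norm ?subr_ge0 ?clamp_le//.
rewrite /clamp /Num.max /Num.min.
by repeat case: ifPn => //=; rewrite -?leNgt => *; lra.
Qed.

Definition grid (a b : R) (n i : nat) : R := a + i%:R * ((b - a) / 2 ^+ n).

Lemma grid0 a b n : grid a b n 0 = a.
Proof. by rewrite /grid mul0r addr0. Qed.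

Lemma grid_last a b n : grid a b n (2 ^ n) = b.
Proof. by rewrite /grid natrX mulrCA mulfV ?expf_neq0// mulr1 addrC subrK. Qed.

Lemma grid_step a b n i : grid a b n i.+1 = grid a b n i + (b - a) / 2 ^+ n.
Proof. by rewrite /grid -natr1 mulrDl mul1r addrA. Qed.

Lemma grid_double a b n i : grid a b n.+1 i.*2 = grid a b n i.
Proof.
by rewrite /grid -mul2n natrM exprS invfM mulrA; congr (_ + _); field.
Qed.

Lemma grid_le a b n i j : a <= b -> (i <= j)%N -> grid a b n i <= grid a b n j.
Proof.
move=> ab ij; rewrite lerD2l ler_wpM2r ?ler_nat//.
by rewrite divr_ge0 ?subr_ge0 ?exprn_ge0.
Qed.

Lemma grid_find a b n x : a < x -> x <= b ->
  exists2 i, (i < 2 ^ n)%N & grid a b n i < x <= grid a b n i.+1.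
Proof.
move=> ax xb.
have ex : exists i, x <= grid a b n i by exists (2 ^ n)%N; rewrite grid_last.
case: (ex_minnP ex) => -[|i] xi imin; first by move: xi; rewrite grid0 leNgt ax.
exists i; last by rewrite xi andbT ltNge; apply/negP => /imin; rewrite ltnn.
by apply: imin; rewrite grid_last.
Qed.

Lemma grid_small a b (d : R) : 0 < d -> exists n, (b - a) / 2 ^+ n < d.
Proof.
move=> d0; have [ba|ab] := leP b a.
  by exists 0; rewrite expr0 divr1 (le_lt_trans _ d0)// subr_le0.
(* The Archimedean bound itself serves as exponent, because [n < 2 ^ n]. *)
exists (Num.bound ((b - a) / d)).
rewrite ltr_pdivrMr ?exprn_gt0// mulrC -ltr_pdivrMr//.
apply: lt_le_trans (archi_boundP _) _; first by rewrite divr_ge0 ?subr_ge0// ltW.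
by rewrite -natrX ler_nat ltnW// ltn_expl.
Qed.

Section DyadicInterior.
Variables (a b : R) (U : set R).
Hypothesis ab : a < b.

(* When the i-th dyadic interval is not contained in U, its right end point is
   moved to the left one, which makes the cell empty. *)
Definition dyadic_right n i : R :=
  if `[< `]grid a b n i, grid a b n i.+1] `<=` U >] then grid a b n i.+1
  else grid a b n i.

Definition dyadic_cell n i : set R := `]grid a b n i, dyadic_right n i].
(** A finite ordered union, to which the epsilon-delta property applies; it increases with [n] and
    exhausts the part of an open [U] in []a, b]], so a bound uniform in [n] passes to [U] by
    continuity of measures from below. *)
Definition dyadic_union n : set R := \big[setU/set0]_(i < 2 ^ n) dyadic_cell n i.

Lemma dyadic_right_bounds n i : grid a b n i <= dyadic_right n i <= grid a b n i.+1.
Proof.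
by rewrite /dyadic_right; case: ifP => _; rewrite ?lexx ?andbT ?grid_le// ltW.
Qed.

Lemma dyadic_cellP n i x : dyadic_cell n i x <->
  (grid a b n i < x <= grid a b n i.+1) /\
  `]grid a b n i, grid a b n i.+1] `<=` U.
Proof.
rewrite /dyadic_cell /dyadic_right; case: asboolP => h; rewrite /= in_itv/=.
  by split=> [|[]//].
by split=> [/andP[x1 x2]|[]//]; have := lt_le_trans x1 x2; rewrite ltxx.
Qed.

Lemma dyadic_unionP n x : dyadic_union n x <-> exists2 i, (i < 2 ^ n)%N & dyadic_cell n i x.
Proof.
rewrite /dyadic_union -(bigcup_mkord (2 ^ n) (dyadic_cell n)); split=> [[i /= ilt gx]|[i ilt gx]].
  by exists i.
by exists i.
Qed.

Lemma dyadic_union_sub n : dyadic_union n `<=` U.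
Proof.
by move=> x /dyadic_unionP[i _ /dyadic_cellP[h]]; apply; rewrite /= in_itv.
Qed.

(** Both halves of a dyadic interval contained in [U] are again contained in [U]. *)
Lemma dyadic_union_mono : {homo dyadic_union : n m / (n <= m)%N >-> (n <= m)%O}.
Proof.
apply/nondecreasing_seqP => n; rewrite subsetEset => x. move=> /dyadic_unionP[i i2 /dyadic_cellP[/andP[x1 x2] iU]].
apply/dyadic_unionP; have e1 : grid a b n.+1 i.*2 = grid a b n i := grid_double _ _ _ _.
have e2 : grid a b n.+1 i.*2.+2 = grid a b n i.+1 by rewrite -doubleS grid_double.
have l1 : grid a b n.+1 i.*2 <= grid a b n.+1 i.*2.+1 by apply: grid_le => //; exact: ltW.
have l2 : grid a b n.+1 i.*2.+1 <= grid a b n.+1 i.*2.+2 by apply: grid_le => //; exact: ltW.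
have [xm|xm] := leP x (grid a b n.+1 i.*2.+1).
  exists i.*2; first by rewrite expnS mul2n ltn_double.
  apply/dyadic_cellP; split; first by rewrite e1 x1.
  move=> y /=; rewrite in_itv/= => /andP[y1 y2]; apply: iU.
  by rewrite /= in_itv/= -e1 y1 -e2 (le_trans y2 l2).
exists i.*2.+1; first by rewrite expnS mul2n -doubleS leq_double.
apply/dyadic_cellP; split; first by rewrite e2 x2 xm.
move=> y /=; rewrite in_itv/= => /andP[y1 y2]; apply: iU.
by rewrite /= in_itv/= -e1 (le_lt_trans l1 y1) -e2.
Qed.

(** Some ball around the point lies in [U], and it contains the dyadic interval of the point as soon
    as the mesh is below its radius. *)
Lemma dyadic_union_cover : open U -> `]a, b] `&` U `<=` \bigcup_n dyadic_union n.
Proof.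
move=> oU x [/=]; rewrite in_itv/= => /andP[ax xb] Ux.
have [e /= e0 eU] : nbhs_ball x U by rewrite nbhs_ballE; apply: open_nbhs_nbhs.
have [n ne] := grid_small a b e0.
exists n => //; apply/dyadic_unionP.
have [i i2 /andP[x1 x2]] := grid_find n ax xb.
exists i => //; apply/dyadic_cellP; split; first by rewrite x1.
move=> y /=; rewrite in_itv/= => /andP[y1 y2]; apply: eU.
by rewrite /ball/=; move: x2 y2; rewrite grid_step => x2 y2; rewrite ltr_norml; apply/andP; split; lra.
Qed.

Lemma dyadic_cell_disjoint n : trivIset setT (fun i : 'I_(2 ^ n) => dyadic_cell n i).
Proof.
move=> i j _ _ [x [/dyadic_cellP[/andP[xi xi'] _] /dyadic_cellP[/andP[xj xj'] _]]].
apply/val_inj; have [ij|ji|//] := ltngtP (val i) (val j).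
  have := @grid_le a b n i.+1 j (ltW ab) ij => h.
  by have := lt_le_trans xj (le_trans xi' h); rewrite ltxx.
have := @grid_le a b n j.+1 i (ltW ab) ji => h.
by have := lt_le_trans xi (le_trans xj' h); rewrite ltxx.
Qed.

Lemma dyadic_chain n : chain a b [seq (grid a b n i, dyadic_right n i) | i <- iota 0 (2 ^ n)].
Proof.
have H m k : (k + m <= 2 ^ n)%N ->
   chain (grid a b n k) b [seq (grid a b n i, dyadic_right n i) | i <- iota k m].
  elim: m k => [|m IH] k /=.
    by rewrite addn0 => kn; rewrite -[leRHS](grid_last a b n) grid_le// ltW.
  rewrite addnS -addSn => /IH h; have /andP[g1 g2] := dyadic_right_bounds n k.
  by rewrite lexx g1 /=; exact: chain_leL h.
by have := H _ 0%N (leqnn (2 ^ n)%N); rewrite grid0.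
Qed.

End DyadicInterior.

End Monotone.

(** * The Stieltjes measure of a monotone function and its density *)

Section Density.
Context {R : realType}.
Notation mu := (@lebesgue_measure R).

(** The final bound is non-strict because it is applied to total variations, and suprema preserve
    only [<=]. *)
Definition chain_continuous (a b : R) (F : R -> R) := forall e : R, 0 < e ->
  exists2 d : R, 0 < d & forall L, chain a b L ->
    \sum_(p <- L) (p.2 - p.1) < d -> \sum_(p <- L) `|F p.2 - F p.1| <= e.

Section Stieltjes.
Variables (a b : R) (F : R -> R).
Hypothesis ab : a < b.
Hypothesis ndF : {in `[a, b] &, nondecreasing_fun F}.
Hypothesis acF : chain_continuous a b F.

Let G := F \o clamp a b.

Let ndG : {homo G : x y / x <= y}.
Proof.
move=> x y xy; apply: ndF; rewrite ?in_itv/=; first exact: clamp_itv (ltW ab).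
  exact: clamp_itv (ltW ab).
exact: clamp_le.
Qed.

Let GE x : a <= x -> x <= b -> G x = F x.
Proof. by move=> ax xb; rewrite /G /= clampE. Qed.

Let cG : right_continuous G.
Proof.
move=> x; apply/cvgrPdist_le => e e0; have [d d0 H] := acF e0.
near=> t; have xt : x <= t by near: t; exact: nbhs_right_ge.
have td : t < x + d by near: t; apply: nbhs_right_lt; rewrite ltrDl.
have := H [:: (clamp a b x, clamp a b t)].
rewrite !big_seq1 /= distrC; apply.
  have /andP[-> _] := clamp_itv x (ltW ab); rewrite clamp_le//=.
  by have /andP[_ ->] := clamp_itv t (ltW ab).
apply: le_lt_trans (ler_norm _) _; apply: le_lt_trans (clamp_lip _ _ (ltW ab)) _.
by rewrite ger0_norm ?subr_ge0//; lra.
Unshelve. all: by end_near. Qed.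

HB.instance Definition _ := isCumulative.Build R _ R G ndG cG.
Let GC : cumulative R R := G.

Let nu0 := lebesgue_stieltjes_measure GC.

Let nu0_oc x y : x <= y -> nu0 `]x, y] = (G y - G x)%:E.
Proof.
move=> xy; rewrite /nu0 /lebesgue_stieltjes_measure /measure_extension.
rewrite measurable_mu_extE/=; last exact: is_ocitv.
by rewrite wlength_itv_bnd.
Qed.

Let mD : measurable (`]a, b]%classic : set (measurableTypeR R)).
Proof. exact: measurable_itv. Qed.

Let nuDoo : (nu0 `]a, b] < +oo)%E.
Proof. by rewrite nu0_oc ?ltry// ltW. Qed.

Let nu := mfrestr mD nuDoo.

(** The cells form a chain whose total length is at most [mu U], while the Stieltjes measure of each
    cell is the increment of [F] over it. *)
Let dyadic_union_bound (U : set R) (d e : R) : open U -> (mu U < d%:E)%E ->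
  (forall L, chain a b L -> \sum_(p <- L) (p.2 - p.1) < d ->
    \sum_(p <- L) `|F p.2 - F p.1| <= e) ->
  forall n, (nu0 (dyadic_union a b U n) <= e%:E)%E.
Proof.
move=> oU Ud H n.
have mg i : measurable (dyadic_cell a b U n i : set (measurableTypeR R)).
  exact: measurable_itv.
have gb i := dyadic_right_bounds U ab n i.
have lenE : \sum_(i < 2 ^ n) (dyadic_right a b U n i - grid a b n i) < d.
  rewrite -lte_fin; apply: le_lt_trans Ud.
  apply: (@le_trans _ _ (mu (dyadic_union a b U n))); last first.
    apply: le_measure; rewrite ?inE.
    - exact: bigsetU_measurable.
    - exact: measurable_realfun.open_measurable.
    - exact: dyadic_union_sub.
  rewrite measure_bigsetU_ord//; last exact: dyadic_cell_disjoint.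
  rewrite -sumEFin; apply: lee_sum => i _.
  rewrite -[leRHS]/(mu [set` `]grid a b n i, dyadic_right a b U n i]]) lebesgue_measure_itv /= lte_fin; case: ltP => //= h.
  by rewrite lee_fin subr_le0.
have := H _ (dyadic_chain U ab n); rewrite !big_map.
rewrite -{1 2}(subn0 (2 ^ n)%N) -!/(index_iota 0 (2 ^ n)) !big_mkord => /(_ lenE).
rewrite -lee_fin; apply: le_trans.
have -> : nu0 (dyadic_union a b U n) = (\sum_(i < 2 ^ n) nu0 (dyadic_cell a b U n i))%E.
  by apply: measure_bigsetU_ord => //; exact: dyadic_cell_disjoint.
rewrite -sumEFin; apply: lee_sum => i _.
have /andP[g1 g2] := gb i.
have ga : a <= grid a b n i by rewrite -[leLHS](grid0 a b n) grid_le// ltW.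
have gb' : grid a b n i.+1 <= b.
  by rewrite -[leRHS](grid_last a b n) grid_le// ltW.
have h1 := le_trans ga g1; have h2 := le_trans g2 gb'; have h3 := le_trans g1 h2.
rewrite -[leLHS]/(nu0 [set` `]grid a b n i, dyadic_right a b U n i]]) nu0_oc// lee_fin.
by rewrite !GE// ler_norm.
Qed.

(** A null set is enclosed in an open set of length below [d]; its dyadic unions all have Stieltjes
    measure at most [e], and so has their limit. *)
Let nu_dom : nu `<< mu.
Proof.
apply/null_content_dominatesP => A mA A0.
rewrite /nu /mfrestr /mrestr; apply/eqP; rewrite eq_le measure_ge0 andbT.
apply/lee_addgt0Pr => e e0; rewrite add0e.
have [d d0 H] := acF e0.
set A' := A `&` `]a, b].
have mA' : measurable (A' : set (measurableTypeR R)) by exact: measurableI.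
have A'0 : mu A' = 0%E.
  by apply/eqP; rewrite eq_le measure_ge0 andbT -A0; apply: le_measure; rewrite ?inE//; exact: subIsetl.
have [|U [oU AU Ud]] := lebesgue_regularity_outer mA' _ d0.
  by apply: (@le_lt_trans _ _ 0%E); [rewrite -A'0|exact: ltry].
have mU : measurable (U : set (measurableTypeR R)) by exact: measurable_realfun.open_measurable.
(* Outer regularity bounds the difference of [U] and [A']; since [A'] is null, the same bound holds
   for [U]. *)
have Ud' : (mu U < d%:E)%E.
  apply: le_lt_trans Ud.
  rewrite -[leRHS]adde0 -A'0 -measureU//; last 2 first.
  - exact: measurableD.
  - by rewrite setDE -setIA (setIC _ A') setICr setI0.
  by apply: le_measure; rewrite ?inE//;
    [apply: measurableU => //; exact: measurableD|rewrite setUC setDUK].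
have mgU n : measurable (dyadic_union a b U n : set (measurableTypeR R)).
  by apply: bigsetU_measurable => i _; exact: measurable_itv.
have mB : measurable (\bigcup_n dyadic_union a b U n : set (measurableTypeR R)).
  exact: bigcupT_measurable.
apply: (@le_trans _ _ (nu0 (\bigcup_n dyadic_union a b U n))).
  apply: le_measure; rewrite ?inE//.
  by move=> x A'x; apply: dyadic_union_cover => //; split; [case: A'x|exact: AU].
have h : (nu0 \o dyadic_union a b U) x @[x --> \oo] --> nu0 (\bigcup_n dyadic_union a b U n).
  exact: nondecreasing_cvg_mu mgU mB (dyadic_union_mono U ab).
rewrite -(cvg_lim _ h)//.
apply: lime_le; first by apply/cvg_ex; eexists; exact: h.
by apply: nearW => n; exact: dyadic_union_bound Ud' H n.
Qed.

Lemma monotone_density : exists g : R -> R,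
  mu.-integrable `[a, b] (EFin \o g) /\
  forall x, a <= x -> x <= b -> F x = F a + \int[mu]_(t in `[a, x]) g t.
Proof.
have [f [f0 ff fi fE]] := radon_nikodym_sigma_finite nu_dom.
have fEF : EFin \o (fine \o f) = f by apply/funext => x /=; rewrite fineK.
exists (fine \o f); split.
  by rewrite fEF; exact: integrableS fi.
move=> x ax xb.
have : nu0 (`]a, x] `&` `]a, b]) = (\int[mu]_(t in `]a, x]) f t)%E.
  exact: fE (measurable_itv _).
rewrite setIidl; last first.
  by move=> y /=; rewrite !in_itv/= => /andP[-> /le_trans]; exact.
rewrite nu0_oc// !GE// ?(ltW ab)// => e.
rewrite -Rintegral_itv_obnd_cbnd; last first.
  by rewrite fEF; exact: integrableS fi.
rewrite /Rintegral -[X in fine (integral _ _ X)]/(EFin \o (fine \o f)) fEF -e /=.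
by rewrite addrC subrK.
Qed.

End Stieltjes.
End Density.

(** * Densities of absolutely continuous functions *)

Section ACDensity.
Context {R : realType}.
Notation mu := (@lebesgue_measure R).
Variables (a b : R) (f : R -> R).
Hypothesis ab : a < b.
Hypothesis acf : real_abs_continuous a b f.

Let acTV (e : R) : 0 < e -> exists2 d : R, 0 < d & forall L, chain a b L ->
  \sum_(p <- L) (p.2 - p.1) < d ->
  (\sum_(p <- L) total_variation p.1 p.2 f <= e%:E)%E.
Proof.
move=> e0; have [d d0 H] := chain_AC acf e0; exists d => // L cL dL.
have := @chain_total_variation _ a b f d e _ L [::] cL dL.
by rewrite big_nil add0e; apply => L' cL' dL'; apply/ltW/H.
Qed.

Let TV_fin x y : a <= x -> x <= y -> y <= b ->
  total_variation x y f \is a fin_num.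
Proof.
move=> ax xy yb; apply/(bounded_variationP _ xy).
suff /(bounded_variationP _ (ltW ab)) bv : total_variation a b f \is a fin_num.
  apply: (bounded_variationr ax xy); apply: (bounded_variationl _ yb bv).
  exact: le_trans ax xy.
(* Every cell of a grid of mesh below the [d] attached to [e = 1] has variation at most 1, and
   finitely many cells cover the segment. *)
have [d d0 H] := acTV ltr01; have [n nd] := grid_small a b d0.
suff h i : (i <= 2 ^ n)%N -> total_variation a (grid a b n i) f \is a fin_num.
  by have := h _ (leqnn _); rewrite grid_last.
elim: i => [|i IH] iN; first by rewrite grid0 total_variationxx.
have l0 : a <= grid a b n i by rewrite -[leLHS](grid0 a b n) grid_le// ltW.
have l1 : grid a b n i <= grid a b n i.+1 by rewrite grid_le// ltW.
have l2 : grid a b n i.+1 <= b by rewrite -[leRHS](grid_last a b n) grid_le// ltW.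
rewrite (total_variationD f l0 l1) fin_numD IH ?(ltnW iN)//=.
rewrite ge0_fin_numE ?total_variation_ge0//.
have := H [:: (grid a b n i, grid a b n i.+1)].
rewrite !big_seq1 /= l0 l1 l2 => h; apply: le_lt_trans (h _ _) (ltry 1) => //.
by rewrite grid_step addrAC subrr add0r.
Qed.

Let T x := fine (total_variation a x f).

Let TB x y : a <= x -> x <= y -> y <= b ->
  (T y - T x)%:E = total_variation x y f.
Proof.
move=> ax xy yb; rewrite /T (total_variationD f ax xy) fineD ?TV_fin//.
- by rewrite addrAC subrr add0r fineK// TV_fin.
- exact: le_trans xy yb.
Qed.

Let Tf x y : a <= x -> x <= y -> y <= b -> `|f y - f x| <= T y - T x.
Proof.
by move=> ax xy yb; rewrite -lee_fin TB//; exact: total_variation_ge.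
Qed.

Let ndT : {in `[a, b] &, nondecreasing_fun T}.
Proof.
move=> x y; rewrite !in_itv/= => /andP[ax _] /andP[_ yb] xy.
by rewrite -subr_ge0; apply: le_trans (Tf ax xy yb).
Qed.

Let N x := T x - f x.

Let ndN : {in `[a, b] &, nondecreasing_fun N}.
Proof.
move=> x y; rewrite !in_itv/= => /andP[ax _] /andP[_ yb] xy.
have := Tf ax xy yb; have := ler_norm (f y - f x); rewrite /N; lra.
Qed.

Lemma chain_in (L : seq (R * R)) (p : R * R) : chain a b L -> p \in L ->
  [/\ a <= p.1, p.1 <= p.2 & p.2 <= b].
Proof.
move=> /chain_bounds[_ [h _]] /(nthP (0, 0))[i iL <-].
by have [] := h _ iL.
Qed.

Let acT : chain_continuous a b T.
Proof.
move=> e e0; have [d d0 H] := acTV e0; exists d => // L cL dL.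
rewrite -lee_fin; apply: le_trans (H L cL dL); rewrite -sumEFin.
rewrite !big_seq; apply: lee_sum => p /(chain_in cL)[p1 p2 p3].
rewrite -TB// lee_fin ger0_norm// subr_ge0; apply: ndT => //; rewrite in_itv/=.
  by rewrite p1 (le_trans p2).
by rewrite p3 (le_trans p1).
Qed.

Let acN : chain_continuous a b N.
Proof.
move=> e e0; have e20 : 0 < e / 2 by rewrite divr_gt0.
have [d1 d10 H1] := acT e20; have [d2 d20 H2] := chain_AC acf e20.
exists (Num.min d1 d2); first by rewrite lt_min d10.
move=> L cL; rewrite lt_min => /andP[/(H1 _ cL) h1 /(H2 _ cL) h2].
apply: (@le_trans _ _ (\sum_(p <- L) (`|T p.2 - T p.1| + `|f p.2 - f p.1|))).
  apply: ler_sum => p _; apply: le_trans (ler_normB _ _).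
  by rewrite /N (_ : _ - _ - _ = T p.2 - T p.1 - (f p.2 - f p.1))//; ring.
rewrite big_split /=; lra.
Qed.

Lemma AC_density : exists g : R -> R,
  mu.-integrable `[a, b] (EFin \o g) /\
  forall x, a <= x -> x <= b -> f x = f a + \int[mu]_(t in `[a, x]) g t.
Proof.
have [g1 [i1 h1]] := monotone_density ab ndT acT.
have [g2 [i2 h2]] := monotone_density ab ndN acN.
exists (fun x => g1 x - g2 x); split.
  rewrite (_ : _ \o _ = (EFin \o g1) \- (EFin \o g2))%E; last exact/funext.
  exact: integrableB.
move=> x ax xb; have sub : `[a, x] `<=` `[a, b].
  by move=> y /=; rewrite !in_itv/= => /andP[-> /le_trans]; exact.
rewrite RintegralB//; [|exact: integrableS i1|exact: integrableS i2].
have -> : \int[mu]_(t in `[a, x]) g1 t = T x - T a.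
  by rewrite (h1 x ax xb) addrAC subrr add0r.
have -> : \int[mu]_(t in `[a, x]) g2 t = N x - N a.
  by rewrite (h2 x ax xb) addrAC subrr add0r.
by rewrite /N; ring.
Qed.

End ACDensity.

(** * The fundamental theorem of calculus for [derive1] *)

Section RealFTC.
Context {R : realType}.
Notation mu := (@lebesgue_measure R).
Implicit Types (a b x : R) (f g : R -> R).

Lemma continuous_clampP a b f : a <= b ->
  {within `[a, b], continuous f} <-> continuous (f \o clamp a b).
Proof.
move=> ab; split=> [/subspace_continuousP cf x|cf].
  have xab : `[a, b]%classic (clamp a b x) by rewrite /= in_itv/= clamp_itv.
  apply/cvgrPdist_lt => e e0.
  have /cvgrPdist_lt/(_ e e0) := cf _ xab.
  rewrite /= near_withinE => /nbhs_ballP[d /= d0 H].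
  apply/nbhs_ballP; exists d => // y xy /=; apply: H.
    by apply: le_lt_trans (clamp_lip _ _ ab) _.
  by rewrite /= in_itv/= clamp_itv.
apply/subspace_continuousP => x; rewrite /= in_itv/= => /andP[ax xb].
apply/cvgrPdist_lt => e e0; rewrite /= near_withinE.
have := cf x; rewrite /continuous_at /= clampE// => /cvgrPdist_lt/(_ e e0).
apply: filterS => y h; rewrite /= in_itv/= => /andP[ay yb].
by move: h; rewrite /= clampE.
Qed.

(* The difference quotients converge exactly on the set where they are Cauchy, which
   is a countable combination of closed sets; elsewhere derive1 f is the constant
   junk value of lim. *)
Lemma measurable_derive1 f : continuous f -> measurable_fun setT (derive1 f).
Proof.
move=> cf.
pose q h x := h^-1 *: (f (h + x) - f x).
have cq h : continuous (q h).
  move=> x; apply: (@cvgZr _ R^o); apply: cvgB; last exact: cf.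
  apply: continuous_comp; last exact: cf.
  by apply: cvgD; [exact: cvg_cst|exact: cvg_id].
pose W (k m : nat) := [set x | forall h h', 0 < `|h| < m.+1%:R^-1 ->
  0 < `|h'| < m.+1%:R^-1 -> `|q h x - q h' x| <= k.+1%:R^-1].
have cW k m : closed (W k m).
  rewrite (_ : W k m = \bigcap_(p in [set p : R * R |
     0 < `|p.1| < m.+1%:R^-1 /\ 0 < `|p.2| < m.+1%:R^-1])
     ((fun x => `|q p.1 x - q p.2 x|) @^-1` [set y | y <= k.+1%:R^-1])); last first.
    apply/seteqP; split=> [x Wx [h h'] /= [h0 h1]|x H h h' h0 h1]; first exact: Wx.
    by have /= := H (h, h') (conj h0 h1).
  apply: closed_bigI => -[h h'] _; apply: preimage_closed; last exact: closed_le.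
  move=> x _; apply: cvg_norm; apply: cvgB; exact: cq.
pose D := \bigcap_k \bigcup_m W k m.
have mD : measurable D.
  apply: bigcapT_measurable => k; apply: bigcupT_measurable => m.
  exact: closed_measurable.
have Dcvg x : D x <-> cvg (q h x @[h --> 0^']).
  split=> [Dx|/cvg_ex[l ql]].
    apply: cauchy_cvg; apply: cauchy_exP => e e0.
    have [k ke] : exists k : nat, k.+1%:R^-1 < e.
      exists (Num.bound e^-1); rewrite invf_plt ?posrE//.
      apply: lt_le_trans (archi_boundP _) _; first by rewrite invr_ge0 ltW.
      by rewrite ler_nat.
    have [m _ Wm] := Dx k I.
    pose h0 : R := m.+1%:R^-1 / 2.
    have m0 : 0 < m.+1%:R^-1 :> R by rewrite invr_gt0.
    have h00 : 0 < h0 by rewrite divr_gt0.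
    exists (q h0 x); apply/nbhs_ballP; exists m.+1%:R^-1 => //= h.
    rewrite /ball/= sub0r normrN => hm hn0.
    apply: le_lt_trans ke; apply: Wm.
      by rewrite (gtr0_norm h00) h00 /= /h0 gtr_pMr// invf_lt1 ?ltr1n.
    by rewrite normr_gt0 hn0 hm.
  move=> k _; have k0 : 0 < k.+1%:R^-1 / 2 :> R by rewrite divr_gt0 ?invr_gt0.
  have /cvgrPdist_lt/(_ _ k0)/nbhs_ballP[d /= d0 H] := ql.
  exists (Num.bound d^-1) => // h h' /andP[h0 hm] /andP[h'0 h'm].
  have md : (Num.bound d^-1).+1%:R^-1 < d.
    rewrite invf_plt ?posrE//.
    apply: lt_le_trans (archi_boundP _) _; first by rewrite invr_ge0 ltW.
    by rewrite ler_nat.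
  have H1 : `|l - q h x| < k.+1%:R^-1 / 2.
    apply: H; rewrite -?normr_gt0// /ball/= sub0r normrN; exact: lt_trans hm md.
  have H2 : `|l - q h' x| < k.+1%:R^-1 / 2.
    apply: H; rewrite -?normr_gt0// /ball/= sub0r normrN; exact: lt_trans h'm md.
  rewrite (_ : q h x - q h' x = (l - q h' x) - (l - q h x)); last by ring.
  apply: le_trans (ler_normB _ _) _.
  by rewrite [leRHS]splitr lerD// ltW.
(* On [D] the quotients along the steps [1 / (n + 1)] suffice; off [D] the limit operator returns
   [point]. *)
pose u (n : nat) (x : R) : R := \1_D x * q n.+1%:R^-1 x + \1_(~` D) x * (@point R).
have mu_ n : measurable_fun setT (u n).
  apply: measurable_funD; apply: measurable_funM.
  - exact: measurable_indic.
  - exact: continuous_measurable_fun.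
  - by apply: measurable_indic; exact: measurableC.
  - exact: measurable_cst.
apply: (measurable_fun_cvg mu_) => x _; rewrite /u.
have [Dx|Dx] := pselect (D x).
  rewrite !indicE (mem_set Dx) memNset; last by move=> /(_ Dx).
  under eq_fun do rewrite mul1r mul0r addr0.
  move/Dcvg : (Dx) => cx.
  have /cvgr_dnbhsP := cx; apply; split=> [n|]; last exact: cvg_harmonic.
  by rewrite invr_neq0.
rewrite !indicE (memNset Dx) mem_set//.
under eq_fun do rewrite mul1r mul0r add0r.
rewrite /derive1 dvgP//; first exact: cvg_cst.
by move=> /Dcvg.
Qed.

Lemma ae_imply (P Q : R -> Prop) : (forall x, P x -> Q x) ->
  {ae mu, forall x, P x} -> {ae mu, forall x, Q x}.
Proof. by move=> PQ; apply: filterS => //; exact: (ae_filter_ringOfSetsType mu). Qed.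

Lemma ae_and (P Q : R -> Prop) : {ae mu, forall x, P x} ->
  {ae mu, forall x, Q x} -> {ae mu, forall x, P x /\ Q x}.
Proof.
by move=> aP aQ; apply: filterI => //; exact: (ae_filter_ringOfSetsType mu).
Qed.

(** Agreement is asked on the open interval only, since the two-sided derivative at an end point
    depends on values outside the segment. *)
Lemma ae_eq_Rintegral a b f g : measurable_fun `[a, b] f ->
  measurable_fun `[a, b] g -> {ae mu, forall x, a < x < b -> f x = g x} ->
  \int[mu]_(x in `[a, b]) f x = \int[mu]_(x in `[a, b]) g x.
Proof.
move=> mf mg fg; rewrite /Rintegral; congr fine.
have sub : `]a, b[ `<=` `[a, b] by exact: subset_itv_oo_cc.
rewrite !(integral_itv_bndoo true false); last 2 first.
- by apply/measurable_EFinP; exact: measurable_funS mg.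
- by apply/measurable_EFinP; exact: measurable_funS mf.
apply: ae_eq_integral => //.
- by apply/measurable_EFinP; exact: measurable_funS mf.
- by apply/measurable_EFinP; exact: measurable_funS mg.
apply: ae_imply fg => x h; rewrite /= in_itv/= => xab.
by rewrite h.
Qed.

Lemma ae_eq_integrable a b f g : measurable_fun `[a, b] g ->
  {ae mu, forall x, a < x < b -> f x = g x} ->
  mu.-integrable `[a, b] (EFin \o f) -> mu.-integrable `[a, b] (EFin \o g).
Proof.
move=> mg fg /integrableP[mf fi]; apply/integrableP; split.
  exact/measurable_EFinP.
apply: le_lt_trans fi.
have sub : `]a, b[ `<=` `[a, b] by exact: subset_itv_oo_cc.
have mf' : measurable_fun `[a, b] (fun x => `|(EFin \o f) x|%E).
  exact: measurableT_comp.
have mg' : measurable_fun `[a, b] (fun x => `|(EFin \o g) x|%E).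
  by apply: measurableT_comp => //; exact/measurable_EFinP.
rewrite !(integral_itv_bndoo true false); last 2 first.
- exact: measurable_funS mf'.
- exact: measurable_funS mg'.
rewrite le_eqVlt; apply/orP; left; apply/eqP.
apply: ae_eq_integral => //.
- exact: measurable_funS mg'.
- exact: measurable_funS mf'.
apply: ae_imply fg => x h; rewrite /= in_itv/= => xab.
by rewrite h.
Qed.

Lemma primitive_derive a b c f g : mu.-integrable `[a, b] (EFin \o g) ->
  (forall x, a <= x -> x <= b -> f x = c + \int[mu]_(t in `[a, x]) g t) ->
  {ae mu, forall x, a < x < b -> is_derive x 1 f (g x)}.
Proof.
(* Extension by zero gives a function integrable on the line, as Lebesgue differentiation is applied
   there. *)
move=> gi fE; pose g' := g \_ `[a, b].
have lg : locally_integrable [set: R] g' by exact: integrable_locally.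
have ig : mu.-integrable setT (EFin \o g').
  by move: gi; rewrite integrable_mkcond// restrict_EFin.
have ig' y : mu.-integrable [set` Interval (BLeft a) (BRight y)] (EFin \o g').
  by apply: integrableS ig.
have := FTC1 ig' lg.
apply: ae_imply => x /= H /andP[ax xb].
have [|d e] := H; first by rewrite lte_fin.
have -> : g x = g' x.
  by rewrite /g' patchE mem_set//= in_itv/= !ltW.
rewrite -e.
apply: (@near_eq_is_derive _ _ _
  (fun x => c + \int[mu]_(t in `[a, x]) g' t)); last first.
  rewrite -[X in is_derive _ _ _ X]add0r; apply: is_deriveD.
  by rewrite derive1E; apply: DeriveDef.
near=> y.
have ay : a < y by near: y; exact: lt_nbhsr.
have yb : y < b by near: y; exact: lt_nbhsl.
rewrite fE ?ltW//; congr (_ + _); apply: eq_Rintegral => t.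
rewrite inE/= in_itv/= => /andP[t1 t2].
by rewrite /g' patchE mem_set//= in_itv/= t1 (le_trans t2)// ltW.
Unshelve. all: by end_near. Qed.

Lemma real_AC_continuous a b f : real_abs_continuous a b f ->
  {within `[a, b], continuous f}.
Proof.
move=> acf; apply/subspace_continuousP => x; rewrite /= in_itv/= => /andP[ax xb].
apply/cvgrPdist_lt => e e0; rewrite /= near_withinE.
have [d d0 H] := chain_AC acf e0.
apply/nbhs_ballP; exists d => // y; rewrite /ball/= => xy.
rewrite in_itv/= => /andP[ay yb].
have [lxy|lyx] := leP x y.
  have := H [:: (x, y)]; rewrite !big_seq1 /= ax lxy yb distrC => -> //.
  by apply: le_lt_trans xy; rewrite distrC ler_norm.
have := H [:: (y, x)]; rewrite !big_seq1 /= ay (ltW lyx) xb => -> //.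
by apply: le_lt_trans xy; rewrite ler_norm.
Qed.

Section AC.
Variables (a b : R) (f : R -> R).
Hypothesis ab : a < b.
Hypothesis acf : real_abs_continuous a b f.

(** The clamped function is continuous on the line and agrees with [f] near every interior point;
    the two end points do not affect measurability. *)
Lemma real_AC_measurable_derive1 : measurable_fun `[a, b] (derive1 f).
Proof.
have cF : continuous (f \o clamp a b).
  by apply/(continuous_clampP _ (ltW ab)); exact: real_AC_continuous.
have mF := measurable_derive1 cF.
apply: (@measurable_fun_itv_cc _ _ _ false true).
apply: (@eq_measurable_fun _ _ _ _ _ (derive1 (f \o clamp a b))); last first.
  exact: measurable_funS mF.
move=> x; rewrite inE/= in_itv/= => /andP[ax xb].
rewrite !derive1E; apply: near_eq_derive; near=> y.
have ay : a < y by near: y; exact: lt_nbhsr.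
have yb : y < b by near: y; exact: lt_nbhsl.
by rewrite /= clampE// ltW.
Unshelve. all: by end_near. Qed.

Let density : exists g, [/\ mu.-integrable `[a, b] (EFin \o g),
  (forall x, a <= x -> x <= b -> f x = f a + \int[mu]_(t in `[a, x]) g t) &
  {ae mu, forall x, a < x < b -> is_derive x 1 f (g x)}].
Proof.
have [g [gi gE]] := AC_density ab acf.
by exists g; split => //; exact: primitive_derive gE.
Qed.

Lemma real_AC_is_derive :
  {ae mu, forall x, a < x < b -> is_derive x 1 f ((derive1 f) x)}.
Proof.
have [g [_ _ ]] := density; apply: ae_imply => x H /H D.
by rewrite derive1E derive_val.
Qed.

Lemma real_AC_integrable : mu.-integrable `[a, b] (EFin \o (derive1 f)).
Proof.
have [g [gi _ gd]] := density.
apply: ae_eq_integrable gi; first exact: real_AC_measurable_derive1.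
apply: ae_imply gd => x H /H D.
by rewrite derive1E derive_val.
Qed.

(** The abstract Radon-Nikodym density is exchanged for [derive1 f], the derivative in which the
    equation itself is written. *)
Lemma real_AC_FTC x : a <= x -> x <= b ->
  f x = f a + \int[mu]_(t in `[a, x]) (derive1 f) t.
Proof.
move=> ax xb; have [g [gi gE gd]] := density.
have sub : `[a, x] `<=` `[a, b].
  by move=> y /=; rewrite !in_itv/= => /andP[-> /le_trans]; exact.
rewrite gE//; congr (_ + _); apply: ae_eq_Rintegral.
- apply/measurable_EFinP.
  by case/integrableP : gi => + _; exact: measurable_funS.
- exact: measurable_funS real_AC_measurable_derive1.
apply: ae_imply gd => y H /andP[ay yx].
have D := H _; rewrite derive1E (@derive_val _ _ _ _ _ _ _ (D _))//.
by rewrite ay (lt_le_trans yx).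
Qed.

End AC.
End RealFTC.

(** * Complex-valued functions of a real variable *)

Local Open Scope complex_scope.
Local Notation Re := complex.Re.
Local Notation Im := complex.Im.

(** * Modulus and exponential *)

Section ComplexModulus.
Context {R : realType}.
Local Notation C := R[i].
Implicit Types (z w : C) (t x : R).

Lemma ReD z w : Re (z + w) = Re z + Re w. Proof. by case: z w => ? ? []. Qed.
Lemma ImD z w : Im (z + w) = Im z + Im w. Proof. by case: z w => ? ? []. Qed.
Lemma ReN z : Re (- z) = - Re z. Proof. by case: z. Qed.
Lemma ImN z : Im (- z) = - Im z. Proof. by case: z. Qed.
Lemma ReM z w : Re (z * w) = Re z * Re w - Im z * Im w.
Proof. by case: z w => ? ? []. Qed.
Lemma ImM z w : Im (z * w) = Re z * Im w + Im z * Re w.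
Proof. by case: z w => ? ? []. Qed.
Lemma ReV z : Re z^-1 = Re z / (Re z ^+ 2 + Im z ^+ 2).
Proof. by case: z. Qed.
Lemma ImV z : Im z^-1 = - (Im z / (Re z ^+ 2 + Im z ^+ 2)).
Proof. by case: z. Qed.

Lemma complex_eq z w : Re z = Re w -> Im z = Im w -> z = w.
Proof. by case: z w => ? ? [? ?] /= -> ->. Qed.

Definition complexReImE := (ReD, ImD, ReN, ImN, ReM, ImM).

Lemma Re_sum (I : Type) (r : seq I) (P : pred I) (F : I -> C) :
  Re (\sum_(i <- r | P i) F i) = \sum_(i <- r | P i) Re (F i).
Proof. by apply: (big_morph _ ReD). Qed.
Lemma Im_sum (I : Type) (r : seq I) (P : pred I) (F : I -> C) :
  Im (\sum_(i <- r | P i) F i) = \sum_(i <- r | P i) Im (F i).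
Proof. by apply: (big_morph _ ImD). Qed.

Lemma cabsE z : cabs z = Num.sqrt (Re z ^+ 2 + Im z ^+ 2).
Proof. by case: z. Qed.

Lemma cabs_ge0 z : 0 <= cabs z.
Proof. by rewrite cabsE sqrtr_ge0. Qed.

Lemma cabsM z w : cabs (z * w) = cabs z * cabs w.
Proof. exact: Normc.normcM. Qed.

Lemma cabsD z w : cabs (z + w) <= cabs z + cabs w.
Proof. exact: le_normcD. Qed.

Lemma cabsN z : cabs (- z) = cabs z.
Proof. by rewrite !cabsE ReN ImN !sqrrN. Qed.

Lemma cabsB z w : cabs (z - w) <= cabs z + cabs w.
Proof. by rewrite -(cabsN w) cabsD. Qed.

Lemma cabs_distC z w : cabs (z - w) = cabs (w - z).
Proof. by rewrite -cabsN opprB. Qed.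

Lemma cabs0 : cabs (0 : C) = 0.
Proof. by rewrite cabsE /= expr0n /= addr0 sqrtr0. Qed.

Lemma cabs_eq0 z : (cabs z == 0) = (z == 0).
Proof.
by apply/eqP/eqP => [/Normc.eq0_normc//|->]; exact: cabs0.
Qed.

Lemma cabs_gt0 z : (0 < cabs z) = (z != 0).
Proof. by rewrite lt_neqAle cabs_ge0 andbT eq_sym cabs_eq0. Qed.

Lemma cabsV z : cabs z^-1 = (cabs z)^-1.
Proof. exact: Normc.normcV. Qed.

Lemma cabs1 : cabs (1 : C) = 1. Proof. exact: Normc.normc1. Qed.

Lemma cabsX z n : cabs (z ^+ n) = cabs z ^+ n.
Proof. by elim: n => [|n IH]; rewrite ?cabs1// !exprS cabsM IH. Qed.

Lemma cabs_real x : cabs (x%:C) = `|x|.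
Proof. by rewrite cabsE /= expr0n addr0 sqrtr_sqr. Qed.

Lemma Re_le_cabs z : `|Re z| <= cabs z.
Proof. by rewrite cabsE -sqrtr_sqr ler_wsqrtr// lerDl sqr_ge0. Qed.

Lemma Im_le_cabs z : `|Im z| <= cabs z.
Proof. by rewrite cabsE -sqrtr_sqr ler_wsqrtr// lerDr sqr_ge0. Qed.

Lemma cabs_le z : cabs z <= `|Re z| + `|Im z|.
Proof.
rewrite cabsE -[leRHS]ger0_norm ?addr_ge0// -sqrtr_sqr ler_wsqrtr//.
rewrite sqrrD !real_normK ?num_real// addrAC lerDl mulrn_wge0// mulr_ge0//.
Qed.

Lemma cabs_sqr z : cabs z ^+ 2 = Re z ^+ 2 + Im z ^+ 2.
Proof. by rewrite cabsE sqr_sqrtr// addr_ge0 ?sqr_ge0. Qed.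

Lemma real_complexM x y : (x * y)%:C = x%:C * y%:C :> C.
Proof. by rewrite rmorphM. Qed.

Lemma cisD s t : cis (s + t) = cis s * cis t :> C.
Proof.
rewrite /cis cosD sinD; apply: complex_eq; rewrite ?ReM ?ImM /=; ring.
Qed.

Lemma cis0 : cis 0 = 1 :> C.
Proof. by rewrite /cis cos0 sin0. Qed.

Lemma cabs_cis t : cabs (cis t : C) = 1.
Proof. by rewrite cabsE /= cos2Dsin2 sqrtr1. Qed.

Lemma cexpD z w : cexp (z + w) = cexp z * cexp w.
Proof.
rewrite /cexp ReD ImD expRD cisD real_complexM; ring.
Qed.

Lemma cexp0 : cexp (0 : C) = 1.
Proof. by rewrite /cexp /= expR0 cis0 mulr1. Qed.

Lemma cexp_neq0 z : cexp z != 0.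
Proof.
by rewrite -cabs_gt0 /cexp cabsM cabs_cis mulr1 cabs_real normr_gt0 gt_eqF ?expR_gt0.
Qed.

Lemma cabs_cexp z : cabs (cexp z) = expR (Re z).
Proof. by rewrite /cexp cabsM cabs_cis mulr1 cabs_real ger0_norm ?expR_ge0. Qed.

End ComplexModulus.

(** * Continuity of complex-valued functions on a segment *)

Section ComplexContinuity.
Context {R : realType}.
Local Notation C := R[i].
Implicit Types (f g : R -> C) (a b : R).

Lemma cont_ext (A : set R) (u v : R -> R) : u =1 v ->
  {within A, continuous v} -> {within A, continuous u}.
Proof. by move=> /funext ->. Qed.

Lemma ccont_cst a b (c : C) : ccontinuous_on a b (fun=> c).
Proof. by split=> x; exact: cvg_cst. Qed.

Lemma ccontD a b f g : ccontinuous_on a b f -> ccontinuous_on a b g ->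
  ccontinuous_on a b (fun x => f x + g x).
Proof.
move=> [f1 f2] [g1 g2]; split.
  apply: (cont_ext (fun x => ReD (f x) (g x))) => x.
  by apply: cvgD; [exact: f1|exact: g1].
apply: (cont_ext (fun x => ImD (f x) (g x))) => x.
by apply: cvgD; [exact: f2|exact: g2].
Qed.

Lemma ccontN a b f : ccontinuous_on a b f -> ccontinuous_on a b (fun x => - f x).
Proof.
move=> [f1 f2]; split.
  by apply: (cont_ext (fun x => ReN (f x))) => x; apply: cvgN; exact: f1.
by apply: (cont_ext (fun x => ImN (f x))) => x; apply: cvgN; exact: f2.
Qed.

Lemma ccontM a b f g : ccontinuous_on a b f -> ccontinuous_on a b g ->
  ccontinuous_on a b (fun x => f x * g x).
Proof.
move=> [f1 f2] [g1 g2]; split.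
  apply: (cont_ext (fun x => ReM (f x) (g x))) => x.
  by apply: cvgB; apply: cvgM; [exact: f1|exact: g1|exact: f2|exact: g2].
apply: (cont_ext (fun x => ImM (f x) (g x))) => x.
by apply: cvgD; apply: cvgM; [exact: f1|exact: g2|exact: f2|exact: g1].
Qed.

Lemma cont_sqr (A : set R) (f : R -> R) : {within A, continuous f} ->
  {within A, continuous (fun x => f x ^+ 2)}.
Proof. by move=> cf; apply: (cont_ext (fun x => expr2 (f x))) => x; apply: cvgM; exact: cf. Qed.

Lemma cont_cabs a b f : ccontinuous_on a b f ->
  {within `[a, b], continuous (fun x => cabs (f x))}.
Proof.
move=> [f1 f2]; apply: (cont_ext (fun x => cabsE (f x))) => x.
apply: (@continuous_comp _ _ _ (fun x => _ : R) Num.sqrt); last first.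
  exact: sqrt_continuous.
by apply: cvgD; apply: cont_sqr.
Qed.

Lemma ccontV a b f : ccontinuous_on a b f ->
  (forall x, a <= x <= b -> f x != 0) -> ccontinuous_on a b (fun x => (f x)^-1).
Proof.
move=> [f1 f2] f0.
have H (u : R -> R) : {within `[a, b], continuous u} ->
   {within `[a, b], continuous (fun x => u x / (Re (f x) ^+ 2 + Im (f x) ^+ 2))}.
  move=> cu; apply/subspace_continuousP => x; rewrite /= in_itv/= => xab.
  have N0 : Re (f x) ^+ 2 + Im (f x) ^+ 2 != 0.
    by rewrite -cabs_sqr expf_eq0 /= cabs_eq0 f0.
  have g1 : {within `[a, b], continuous (fun x => Re (f x) ^+ 2 + Im (f x) ^+ 2)}.
    by move=> t; apply: cvgD; apply: cont_sqr.
  move/subspace_continuousP : g1 => g1; move/subspace_continuousP : cu => cu.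
  by apply: cvgM; [exact: cu|apply: cvgV => //; exact: g1].
split.
  by apply: (cont_ext (fun x => ReV (f x))); exact: H.
apply: (cont_ext (fun x => ImV (f x))) => x; apply: cvgN; exact: (H _ f2).
Qed.

Lemma ccont_cexp a b f : ccontinuous_on a b f ->
  ccontinuous_on a b (fun x => cexp (f x)).
Proof.
move=> [f1 f2].
have e1 : {within `[a, b], continuous (fun x => expR (Re (f x)))}.
  move=> x; apply: (@continuous_comp _ _ _ (fun x => _ : R) expR); first exact: f1.
  exact: continuous_expR.
split; rewrite /cexp.
  have E x : Re ((expR (Re (f x)))%:C * cis (Im (f x))) =
      expR (Re (f x)) * cos (Im (f x)) by rewrite ReM /= mul0r subr0.
  apply: (cont_ext E) => x; apply: cvgM; first exact: e1.
  apply: (@continuous_comp _ _ _ (fun x => _ : R) cos); first exact: f2.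
  exact: continuous_cos.
have E x : Im ((expR (Re (f x)))%:C * cis (Im (f x))) =
    expR (Re (f x)) * sin (Im (f x)) by rewrite ImM /= mul0r addr0.
apply: (cont_ext E) => x; apply: cvgM; first exact: e1.
apply: (@continuous_comp _ _ _ (fun x => _ : R) sin); first exact: f2.
exact: continuous_sin.
Qed.

Lemma ccont_bounded a b f : a <= b -> ccontinuous_on a b f ->
  exists2 M, 0 < M & forall x, a <= x <= b -> cabs (f x) <= M.
Proof.
move=> ab /cont_cabs/(EVT_max ab)[c _ H].
exists (cabs (f c) + 1); first by rewrite ltr_wpDl// cabs_ge0.
by move=> x xab; apply: le_trans (H x _) _; rewrite ?in_itv// lerDl.
Qed.

Lemma ccont_lower a b f : a <= b -> ccontinuous_on a b f ->
  (forall x, a <= x <= b -> f x != 0) ->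
  exists2 m, 0 < m & forall x, a <= x <= b -> m <= cabs (f x).
Proof.
move=> ab /cont_cabs/(EVT_min ab)[c]; rewrite in_itv/= => cab H f0.
exists (cabs (f c)); first by rewrite cabs_gt0 f0.
by move=> x xab; apply: H; rewrite in_itv.
Qed.

Lemma ccont_eq a b f g : (forall x, a <= x <= b -> f x = g x) ->
  ccontinuous_on a b f -> ccontinuous_on a b g.
Proof.
move=> fg [/subspace_continuousP f1 /subspace_continuousP f2].
have H (pr : C -> R) :
    (forall x, `[a, b]%classic x ->
       pr (f y) @[y --> within `[a, b]%classic (nbhs x)] --> pr (f x)) ->
    {within `[a, b], continuous (fun x => pr (g x))}.
  move=> cf; apply/subspace_continuousP => x xab; rewrite /from_subspace.
  rewrite (_ : pr (g x) = pr (f x)); last by rewrite fg//; move: xab; rewrite /= in_itv.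
  apply: cvg_trans (cf x xab); apply: near_eq_cvg; rewrite near_withinE.
  by near=> y; rewrite /= in_itv/= => yab; rewrite fg.
by split; exact: H.
Unshelve. all: by end_near. Qed.

End ComplexContinuity.

(** * Derivatives of complex-valued functions *)

Section ComplexDerivative.
Context {R : realType}.
Local Notation C := R[i].
Implicit Types (f g : R -> C) (x : R).

(** A relation that includes existence, whereas [cderiv] has a default value where the derivative
    does not exist. *)
Definition cder f x (d : C) : Prop :=
  is_derive x 1 (fun t => Re (f t)) (Re d) /\
  is_derive x 1 (fun t => Im (f t)) (Im d).

Lemma cder_eq f x d d' : d = d' -> cder f x d -> cder f x d'.
Proof. by move=> ->. Qed.

Lemma cder_unique f x d d' : cder f x d -> cder f x d' -> d = d'.
Proof.
move=> [h1 h2] [h1' h2']; apply: complex_eq.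
  by rewrite -(@derive_val _ _ _ _ _ _ _ h1) (@derive_val _ _ _ _ _ _ _ h1').
by rewrite -(@derive_val _ _ _ _ _ _ _ h2) (@derive_val _ _ _ _ _ _ _ h2').
Qed.

Lemma cder_cderiv f x d : cder f x d -> cderiv f x = d.
Proof.
move=> [h1 h2]; rewrite /cderiv !derive1E.
rewrite (@derive_val _ _ _ _ _ _ _ h1) (@derive_val _ _ _ _ _ _ _ h2).
by case: d {h1 h2}.
Qed.

Lemma is_derive_ext (u v : R -> R) x d : u =1 v -> is_derive x 1 v d ->
  is_derive x 1 u d.
Proof. by move=> /funext ->. Qed.

Lemma is_derive_mul (u v : R -> R) x du dv : is_derive x 1 u du -> is_derive x 1 v dv ->
  is_derive x 1 (fun t => u t * v t) (u x * dv + v x * du).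
Proof. exact: is_deriveM. Qed.

Lemma is_derive_add (u v : R -> R) x du dv : is_derive x 1 u du -> is_derive x 1 v dv ->
  is_derive x 1 (fun t => u t + v t) (du + dv).
Proof. exact: is_deriveD. Qed.

Lemma is_derive_sub (u v : R -> R) x du dv : is_derive x 1 u du -> is_derive x 1 v dv ->
  is_derive x 1 (fun t => u t - v t) (du - dv).
Proof. exact: is_deriveB. Qed.

Lemma cder_near f g x d : (\near x, f x = g x) -> cder f x d -> cder g x d.
Proof.
move=> fg [h1 h2]; split.
  by apply: near_eq_is_derive h1; apply: filterS fg => t ->.
by apply: near_eq_is_derive h2; apply: filterS fg => t ->.
Qed.

Lemma cder_cst (c : C) x : cder (fun=> c) x 0.
Proof. by split; exact: is_derive_cst. Qed.

Lemma cderD f g x df dg : cder f x df -> cder g x dg ->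
  cder (fun t => f t + g t) x (df + dg).
Proof.
move=> [f1 f2] [g1 g2]; split.
  by rewrite ReD; apply: (is_derive_ext (fun t => ReD (f t) (g t))); exact: is_deriveD.
by rewrite ImD; apply: (is_derive_ext (fun t => ImD (f t) (g t))); exact: is_deriveD.
Qed.

Lemma cderM f g x df dg : cder f x df -> cder g x dg ->
  cder (fun t => f t * g t) x (df * g x + f x * dg).
Proof.
move=> [f1 f2] [g1 g2]; split.
  apply: (is_derive_ext (fun t => ReM (f t) (g t))).
  apply: is_derive_eq (is_derive_sub (is_derive_mul f1 g1) (is_derive_mul f2 g2)) _.
  by rewrite !complexReImE /=; ring.
apply: (is_derive_ext (fun t => ImM (f t) (g t))).
apply: is_derive_eq (is_derive_add (is_derive_mul f1 g2) (is_derive_mul f2 g1)) _.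
by rewrite !complexReImE /=; ring.
Qed.

Lemma cderZ (c : C) f x df : cder f x df -> cder (fun t => c * f t) x (c * df).
Proof.
move=> h; apply: cder_eq (cderM (cder_cst c x) h); rewrite mul0r add0r //.
Qed.

Lemma cder_cexp f x d : cder f x d ->
  cder (fun t => cexp (f t)) x (d * cexp (f x)).
Proof.
move=> [h1 h2]; rewrite /cexp.
have e1 : is_derive x 1 (fun t => expR (Re (f t))) (Re d * expR (Re (f x))).
  apply: is_derive_eq (@is_derive1_comp _ expR (fun t => Re (f t)) x _ _ (is_derive_expR _) h1) _.
  by rewrite mulrC.
have e2 : is_derive x 1 (fun t => cos (Im (f t))) (- (Im d * sin (Im (f x)))).
  apply: is_derive_eq (@is_derive1_comp _ cos (fun t => Im (f t)) x _ _ (is_derive_cos _) h2) _.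
  by rewrite mulNr mulrC.
have e3 : is_derive x 1 (fun t => sin (Im (f t))) (Im d * cos (Im (f x))).
  apply: is_derive_eq (@is_derive1_comp _ sin (fun t => Im (f t)) x _ _ (is_derive_sin _) h2) _.
  by rewrite mulrC.
split.
  have E t : Re ((expR (Re (f t)))%:C * cis (Im (f t))) =
      expR (Re (f t)) * cos (Im (f t)) by rewrite ReM /= mul0r subr0.
  apply: (is_derive_ext E); apply: is_derive_eq (is_derive_mul e1 e2) _.
  by rewrite !complexReImE /=; ring.
have E t : Im ((expR (Re (f t)))%:C * cis (Im (f t))) =
    expR (Re (f t)) * sin (Im (f t)) by rewrite ImM /= mul0r addr0.
apply: (is_derive_ext E); apply: is_derive_eq (is_derive_mul e1 e3) _.
by rewrite !complexReImE /=; ring.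
Qed.

End ComplexDerivative.

(** * Integrals of complex-valued functions *)

Section ComplexIntegral.
Context {R : realType}.
Local Notation C := R[i].
Local Notation mu := (@lebesgue_measure R).
Implicit Types (f g : R -> C) (a b c x : R).

Lemma within_integrable a b (u : R -> R) : {within `[a, b], continuous u} ->
  mu.-integrable `[a, b] (EFin \o u).
Proof. by move=> cu; apply: continuous_compact_integrable => //; exact: segment_compact. Qed.

Lemma within_measurable a b (u : R -> R) : {within `[a, b], continuous u} ->
  measurable_fun `[a, b] u.
Proof. by move=> /within_integrable/integrableP[/measurable_EFinP]. Qed.

Lemma within_bounded a b (u : R -> R) : a <= b ->
  {within `[a, b], continuous u} -> [bounded u x | x in `[a, b]].
Proof.
move=> ab cu.
have cn : {within `[a, b], continuous (fun x => `|u x|)}.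
  by move=> x; apply: cvg_norm; exact: cu.
have [c _ H] := EVT_max ab cn.
exists `|u c|; split; first exact: num_real.
by move=> M cM x xab /=; apply: le_trans (H x xab) (ltW cM).
Qed.

Lemma integrable_contM a b (u v : R -> R) : a <= b ->
  {within `[a, b], continuous u} -> mu.-integrable `[a, b] (EFin \o v) ->
  mu.-integrable `[a, b] (EFin \o (fun x => u x * v x)).
Proof.
move=> ab cu iv.
rewrite (_ : _ \o _ = ((EFin \o u) \* (EFin \o v))%E); last exact/funext.
by apply: integrableMr => //; [exact: within_measurable|exact: within_bounded].
Qed.

Lemma L1_cont a b f : ccontinuous_on a b f -> L1 `[a, b] f.
Proof. by move=> [f1 f2]; split; exact: within_integrable. Qed.

Lemma L1_ext (D : set R) f g : f =1 g -> L1 D f -> L1 D g.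
Proof. by move=> /funext ->. Qed.

Lemma L1D a b f g : L1 `[a, b] f -> L1 `[a, b] g -> L1 `[a, b] (fun x => f x + g x).
Proof.
move=> [f1 f2] [g1 g2]; split.
  rewrite (_ : (fun x => (Re (f x + g x))%:E) = ((fun x => (Re (f x))%:E) \+ (fun x => (Re (g x))%:E))%E).
    exact: integrableD.
  by apply/funext => x; rewrite ReD EFinD.
rewrite (_ : (fun x => (Im (f x + g x))%:E) = ((fun x => (Im (f x))%:E) \+ (fun x => (Im (g x))%:E))%E).
  exact: integrableD.
by apply/funext => x; rewrite ImD EFinD.
Qed.

Lemma L1M a b f g : a <= b -> ccontinuous_on a b f -> L1 `[a, b] g ->
  L1 `[a, b] (fun x => f x * g x).
Proof.
move=> ab [f1 f2] [g1 g2]; split.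
  rewrite (_ : (fun x => (Re (f x * g x))%:E) =
    (fun x => (EFin \o (fun x => Re (f x) * Re (g x))%R) x -
              (EFin \o (fun x => Im (f x) * Im (g x))%R) x)%E).
    by apply: integrableB => //; apply: integrable_contM.
  by apply/funext => x; rewrite ReM EFinB.
rewrite (_ : (fun x => (Im (f x * g x))%:E) =
  ((EFin \o (fun x => Re (f x) * Im (g x))%R) \+
            (EFin \o (fun x => Im (f x) * Re (g x))%R))%E).
  by apply: integrableD => //; apply: integrable_contM.
by apply/funext => x; rewrite ImM EFinD.
Qed.

Lemma L1Z a b (c : C) g : a <= b -> L1 `[a, b] g -> L1 `[a, b] (fun x => c * g x).
Proof. by move=> ab; apply: L1M => //; exact: ccont_cst. Qed.

Lemma L1S a b a' b' f : a <= a' -> b' <= b -> L1 `[a, b] f -> L1 `[a', b'] f.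
Proof.
move=> aa bb [f1 f2]; have sub : `[a', b'] `<=` `[a, b].
  move=> y /=; rewrite !in_itv/= => /andP[h1 h2].
  by rewrite (le_trans aa h1) (le_trans h2 bb).
by split; [exact: integrableS f1|exact: integrableS f2].
Qed.

Lemma L1_cabs a b f : L1 `[a, b] f -> mu.-integrable `[a, b] (EFin \o (fun x => cabs (f x))).
Proof.
move=> [f1 f2].
have ig : mu.-integrable `[a, b]
    ((abse \o (fun x => (Re (f x))%:E)) \+ (abse \o (fun x => (Im (f x))%:E)))%E.
  by apply: integrableD => //; exact: integrable_abse.
apply: le_integrable ig => //.
- apply/measurable_EFinP.
  move/integrableP : f1 => [/measurable_EFinP m1 _].
  move/integrableP : f2 => [/measurable_EFinP m2 _].
  rewrite (_ : (fun x => cabs (f x)) =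
    (fun x => Num.sqrt (Re (f x) ^+ 2 + Im (f x) ^+ 2))); last first.
    by apply/funext => x; rewrite cabsE.
  apply: (measurableT_comp (continuous_measurable_fun (@sqrt_continuous R))).
  by apply: measurable_funD; exact: measurable_funX.
- move=> x _ /=; rewrite lee_fin ger0_norm ?cabs_ge0// ger0_norm ?addr_ge0//.
  exact: cabs_le.
Qed.

Lemma cint_eq a b f g : (forall x, a <= x <= b -> f x = g x) ->
  cint a b f = cint a b g.
Proof.
move=> fg; rewrite /cint; congr (_ +i* _); apply: eq_Rintegral => x;
  by rewrite inE/= in_itv/= => h; rewrite fg.
Qed.

Lemma cintD a b f g : L1 `[a, b] f -> L1 `[a, b] g ->
  cint a b (fun x => f x + g x) = cint a b f + cint a b g.
Proof.
move=> [f1 f2] [g1 g2]; apply: complex_eq; rewrite ?ReD ?ImD /cint /=.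
  by rewrite -RintegralD//; apply: eq_Rintegral => x _; rewrite ReD.
by rewrite -RintegralD//; apply: eq_Rintegral => x _; rewrite ImD.
Qed.

Lemma cintZ a b (c : C) f : L1 `[a, b] f ->
  cint a b (fun x => c * f x) = c * cint a b f.
Proof.
move=> [f1 f2].
have iZ (k : R) u : mu.-integrable `[a, b] (EFin \o u) ->
    mu.-integrable `[a, b] (EFin \o (fun x => k * u x)).
  move=> iu; rewrite (_ : _ \o _ = (fun x => k%:E * (EFin \o u) x)%E).
    exact: integrableZl.
  by apply/funext => x /=; rewrite EFinM.
apply: complex_eq; rewrite ?ReM ?ImM /cint /=.
  rewrite -!RintegralZl// -RintegralB//; try exact: iZ.
  by apply: eq_Rintegral => x _; rewrite ReM.
rewrite -!RintegralZl// -RintegralD//; try exact: iZ.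
by apply: eq_Rintegral => x _; rewrite ImM.
Qed.

Lemma cint_id a f : cint a a f = 0.
Proof. by rewrite /cint set_itv1 !Rintegral_set1. Qed.

Lemma cint_split a b c f : a <= b -> b <= c -> L1 `[a, c] f ->
  cint a c f = cint a b f + cint b c f.
Proof.
move=> ab bc [f1 f2].
have H u : mu.-integrable `[a, c] (EFin \o u) ->
   \int[mu]_(x in `[a, c]) u x =
   \int[mu]_(x in `[a, b]) u x + \int[mu]_(x in `[b, c]) u x.
  move=> iu; have := @Rintegral_itvB _ u (BLeft a) (BRight c) b iu.
  rewrite !bnd_simp => /(_ ab bc) => e.
  rewrite -(@Rintegral_itv_obnd_cbnd _ b (BRight c)); last first.
    apply: integrableS iu => // x /=; rewrite !in_itv/= => /andP[h1 ->].
    by rewrite (le_trans ab (ltW h1)).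
  by rewrite -e addrC subrK.
by apply: complex_eq; rewrite ?ReD ?ImD /cint /= H.
Qed.

(** The factor 2 comes from bounding real and imaginary parts separately. It is tolerable here: the
    normalization [2 ^- m] of the series absorbs it. *)
Lemma le_cint a b f : L1 `[a, b] f ->
  cabs (cint a b f) <= 2 * \int[mu]_(x in `[a, b]) cabs (f x).
Proof.
move=> /[dup] /L1_cabs ic [f1 f2].
apply: le_trans (cabs_le _) _; rewrite /cint /= [leRHS]mulr_natl mulr2n.
have H u : mu.-integrable `[a, b] (EFin \o u) -> (forall x, `|u x| <= cabs (f x)) ->
   `|\int[mu]_(x in `[a, b]) u x| <= \int[mu]_(x in `[a, b]) cabs (f x).
  move=> iu ul; apply: le_trans (le_normr_Rintegral _ iu) _ => //.
  by apply: le_Rintegral => //; exact: integrable_abse iu.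
by apply: lerD; apply: H => // x; [exact: Re_le_cabs|exact: Im_le_cabs].
Qed.

End ComplexIntegral.

(** * Absolute continuity of complex-valued functions *)

Section ComplexAC.
Context {R : realType}.
Local Notation C := R[i].
Local Notation mu := (@lebesgue_measure R).
Implicit Types (f g h : R -> C) (a b x : R).

Lemma ac_Re a b f : abs_continuous a b f -> real_abs_continuous a b (fun x => Re (f x)).
Proof.
move=> acf e /acf[d d0 H]; exists d => // n l r lr tr sd.
apply: le_lt_trans (H n l r lr tr sd); apply: ler_sum => i _.
by rewrite -ReN -ReD Re_le_cabs.
Qed.

Lemma ac_Im a b f : abs_continuous a b f -> real_abs_continuous a b (fun x => Im (f x)).
Proof.
move=> acf e /acf[d d0 H]; exists d => // n l r lr tr sd.
apply: le_lt_trans (H n l r lr tr sd); apply: ler_sum => i _.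
by rewrite -ImN -ImD Im_le_cabs.
Qed.

Lemma ac_ReIm a b f : real_abs_continuous a b (fun x => Re (f x)) ->
  real_abs_continuous a b (fun x => Im (f x)) -> abs_continuous a b f.
Proof.
move=> f1 f2 e e0; have e20 : 0 < e / 2 by rewrite divr_gt0.
have [d1 d10 H1] := f1 _ e20; have [d2 d20 H2] := f2 _ e20.
exists (Num.min d1 d2); first by rewrite lt_min d10.
move=> n l r lr tr; rewrite lt_min => /andP[s1 s2].
have := H1 n l r lr tr s1; have := H2 n l r lr tr s2 => h2 h1.
apply: (@le_lt_trans _ _ (\sum_(i < n) `|Re (f (r i)) - Re (f (l i))| +
   \sum_(i < n) `|Im (f (r i)) - Im (f (l i))|)); last first.
  by rewrite [ltRHS]splitr ltrD.
rewrite -big_split; apply: ler_sum => i _ /=.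
by rewrite -ReN -ReD -ImN -ImD cabs_le.
Qed.

Lemma ac_ccont a b f : abs_continuous a b f -> ccontinuous_on a b f.
Proof.
by move=> acf; split; apply: real_AC_continuous; [exact: ac_Re|exact: ac_Im].
Qed.

(** The common criterion behind sums, products, inverses and square roots. Only the square root
    exploits the restriction to increments shorter than [eta]. *)
Lemma ac_dominated a b f g h (K eta : R) : 0 < K -> 0 < eta ->
  abs_continuous a b f -> abs_continuous a b g ->
  (forall x y, a <= x -> x <= y -> y <= b -> y - x < eta ->
    cabs (h y - h x) <= K * (cabs (f y - f x) + cabs (g y - g x))) ->
  abs_continuous a b h.
Proof.
move=> K0 eta0 acf acg H e e0.
have e20 : 0 < e / K / 2 by rewrite !divr_gt0.
have [d1 d10 H1] := acf _ e20; have [d2 d20 H2] := acg _ e20.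
exists (Num.min eta (Num.min d1 d2)); first by rewrite !lt_min eta0 d10.
move=> n l r lr tr; rewrite !lt_min => /and3P[s0 s1 s2].
have h1 := H1 n l r lr tr s1; have h2 := H2 n l r lr tr s2.
apply: (@le_lt_trans _ _ (K * (\sum_(i < n) cabs (f (r i) - f (l i)) +
   \sum_(i < n) cabs (g (r i) - g (l i))))); last first.
  by rewrite mulrC -ltr_pdivlMr// [ltRHS]splitr ltrD.
rewrite -big_split mulr_sumr; apply: ler_sum => i _ /=.
have [li [lri ri]] := lr i; apply: H => //.
apply: le_lt_trans s0; rewrite (bigD1 i)//= lerDl sumr_ge0// => j _.
by have [_ [lrj _]] := lr j; rewrite subr_ge0.
Qed.

Lemma ac_lip a b h (K : R) : 0 < K ->
  (forall x y, a <= x -> x <= y -> y <= b -> cabs (h y - h x) <= K * (y - x)) ->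
  abs_continuous a b h.
Proof.
move=> K0 H e e0; exists (e / K); first by rewrite divr_gt0.
move=> n l r lr tr s0.
apply: (@le_lt_trans _ _ (K * \sum_(i < n) (r i - l i))); last first.
  by rewrite mulrC -ltr_pdivlMr.
rewrite mulr_sumr; apply: ler_sum => i _.
by have [li [lri ri]] := lr i; apply: H.
Qed.

Lemma ac_cst a b (c : C) : abs_continuous a b (fun=> c).
Proof.
apply: (@ac_lip _ _ _ 1) => // x y _ xy _.
by rewrite subrr cabs0 mul1r subr_ge0.
Qed.

Lemma ac_eq a b f g : (forall x, a <= x <= b -> f x = g x) ->
  abs_continuous a b f -> abs_continuous a b g.
Proof.
move=> fg acf; apply: (ac_dominated ltr01 ltr01 acf acf) => x y ax xy yb _.
rewrite -(fg y) ?yb ?(le_trans ax)// -(fg x) ?ax ?(le_trans xy)//.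
by rewrite mul1r lerDl cabs_ge0.
Qed.

Lemma acD a b f g : abs_continuous a b f -> abs_continuous a b g ->
  abs_continuous a b (fun x => f x + g x).
Proof.
move=> acf acg; apply: (ac_dominated ltr01 ltr01 acf acg) => x y _ _ _ _.
rewrite mul1r (_ : _ - _ = (f y - f x) + (g y - g x)) ?cabsD//; ring.
Qed.

Lemma acM a b f g : a <= b -> abs_continuous a b f -> abs_continuous a b g ->
  abs_continuous a b (fun x => f x * g x).
Proof.
move=> ab acf acg.
have [M M0 HM] := ccont_bounded ab (ac_ccont acf).
have [N N0 HN] := ccont_bounded ab (ac_ccont acg).
have K0 : 0 < M + N by rewrite addr_gt0.
apply: (ac_dominated K0 ltr01 acf acg) => x y ax xy yb _.
rewrite (_ : _ - _ = (f y - f x) * g y + f x * (g y - g x)); last by ring.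
apply: le_trans (cabsD _ _) _; rewrite !cabsM.
have h1 : cabs (g y) <= M + N by rewrite (le_trans (HN y _)) ?yb ?(le_trans ax)// lerDr ltW.
have h2 : cabs (f x) <= M + N by rewrite (le_trans (HM x _)) ?ax ?(le_trans xy)// lerDl ltW.
rewrite mulrDr lerD//; last by rewrite ler_wpM2r ?cabs_ge0.
by rewrite mulrC ler_wpM2r ?cabs_ge0.
Qed.

Lemma acZ a b (c : C) f : a <= b -> abs_continuous a b f -> abs_continuous a b (fun x => c * f x).
Proof. by move=> ab; apply: acM => //; exact: ac_cst. Qed.

Lemma acV a b f : a <= b -> abs_continuous a b f ->
  (forall x, a <= x <= b -> f x != 0) -> abs_continuous a b (fun x => (f x)^-1).
Proof.
move=> ab acf f0.
have [m m0 Hm] := ccont_lower ab (ac_ccont acf) f0.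
have K0 : 0 < m^-1 * m^-1 by rewrite mulr_gt0 ?invr_gt0.
apply: (ac_dominated K0 ltr01 acf acf) => x y ax xy yb _.
have xab : a <= x <= b by rewrite ax (le_trans xy).
have yab : a <= y <= b by rewrite yb (le_trans ax).
rewrite (_ : _ - _ = (f x)^-1 * (f y)^-1 * (f x - f y)); last first.
  by field; rewrite f0//= f0.
rewrite !cabsM !cabsV (cabs_distC (f x)); apply: ler_pM; rewrite ?cabs_ge0//.
- by rewrite mulr_ge0// invr_ge0 cabs_ge0.
- by apply: ler_pM; rewrite ?invr_ge0 ?cabs_ge0// lef_pV2 ?posrE ?Hm//;
    apply: lt_le_trans m0 (Hm _ _).
- by rewrite lerDl cabs_ge0.
Qed.

(** Heine's theorem, from the near-covering form of compactness with the filter of small positive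
    radii. *)
Lemma within_uniform a b (u : R -> R) : a <= b -> {within `[a, b], continuous u} ->
  forall e : R, 0 < e -> exists2 d : R, 0 < d &
    forall x y, a <= x <= b -> a <= y <= b -> `|y - x| < d -> `|u y - u x| < e.
Proof.
move=> ab cu e e0.
have /compact_near_coveringP cov := @segment_compact R a b.
pose P (d x : R) := a <= x <= b ->
  forall y, a <= y <= b -> `|y - x| < d -> `|u y - u x| < e.
have := cov R (0^'+) P _ _.
have h : forall x : R, `[a, b]%classic x -> \forall x' \near x & d \near 0^'+, P d x'.
  move=> x xab; move/subspace_continuousP : cu => /(_ x xab).
  have e20 : 0 < e / 2 by rewrite divr_gt0.
  move/cvgrPdist_lt => /(_ _ e20); rewrite near_withinE => /nbhs_ballP[r /= r0 Hr].
  have r20 : 0 < r / 2 by rewrite divr_gt0.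
  exists (ball x (r / 2), [set d | d < r / 2]) => /=.
    split; first exact: nbhsx_ballx.
    exact: nbhs_right_lt.
  move=> [x' d] /= [x'r dr] x'ab y yab yd.
  have h1 : `|u x - u x'| < e / 2.
    apply: Hr; last by rewrite /= in_itv.
    by apply: lt_trans x'r _; rewrite ltr_pdivrMr// ltr_pMr// ltr1n.
  have h2 : `|u x - u y| < e / 2.
    apply: Hr; last by rewrite /= in_itv.
    rewrite /ball/= (_ : x - y = (x - x') - (y - x')); last by ring.
    apply: le_lt_trans (ler_normB _ _) _; rewrite [ltRHS]splitr ltrD//.
    exact: lt_trans yd dr.
  rewrite (_ : u y - u x' = (u x - u x') - (u x - u y)); last by ring.
  by apply: le_lt_trans (ler_normB _ _) _; rewrite [ltRHS]splitr ltrD.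
move=> /(_ _ h) H.
near (0 : R)^'+ => d.
exists d; first by near: d; exact: nbhs_right_gt.
have : `[a, b] `<=` P d by near: d; exact: H.
by move=> Hd x y xab; apply: Hd => //; rewrite /= in_itv.
Unshelve. all: by end_near. Qed.

Lemma ccont_uniform a b f : a <= b -> ccontinuous_on a b f -> forall e : R, 0 < e ->
  exists2 d : R, 0 < d & forall x y, a <= x <= b -> a <= y <= b -> `|y - x| < d ->
    cabs (f y - f x) < e.
Proof.
move=> ab [f1 f2] e e0; have e20 : 0 < e / 2 by rewrite divr_gt0.
have [d1 d10 H1] := within_uniform ab f1 e20.
have [d2 d20 H2] := within_uniform ab f2 e20.
exists (Num.min d1 d2); first by rewrite lt_min d10.
move=> x y xab yab; rewrite lt_min => /andP[s1 s2].
apply: le_lt_trans (cabs_le _) _; rewrite ReD ReN ImD ImN [ltRHS]splitr.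
by rewrite ltrD ?H1 ?H2.
Qed.

(** The increment of [f ^ 2] is [(f y + f x) (f y - f x)]. If [m] bounds the modulus of [f] from
    below, then for close points [f y + f x] differs from [2 f x] by less than [m], so its modulus
    is at least [m] and can be divided out. All the prescribed roots become absolutely continuous in
    this way. *)
Lemma ac_sqrt a b f : a <= b -> ccontinuous_on a b f ->
  (forall x, a <= x <= b -> f x != 0) ->
  abs_continuous a b (fun x => f x ^+ 2) -> abs_continuous a b f.
Proof.
move=> ab cf f0 ac2; have [m m0 Hm] := ccont_lower ab cf f0.
have [d d0 Hd] := ccont_uniform ab cf m0.
have K0 : 0 < m^-1 by rewrite invr_gt0.
apply: (ac_dominated K0 d0 ac2 ac2) => x y ax xy yb xyd.
have xab : a <= x <= b by rewrite ax (le_trans xy).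
have yab : a <= y <= b by rewrite yb (le_trans ax).
have hd : cabs (f y - f x) < m by rewrite Hd// ger0_norm// subr_ge0.
have hs : m <= cabs (f y + f x).
  have h2 := cabsB (f y + f x) (f y - f x).
  have e2 : (f y + f x) - (f y - f x) = 2%:R * f x by ring.
  have c2 : cabs (2%:R : R[i]) = 2.
    by rewrite (_ : (2%:R : R[i]) = (2 : R)%:C) ?cabs_real ?ger0_norm// rmorph_nat.
  rewrite e2 cabsM c2 in h2.
  have := Hm x xab; lra.
rewrite ler_pdivlMl//.
apply: (@le_trans _ _ (cabs (f y ^+ 2 - f x ^+ 2))); last by rewrite lerDl cabs_ge0.
rewrite (_ : f y ^+ 2 - f x ^+ 2 = (f y + f x) * (f y - f x)); last by ring.
by rewrite cabsM ler_wpM2r ?cabs_ge0.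
Qed.

Lemma ac_cder a b f : a < b -> abs_continuous a b f ->
  {ae mu, forall x, a < x < b -> cder f x (cderiv f x)}.
Proof.
move=> ab acf.
apply: ae_imply (ae_and (real_AC_is_derive ab (ac_Re acf)) (real_AC_is_derive ab (ac_Im acf))).
by move=> x [h1 h2] xab; split; [exact: h1|exact: h2].
Qed.

Lemma ac_L1 a b f : a < b -> abs_continuous a b f -> L1 `[a, b] (cderiv f).
Proof.
by move=> ab acf; split; apply: real_AC_integrable => //; [exact: ac_Re|exact: ac_Im].
Qed.

Lemma ac_FTC a b f x : a < b -> abs_continuous a b f -> a <= x <= b ->
  f x = f a + cint a x (cderiv f).
Proof.
move=> ab acf /andP[ax xb]; apply: complex_eq; rewrite ?ReD ?ImD /cint /=.
  exact: (real_AC_FTC ab (ac_Re acf) ax xb).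
exact: (real_AC_FTC ab (ac_Im acf) ax xb).
Qed.

Lemma ac_primitive a b f h x : a < b -> abs_continuous a b f -> L1 `[a, b] h ->
  {ae mu, forall x, a < x < b -> cder f x (h x)} -> a <= x <= b ->
  f x = f a + cint a x h.
Proof.
move=> ab acf hL1 fh xab; rewrite (ac_FTC ab acf xab); congr (_ + _).
move/andP : xab => [ax xb].
have [m1 m2] := L1S (lexx a) xb (ac_L1 ab acf).
have [m3 m4] := L1S (lexx a) xb hL1.
rewrite /cint; congr (_ +i* _); apply: ae_eq_Rintegral.
- by case/integrableP : m1 => /measurable_EFinP.
- by case/integrableP : m3 => /measurable_EFinP.
- apply: ae_imply fh => t H /andP[t1 t2]; rewrite (cder_cderiv (H _))//.
  by rewrite t1 (lt_le_trans t2).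
- by case/integrableP : m2 => /measurable_EFinP.
- by case/integrableP : m4 => /measurable_EFinP.
- apply: ae_imply fh => t H /andP[t1 t2]; rewrite (cder_cderiv (H _))//.
  by rewrite t1 (lt_le_trans t2).
Qed.

Lemma primitive_cder a b c f h : L1 `[a, b] h ->
  (forall x, a <= x <= b -> f x = c + cint a x h) ->
  {ae mu, forall x, a < x < b -> cder f x (h x)}.
Proof.
move=> [h1 h2] fE.
have H1 := @primitive_derive _ a b (Re c) (fun x => Re (f x)) _ h1.
have H2 := @primitive_derive _ a b (Im c) (fun x => Im (f x)) _ h2.
apply: ae_imply (ae_and (H1 _) (H2 _)) => [x [d1 d2] xab|x ax xb|x ax xb].
- by split; [exact: d1|exact: d2].
- by rewrite fE ?ax// ReD.
- by rewrite fE ?ax// ImD.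
Qed.

(** Absolute continuity of the integral of the modulus of [g] as a set function, evaluated on the
    union of the given intervals. *)
Lemma real_primitive_ac a b c (u g : R -> R) : mu.-integrable `[a, b] (EFin \o g) ->
  (forall x, a <= x <= b -> u x = c + \int[mu]_(t in `[a, x]) g t) ->
  real_abs_continuous a b u.
Proof.
move=> gi uE e e0; pose g' := g \_ `[a, b].
have ig : mu.-integrable setT (EFin \o g').
  by move: gi; rewrite integrable_mkcond// restrict_EFin.
have [d [d0 H]] := integral_normr_continuous ig e0.
exists d => // n l r lr tr sd.
have mI i : measurable (`]l i, r i[%classic : set (measurableTypeR R)).
  exact: measurable_itv.
pose U := \big[setU/set0]_(i < n) `]l i, r i[%classic.
have mU : measurable (U : set (measurableTypeR R)) by exact: bigsetU_measurable.
have Ud : (mu U < d%:E)%E.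
  have -> : mu U = (\sum_(i < n) mu `]l i, r i[)%E by apply: measure_bigsetU_ord.
  apply: (@le_lt_trans _ _ (\sum_(i < n) (r i - l i))%:E); last by rewrite lte_fin.
  rewrite -sumEFin; apply: lee_sum => i _.
  have [_ [lri _]] := lr i.
  rewrite -[leLHS]/(mu [set` `]l i, r i[]) lebesgue_measure_itv /= lte_fin.
  by case: ltP => // _; rewrite lee_fin subr_ge0.
apply: le_lt_trans (H U mU Ud).
have ign : mu.-integrable setT (EFin \o (fun x => `|g' x|)).
  exact: integrable_abse ig.
have -> : \int[mu]_(x in U) `|g' x| = \sum_(i < n) \int[mu]_(x in `]l i, r i[) `|g' x|.
  rewrite /Rintegral.
  have := @ge0_integral_bigsetU _ _ R mu _ (fun i : 'I_n => `]l i, r i[%classic)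
    (EFin \o (fun x => `|g' x|)) (index_enum _) mI (index_enum_uniq _).
  rewrite /= => -> //; last 2 first.
  - by apply: sub_trivIset tr.
  - case/integrableP : ign => + _; apply: measurable_funS => //.
  rewrite -sum_fine// => i _; apply: integrable_fin_num => //.
  exact: integrableS ign.
apply: ler_sum => i _; have [li [lri ri]] := lr i.
rewrite !uE ?ri ?li ?(le_trans li) ?(le_trans lri)//.
have ir : mu.-integrable `[a, r i] (EFin \o g).
  apply: integrableS gi => // y; rewrite /= !in_itv/= => /andP[-> h].
  exact: le_trans h ri.
have := @Rintegral_itvB _ g (BLeft a) (BRight (r i)) (l i) ir.
rewrite !bnd_simp => /(_ li lri) e1.
rewrite (_ : _ - _ = \int[mu]_(t in `[a, r i]) g t - \int[mu]_(t in `[a, l i]) g t);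
  last by ring.
rewrite e1.
have ilr : mu.-integrable `]l i, r i] (EFin \o g).
  apply: integrableS gi => // y; rewrite /= !in_itv/= => /andP[h1 h2].
  by rewrite (le_trans h2 ri) andbT (le_trans li)// ltW.
rewrite -Rintegral_itv_bndo_bndc; last first.
  by apply: integrableS ilr => //; exact: subset_itv_oo_oc.
have ilr' : mu.-integrable `]l i, r i[ (EFin \o g).
  by apply: integrableS ilr => //; exact: subset_itv_oo_oc.
apply: le_trans (le_normr_Rintegral _ ilr') _ => //.
rewrite le_eqVlt; apply/orP; left; apply/eqP; apply: eq_Rintegral => t.
rewrite inE /= in_itv/= => /andP[t1 t2]; rewrite /g' patchE mem_set//= in_itv/=.
by rewrite (le_trans li (ltW t1)) (le_trans (ltW t2)).
Qed.

Lemma primitive_ac a b c f h : L1 `[a, b] h ->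
  (forall x, a <= x <= b -> f x = c + cint a x h) -> abs_continuous a b f.
Proof.
move=> [h1 h2] fE; apply: ac_ReIm.
  by apply: (@real_primitive_ac _ _ (Re c) _ _ h1) => x xab; rewrite fE// ReD.
by apply: (@real_primitive_ac _ _ (Im c) _ _ h2) => x xab; rewrite fE// ImD.
Qed.

Lemma C1_ac a b f df (M : R) : 0 < M -> ccontinuous_on a b f ->
  (forall x, a < x < b -> cder f x (df x)) ->
  (forall x, a <= x <= b -> cabs (df x) <= M) -> abs_continuous a b f.
Proof.
move=> M0 [f1 f2] fd dM; have K0 : 0 < 2 * M by rewrite mulr_gt0.
apply: (ac_lip K0) => x y ax xy yb.
have sub : `[x, y] `<=` `[a, b].
  move=> t /=; rewrite !in_itv/= => /andP[h1 h2].
  by rewrite (le_trans ax h1) (le_trans h2 yb).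
have H (u du : R -> R) : {within `[a, b], continuous u} ->
    (forall t, a < t < b -> is_derive t 1 u (du t)) ->
    (forall t, a <= t <= b -> `|du t| <= M) -> `|u y - u x| <= M * (y - x).
  move=> cu ud duM.
  have [|c cxy ->] := MVT_segment xy (f := u) (df := du) _ (continuous_subspaceW sub cu).
    move=> t; rewrite in_itv/= => /andP[t1 t2]; apply: ud.
    by rewrite (le_lt_trans ax t1) (lt_le_trans t2 yb).
  have cab := sub c cxy.
  rewrite normrM [X in _ * X]ger0_norm ?subr_ge0// ler_wpM2r ?subr_ge0// duM//.
apply: le_trans (cabs_le _) _; rewrite ReD ReN ImD ImN mulr_natl mulr2n mulrDl.
apply: lerD.
  apply: (H _ (fun t => Re (df t)) f1) => t tab; first by have [] := fd t tab.
  exact: le_trans (Re_le_cabs _) (dM t tab).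
apply: (H _ (fun t => Im (df t)) f2) => t tab; first by have [] := fd t tab.
exact: le_trans (Im_le_cabs _) (dM t tab).
Qed.

End ComplexAC.

(** * Derivatives on a closed segment, one-sided at the end points *)

Section HasDeriv.
Context {R : realType}.
Local Notation C := R[i].
Local Notation mu := (@lebesgue_measure R).
Implicit Types (f h : R -> C) (a b x : R).

Lemma cvg_withinP (A : set R) (u : R -> R) x l :
  (u t @[t --> within A x^'] --> l) <->
  (forall e : R, 0 < e -> exists2 d : R, 0 < d & forall t, A t -> t != x ->
     `|x - t| < d -> `|l - u t| < e).
Proof.
split=> [/cvgrPdist_lt cu e e0|H].
  have := cu e e0; rewrite near_withinE => -[d /= d0 Hd].
  by exists d => // t At tx xt; exact: Hd.
apply/cvgrPdist_lt => e e0; have [d d0 Hd] := H e e0.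
rewrite near_withinE; exists d => // t xt tx At; exact: Hd.
Qed.

Lemma is_derive_dist (u : R -> R) x l :
  is_derive x 1 u l <-> (forall e : R, 0 < e -> exists2 d : R, 0 < d & forall t, t != x ->
     `|x - t| < d -> `|l - (u t - u x) / (t - x)| < e).
Proof.
have E : (fun h : R => h^-1 *: ((u \o shift x) (h *: 1) - u x)) =
         (fun h : R => h^-1 * (u (h + x) - u x)).
  by apply/funext => h /=; rewrite [_ *: 1]mulr1.
split=> [[]|H].
  rewrite /derive /derivable E => cu dl.
  have {}cu : h^-1 * (u (h + x) - u x) @[h --> 0^'] --> l by rewrite -dl.
  move=> e e0; move/cvgrPdist_lt : cu => /(_ e e0)[d /= d0 Hd]; exists d => // t tx xt.
  have := Hd (t - x); rewrite /= sub0r normrN distrC subrK mulrC; apply => //.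
  by rewrite subr_eq0.
have cu : h^-1 * (u (h + x) - u x) @[h --> 0^'] --> l.
  apply/cvgrPdist_lt => e e0; have [d d0 Hd] := H e e0.
  exists d => // t /=; rewrite sub0r normrN => td t0.
  have := Hd (t + x); rewrite addrK mulrC; apply.
    by rewrite -subr_eq0 addrK.
  by rewrite opprD addrCA subrr addr0 normrN.
apply: DeriveDef; first by rewrite /derivable E; apply/cvg_ex; exists l.
by rewrite /derive E; apply/cvg_lim.
Qed.

Lemma has_deriv_cder a b f df x : has_deriv_on a b f df -> a < x < b -> cder f x (df x).
Proof.
move=> H /andP[ax xb]; have [|h1 h2] := H x; first by rewrite in_itv/= !ltW.
have K (u : R -> R) (l : R) : (u t - u x) / (t - x) @[t --> within `[a, b]%classic x^'] --> l ->
    is_derive x 1 u l.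
  move=> /cvg_withinP cu; apply/is_derive_dist => e /cu[d d0 Hd].
  exists (Num.min d (Num.min (x - a) (b - x))); first by rewrite !lt_min d0 !subr_gt0 ax.
  move=> t tx; rewrite !lt_min => /and3P[td ta tb]; apply: Hd => //.
  rewrite /= in_itv/=; move: (ler_norm (x - t)) (ler_norm (- (x - t))); rewrite normrN => n1 n2.
  apply/andP; split.
    by rewrite -(lerD2l x) -lerBlDr; have := le_lt_trans n1 ta; lra.
  by have := le_lt_trans n2 tb; lra.
by split; apply: K.
Qed.

Lemma cont_primitive_real a b c (u g : R -> R) x : a < b ->
  {within `[a, b], continuous g} ->
  (forall x, a <= x <= b -> u x = c + \int[mu]_(t in `[a, x]) g t) ->
  a <= x <= b -> (u t - u x) / (t - x) @[t --> within `[a, b]%classic x^'] --> g x.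
Proof.
move=> ab cg uE xab.
(* With [g] clamped and the integral started at [a - 1], the end points of the segment become
   interior points, where the two-sided theorem applies. *)
pose G := g \o clamp a b; pose H y := \int[mu]_(t in `[a - 1, y]) G t.
have cG : continuous G by apply/(continuous_clampP _ (ltW ab)).
have iG p q : mu.-integrable `[p, q] (EFin \o G).
  by apply: within_integrable; apply: continuous_subspaceT.
have GE t : a <= t <= b -> G t = g t.
  by move=> /andP[t1 t2]; rewrite /G /= clampE.
have uH t : a <= t <= b -> u t = c - \int[mu]_(t in `[a - 1, a]) G t + H t.
  move=> /andP[t1 t2]; rewrite uE ?t1// -addrA; congr (_ + _).
  have := @Rintegral_itvB _ G (BLeft (a - 1)) (BRight t) a (iG _ _).
  rewrite !bnd_simp => /(_ _ t1) e; rewrite /H addrC e; last by rewrite lerBlDr lerDl.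
  rewrite Rintegral_itv_obnd_cbnd; last first.
    by apply: integrableS (iG a t) => //; exact: subset_itv_oc_cc.
  apply: eq_Rintegral => y; rewrite inE/= in_itv/= => /andP[y1 y2].
  by rewrite GE// y1 (le_trans y2).
have /andP[ax xb] := xab.
have D : is_derive x 1 H (g x).
  have [||||d e] := @continuous_FTC1_closed _ G (a - 1) x (x + 1).
  - by rewrite ltrDl.
  - exact: iG.
  - by rewrite ltrBlDr (le_lt_trans ax)// ltrDl.
  - exact: cG.
  - by rewrite -GE// -e derive1E; apply: DeriveDef.
apply/cvg_withinP => e e0; move/is_derive_dist : D => /(_ e e0)[d d0 Hd].
exists d => // t /=; rewrite in_itv/= => tab tx td.
rewrite (uH t tab) (uH x xab) opprD addrACA subrr add0r; exact: Hd.
Qed.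

Lemma cont_primitive_has_deriv a b c f h : a < b -> ccontinuous_on a b h ->
  (forall x, a <= x <= b -> f x = c + cint a x h) -> has_deriv_on a b f h.
Proof.
move=> ab [h1 h2] fE x; rewrite in_itv/= => xab; split.
  apply: (@cont_primitive_real a b (Re c) (fun x => Re (f x)) _ x ab h1) => // t tab.
  by rewrite fE// ReD.
apply: (@cont_primitive_real a b (Im c) (fun x => Im (f x)) _ x ab h2) => // t tab.
by rewrite fE// ImD.
Qed.

Lemma cont_primitive_cder a b c f h x : a < b -> ccontinuous_on a b h ->
  (forall x, a <= x <= b -> f x = c + cint a x h) -> a < x < b -> cder f x (h x).
Proof. by move=> ab ch fE; apply: has_deriv_cder; exact: cont_primitive_has_deriv fE. Qed.

(** Near each point the difference quotients are bounded by the modulus of the derivative plus 1. *)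
Lemma has_deriv_ccont a b f df : has_deriv_on a b f df -> ccontinuous_on a b f.
Proof.
move=> H.
have K (u : R -> R) (l x : R) : (u t - u x) / (t - x) @[t --> within `[a, b]%classic x^'] --> l ->
    u t @[t --> within `[a, b]%classic (nbhs x)] --> u x.
  move=> /cvg_withinP cu; have [d d0 Hd] := cu 1 ltr01.
  apply/cvgrPdist_lt => e e0; rewrite near_withinE.
  have L0 : 0 < `|l| + 1 by rewrite ltr_wpDl.
  apply/nbhs_ballP; exists (Num.min d (e / (`|l| + 1))) => /=.
    by rewrite lt_min d0 divr_gt0.
  move=> t; rewrite /ball/= lt_min => /andP[td te] tab.
  have [->|tx] := eqVneq t x; first by rewrite subrr normr0.
  have h := Hd t tab tx td.
  have tx0 : t - x != 0 by rewrite subr_eq0.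
  set q := _ / _ in h.
  have hq : `|q| <= `|l| + 1.
    rewrite (_ : q = l - (l - q)); last by ring.
    by apply: le_trans (ler_normB _ _) _; rewrite lerD2l ltW.
  rewrite distrC (_ : u t - u x = q * (t - x)); last by rewrite /q divfK.
  rewrite normrM (distrC t); apply: le_lt_trans (ler_wpM2r _ hq) _ => //.
  by rewrite mulrC -ltr_pdivlMr.
split; apply/subspace_continuousP => x xab; have [h1 h2] := H x xab.
  exact: (K (fun t => Re (f t)) _ _ h1).
exact: (K (fun t => Im (f t)) _ _ h2).
Qed.

Lemma has_deriv_ac a b f df : a <= b -> has_deriv_on a b f df -> ccontinuous_on a b df ->
  abs_continuous a b f.
Proof.
move=> ab H cdf; have [M M0 HM] := ccont_bounded ab cdf.
apply: (C1_ac M0 (has_deriv_ccont H) _ HM) => x xab; exact: has_deriv_cder H xab.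
Qed.

End HasDeriv.

(** * Iterated oscillatory integrals *)

Section Iterated.
Context {R : realType}.
Local Notation C := R[i].
Local Notation mu := (@lebesgue_measure R).
Variables (a b : R) (n q : R -> C).
Hypothesis ab : a < b.
Hypothesis cn : ccontinuous_on a b n.
Hypothesis iq : L1 `[a, b] q.

Definition primitive_from x := cint a x n.
Local Notation Phi := primitive_from.

(* 2 ^ m times the m-th term of the series in which cos and sin are replaced by the
   exponential z |-> exp (s z / k). *)
Fixpoint iter_osc (s : C) (m : nat) (x : R) : C :=
  if m is p.+1 then
    cint a x (fun y => q y * cexp (s * (-1) ^+ m * (Phi x - Phi y)) * iter_osc s p y)
  else cexp (s * Phi x).
Local Notation J := iter_osc.

Lemma L1_init f x : L1 `[a, b] f -> a <= x <= b -> L1 `[a, x] f.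
Proof. by move=> h /andP[_ xb]; apply: L1S xb h. Qed.

Lemma ac_Phi : abs_continuous a b Phi.
Proof.
by apply: (@primitive_ac _ _ _ 0 _ n (L1_cont cn)) => x _; rewrite add0r.
Qed.

Lemma cder_Phi x : a < x < b -> cder Phi x (n x).
Proof.
by apply: (@cont_primitive_cder _ a b 0 _ _ _ ab cn) => t _; rewrite add0r.
Qed.

Lemma ac_cexp_Phi (s : C) : abs_continuous a b (fun x => cexp (s * Phi x)).
Proof.
have ce : ccontinuous_on a b (fun x => cexp (s * Phi x)).
  by apply/ccont_cexp/ccontM; [exact: ccont_cst|exact: ac_ccont ac_Phi].
have cd : ccontinuous_on a b (fun x => s * n x * cexp (s * Phi x)).
  by apply: ccontM => //; apply: ccontM => //; exact: ccont_cst.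
have [M M0 HM] := ccont_bounded (ltW ab) cd.
apply: (C1_ac M0 ce _ HM) => x xab; apply: cder_cexp.
by apply: cderZ; exact: cder_Phi.
Qed.

Lemma cder_cexp_Phi (s : C) x : a < x < b ->
  cder (fun x => cexp (s * Phi x)) x (s * n x * cexp (s * Phi x)).
Proof. by move=> xab; apply: cder_cexp; apply: cderZ; exact: cder_Phi. Qed.

(** Splitting the exponential removes [x] from the integrand, so that each term is an exponential
    times the primitive of an integrable function. *)
Lemma iter_oscS s m x : a <= x <= b -> ccontinuous_on a b (J s m) ->
  J s m.+1 x = cexp (s * (-1) ^+ m.+1 * Phi x) *
    cint a x (fun y => cexp (- (s * (-1) ^+ m.+1) * Phi y) * J s m y * q y).
Proof.
move=> xab cJ; rewrite /= -cintZ; last first.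
  apply: L1_init => //; apply: L1M => //; first exact: ltW.
  by apply: ccontM => //; apply: ac_ccont; exact: ac_cexp_Phi.
apply: cint_eq => y _; rewrite mulrBr cexpD mulNr; ring.
Qed.

(** In the product rule, the outer exponential reproduces [J s m] with the coefficient
    [s (-1) ^ m n], and in the derivative of the integral the two opposite exponentials cancel,
    leaving [q] times the previous term. *)
Lemma iter_osc_ac s m : abs_continuous a b (J s m) /\
  {ae mu, forall x, a < x < b ->
     cder (J s m) x (s * (-1) ^+ m * n x * J s m x +
                     (if m is p.+1 then q x * J s p x else 0))}.
Proof.
elim: m => [|m [acJ _]].
  split; first exact: ac_cexp_Phi.
  apply: aeW => x xab; apply: cder_eq (cder_cexp_Phi s xab).
  by rewrite expr0 mulr1 addr0.
have cJ := ac_ccont acJ.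
set s' := s * (-1) ^+ m.+1.
have iI : L1 `[a, b] (fun y => cexp (- s' * Phi y) * J s m y * q y).
  apply: L1M => //; first exact: ltW.
  by apply: ccontM => //; apply: ac_ccont; exact: ac_cexp_Phi.
set I := fun x => cint a x (fun y => cexp (- s' * Phi y) * J s m y * q y).
have acI : abs_continuous a b I.
  by apply: (@primitive_ac _ _ _ 0 _ _ iI) => x _; rewrite add0r.
have dI : {ae mu, forall x, a < x < b -> cder I x (cexp (- s' * Phi x) * J s m x * q x)}.
  by apply: (@primitive_cder _ _ _ 0 _ _ iI) => x _; rewrite add0r.
have JE x : a <= x <= b -> cexp (s' * Phi x) * I x = J s m.+1 x.
  by move=> xab; rewrite iter_oscS.
split.
  apply: ac_eq JE _; apply: acM => //; [exact: ltW|exact: ac_cexp_Phi].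
apply: ae_imply dI => x dI xab.
apply: (@cder_near _ (fun x => cexp (s' * Phi x) * I x)).
  move/andP : xab => [ax xb]; near=> y; apply: JE.
  apply/andP; split; apply/ltW; near: y; [exact: lt_nbhsr|exact: lt_nbhsl].
apply: cder_eq (cderM (cder_cexp_Phi s' xab) (dI xab)).
rewrite -JE; last by move/andP : xab => [/ltW -> /ltW ->].
have e0 : cexp (s' * Phi x) * cexp (- s' * Phi x) = 1.
  by rewrite -cexpD mulNr subrr cexp0.
rewrite (_ : cexp (s' * Phi x) * (_ * _ * q x) = q x * J s m x).
  by rewrite /s'; ring.
transitivity (cexp (s' * Phi x) * cexp (- s' * Phi x) * (q x * J s m x)); first by ring.
by rewrite e0 mul1r.
Unshelve. all: by end_near. Qed.

Lemma iter_osc_ccont s m : ccontinuous_on a b (J s m).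
Proof. by apply: ac_ccont; have [] := iter_osc_ac s m. Qed.

Lemma Phi_a : Phi a = 0. Proof. exact: cint_id. Qed.

Lemma iter_osc_a s m : J s m a = (m == 0)%:R.
Proof. by case: m => [|m] /=; rewrite ?cint_id// Phi_a mulr0 cexp0. Qed.

Definition osc_rhs s m x : C :=
  s * (-1) ^+ m * n x * J s m x + (if m is p.+1 then q x * J s p x else 0).

Lemma osc_rhs_L1 s m : L1 `[a, b] (osc_rhs s m).
Proof.
apply: L1D.
  apply: L1_cont; apply: ccontM; last exact: iter_osc_ccont.
  by apply: ccontM => //; exact: ccont_cst.
case: m => [|m]; first by apply: L1_cont; exact: ccont_cst.
apply: (L1_ext (f := fun x => J s m x * q x)); first by move=> x; rewrite mulrC.
by apply: L1M => //; [exact: ltW|exact: iter_osc_ccont].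
Qed.

Lemma iter_osc_primitive s m x : a <= x <= b ->
  J s m x = (m == 0)%:R + cint a x (osc_rhs s m).
Proof.
move=> xab; rewrite -(iter_osc_a s m).
have [acJ dJ] := iter_osc_ac s m.
exact: ac_primitive ab acJ (osc_rhs_L1 s m) dJ xab.
Qed.

(** The natural clock for the estimates: measured by it, [q] behaves like a bounded coefficient. *)
Definition mass x : R := \int[mu]_(t in `[a, x]) cabs (q t).

Let iq' : L1 `[a, b] (fun x => (cabs (q x))%:C).
Proof. by split => //=; [exact: L1_cabs|exact: (integrable0 mu)]. Qed.

Let massE z : (mass z)%:C = cint a z (fun x => (cabs (q x))%:C).
Proof. by rewrite /cint /=; congr (_ +i* _); rewrite /Rintegral integral0. Qed.

Let massX_ac p : abs_continuous a b (fun x => (mass x)%:C ^+ p).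
Proof.
have acm : abs_continuous a b (fun x => (mass x)%:C).
  by apply: (@primitive_ac _ _ _ 0 _ _ iq') => t _; rewrite add0r massE.
elim: p => [|p IH]; first exact: ac_cst.
apply: (ac_eq (f := fun x => (mass x)%:C * (mass x)%:C ^+ p)).
  by move=> t _; rewrite exprS.
by apply: acM => //; exact: ltW.
Qed.

Let massX_L1 m : L1 `[a, b] (fun t => (mass t)%:C ^+ m * (cabs (q t))%:C).
Proof. by apply: L1M => //; [exact: ltW|exact: ac_ccont]. Qed.

Lemma mass_integrable m :
  mu.-integrable `[a, b] (EFin \o (fun t => mass t ^+ m * cabs (q t))).
Proof.
have [iM _] := massX_L1 m.
by apply: eq_integrable iM => // t _ /=; rewrite -rmorphXn -rmorphM.
Qed.

(** The derivative of [mass ^ (m + 1)] is [(m + 1) mass ^ m] times the modulus of [q] almost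
    everywhere. This is the source of the factorials. The computation is complex-valued so that the
    product rule and the fundamental theorem above can be used. *)
Lemma mass_pow m x : a <= x <= b ->
  mass x ^+ m.+1 = m.+1%:R * \int[mu]_(t in `[a, x]) (mass t ^+ m * cabs (q t)).
Proof.
move=> xab.
have dm : {ae mu, forall x, a < x < b -> cder (fun x => (mass x)%:C) x (cabs (q x))%:C}.
  by apply: (@primitive_cder _ _ _ 0 _ _ iq') => t _; rewrite add0r massE.
have dX p t : cder (fun x => (mass x)%:C) t (cabs (q t))%:C ->
   cder (fun x => (mass x)%:C ^+ p.+1) t (p.+1%:R * ((mass t)%:C ^+ p * (cabs (q t))%:C)).
  move=> d1; elim: p => [|p IH].
    by under eq_fun do rewrite expr1; apply: cder_eq d1; rewrite expr0 !mul1r.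
  under eq_fun do rewrite exprS.
  apply: cder_eq (cderM d1 IH); rewrite -[p.+2]addn1 natrD !exprS; ring.
have iX : L1 `[a, b] (fun t => (m.+1%:R : C) * ((mass t)%:C ^+ m * (cabs (q t))%:C)).
  by apply: L1Z => //; exact: ltW.
have := @ac_primitive _ a b _ _ x ab (massX_ac m.+1) iX _ xab.
have -> : (mass a)%:C = 0 by rewrite massE cint_id.
rewrite expr0n add0r => e.
have {}e := e (ae_imply (fun t H tab => dX m t (H tab)) dm).
have := congr1 (@complex.Re R) e.
rewrite -rmorphXn /= => ->.
have E t : Re (m.+1%:R * ((mass t)%:C ^+ m * (cabs (q t))%:C)) =
    m.+1%:R * (mass t ^+ m * cabs (q t)).
  by rewrite -rmorphXn -rmorphM -(rmorph_nat (@real_complex R)) -rmorphM.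
rewrite /Rintegral; under eq_integral do rewrite E.
rewrite -/(Rintegral _ _ _) RintegralZl//.
apply: integrableS (mass_integrable m) => // t /=; rewrite !in_itv/= => /andP[-> h].
by apply: le_trans h _; case/andP : xab.
Qed.

End Iterated.

(** * Complex series and dominated convergence *)

Section ComplexSeries.
Context {R : realType}.
Local Notation C := R[i].
Local Notation mu := (@lebesgue_measure R).
Implicit Types (u v : nat -> C) (l c : C).

Definition ccvg u l :=
  (Re (u m) @[m --> \oo] --> Re l) /\ (Im (u m) @[m --> \oo] --> Im l).

(** Convergence is part of the relation, whereas [csum] is defined for every sequence. *)
Definition csums u l := ccvg (fun m => \sum_(0 <= i < m) u i) l.

Lemma seq_cvg_ext (x y : nat -> R) (l : R) : x =1 y ->
  (y m @[m --> \oo] --> l) -> (x m @[m --> \oo] --> l).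
Proof. by move=> /funext ->. Qed.

Lemma ccvg_ext u v l : u =1 v -> ccvg v l -> ccvg u l.
Proof. by move=> /funext ->. Qed.

Lemma ccvg_cst c : ccvg (fun=> c) c.
Proof. by split; exact: cvg_cst. Qed.

Lemma ccvgD u v l l' : ccvg u l -> ccvg v l' -> ccvg (fun m => u m + v m) (l + l').
Proof.
move=> [u1 u2] [v1 v2]; split.
  by rewrite ReD; apply: (seq_cvg_ext (fun m => ReD (u m) (v m))); exact: cvgD.
by rewrite ImD; apply: (seq_cvg_ext (fun m => ImD (u m) (v m))); exact: cvgD.
Qed.

Lemma ccvgM u v l l' : ccvg u l -> ccvg v l' -> ccvg (fun m => u m * v m) (l * l').
Proof.
move=> [u1 u2] [v1 v2]; split.
  rewrite ReM; apply: (seq_cvg_ext (fun m => ReM (u m) (v m))).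
  by apply: cvgB; apply: cvgM.
rewrite ImM; apply: (seq_cvg_ext (fun m => ImM (u m) (v m))).
by apply: cvgD; apply: cvgM.
Qed.

Lemma ccvg_unique u l l' : ccvg u l -> ccvg u l' -> l = l'.
Proof.
move=> [u1 u2] [v1 v2]; apply: complex_eq.
  exact: cvg_unique u1 v1.
exact: cvg_unique u2 v2.
Qed.

Lemma ccvgS u l : ccvg u l -> ccvg (fun m => u m.+1) l.
Proof.
by move=> [u1 u2]; split; [rewrite -cvg_shiftS in u1|rewrite -cvg_shiftS in u2].
Qed.

Lemma csums_csum u l : csums u l -> csum u = l.
Proof.
move=> [u1 u2]; rewrite /csum.
rewrite (_ : series (fun n => Re (u n)) = fun m => Re (\sum_(0 <= i < m) u i)); last first.
  by apply/funext => m; rewrite Re_sum.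
rewrite (_ : series (fun n => Im (u n)) = fun m => Im (\sum_(0 <= i < m) u i)); last first.
  by apply/funext => m; rewrite Im_sum.
by rewrite (cvg_lim _ u1)// (cvg_lim _ u2)//; case: l {u1 u2}.
Qed.

Lemma csums_ext u v l : u =1 v -> csums v l -> csums u l.
Proof. by move=> /funext ->. Qed.

Lemma csumsD u v l l' : csums u l -> csums v l' -> csums (fun m => u m + v m) (l + l').
Proof.
move=> cu cv; apply: (ccvg_ext _ (ccvgD cu cv)) => m.
by rewrite big_split.
Qed.

Lemma csumsZ c u l : csums u l -> csums (fun m => c * u m) (c * l).
Proof.
move=> cu; apply: (ccvg_ext _ (ccvgM (ccvg_cst c) cu)) => m.
by rewrite mulr_sumr.
Qed.

Lemma csums_dom u (v : nat -> R) : (forall m, cabs (u m) <= v m) ->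
  cvgn (series v) -> csums u (csum u).
Proof.
move=> uv cv.
have H (w : nat -> R) : (forall m, `|w m| <= cabs (u m)) -> cvgn (series w).
  move=> wu; apply: normed_cvg; apply: series_le_cvg cv => m //=.
  - exact: le_trans (cabs_ge0 _) (uv m).
  - exact: le_trans (wu m) (uv m).
split.
  apply: (seq_cvg_ext (y := series (fun n => Re (u n)))).
    by move=> m; rewrite Re_sum.
  by apply: H => m; exact: Re_le_cabs.
apply: (seq_cvg_ext (y := series (fun n => Im (u n)))).
  by move=> m; rewrite Im_sum.
by apply: H => m; exact: Im_le_cabs.
Qed.

Lemma dominated_cvg_real (a b : R) (h : nat -> R -> R) (h' g : R -> R) :
  (forall m, mu.-integrable `[a, b] (EFin \o h m)) ->
  (forall x, a <= x <= b -> h m x @[m --> \oo] --> h' x) ->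
  mu.-integrable `[a, b] (EFin \o g) ->
  (forall m x, a <= x <= b -> `|h m x| <= g x) ->
  mu.-integrable `[a, b] (EFin \o h') /\
  \int[mu]_(x in `[a, b]) h m x @[m --> \oo] --> \int[mu]_(x in `[a, b]) h' x.
Proof.
move=> ih ch ig hg.
have mh m : measurable_fun `[a, b] (h m).
  by case/integrableP : (ih m) => /measurable_EFinP.
have mh' : measurable_fun `[a, b] h'.
  apply: (measurable_fun_cvg mh) => x; rewrite /= in_itv/=; exact: ch.
have [] := @dominated_convergence _ _ R mu `[a, b]%classic (measurable_itv _)
  (fun m => EFin \o h m) (EFin \o h') (EFin \o g).
- move=> m. by apply/measurable_EFinP; exact: mh.
- exact/measurable_EFinP.
- apply: aeW => x; rewrite /= in_itv/= => xab.
  by apply/fine_cvgP; split; [exact: nearW|exact: ch].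
- exact: ig.
- by apply: aeW => x m; rewrite /= in_itv/= => xab; rewrite lee_fin hg.
move=> ih' _ cI; split => //.
have fi : (\int[mu]_(x in `[a, b]) (EFin \o h') x)%E \is a fin_num.
  exact: integrable_fin_num ih'.
have := cI; rewrite -[X in _ --> X]fineK// => /fine_cvgP[_].
exact.
Qed.

Lemma dominated_ccvg (a b : R) (h : nat -> R -> C) (h' : R -> C) (g : R -> R) :
  (forall m, L1 `[a, b] (h m)) ->
  (forall x, a <= x <= b -> ccvg (h ^~ x) (h' x)) ->
  mu.-integrable `[a, b] (EFin \o g) ->
  (forall m x, a <= x <= b -> cabs (h m x) <= g x) ->
  L1 `[a, b] h' /\ ccvg (fun m => cint a b (h m)) (cint a b h').
Proof.
move=> ih ch ig hg.
have [|||i1 c1] := @dominated_cvg_real a b (fun m x => Re (h m x)) (fun x => Re (h' x)) g _ _ ig.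
- by move=> m; have [] := ih m.
- by move=> x /ch[].
- by move=> m x xab; exact: le_trans (Re_le_cabs _) (hg m x xab).
have [|||i2 c2] := @dominated_cvg_real a b (fun m x => Im (h m x)) (fun x => Im (h' x)) g _ _ ig.
- by move=> m; have [] := ih m.
- by move=> x /ch[].
- by move=> m x xab; exact: le_trans (Im_le_cabs _) (hg m x xab).
by [].
Qed.

End ComplexSeries.

(** * Summation of the iterated integrals and the coupled first-order system *)

Section SummedSystem.
Context {R : realType}.
Local Notation C := R[i].
Local Notation mu := (@lebesgue_measure R).
Variables (a b : R) (n q : R -> C).
Hypothesis ab : a < b.
Hypothesis cn : ccontinuous_on a b n.
Hypothesis iq : L1 `[a, b] q.
Variable s : C.
Local Notation J := (iter_osc a n q s).
Local Notation Phi := (primitive_from a n).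
Local Notation Q := (mass a q).

Lemma le_mass x : a <= x <= b -> 0 <= Q x <= Q b.
Proof.
move=> /andP[ax xb]; rewrite /mass; apply/andP; split.
  by apply: Rintegral_ge0 => t _; exact: cabs_ge0.
have ic := L1_cabs iq.
have := @Rintegral_itvB _ (fun t => cabs (q t)) (BLeft a) (BRight b) x ic.
rewrite !bnd_simp => /(_ ax xb) e; rewrite -subr_ge0 e.
by apply: Rintegral_ge0 => t _; exact: cabs_ge0.
Qed.

Lemma osc_bound : exists2 K : R, 0 < K & forall m x y, a <= x <= b -> a <= y <= b ->
  cabs (cexp (s * (-1) ^+ m * (Phi x - Phi y))) <= K.
Proof.
have [B B0 HB] := ccont_bounded (ltW ab) (ac_ccont (ac_Phi cn)).
exists (expR (cabs s * (B + B))); first exact: expR_gt0.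
move=> m x y xab yab; rewrite cabs_cexp ler_expR.
apply: le_trans (ler_norm _) _; apply: le_trans (Re_le_cabs _) _.
rewrite !cabsM cabsX cabsN cabs1 expr1n mulr1 ler_wpM2l ?cabs_ge0//.
by apply: le_trans (cabsB _ _) _; rewrite lerD ?HB.
Qed.

Lemma iter_osc_bound : exists2 K : R, 0 < K & forall m x, a <= x <= b ->
  cabs (J m x) <= K * (2 * K) ^+ m * (Q x ^+ m / m`!%:R).
Proof.
have [K K0 HK] := osc_bound; exists K => //.
elim=> [|m IH] x xab.
  rewrite !expr0 fact0 divr1 !mulr1 /=.
  have := HK 0 x a xab; rewrite expr0 mulr1 Phi_a subr0; apply.
  by rewrite lexx ltW.
have /andP[ax xb] := xab.
set f := fun y => q y * cexp (s * (-1) ^+ m.+1 * (Phi x - Phi y)) * J m y.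
have if_ : L1 `[a, x] f.
  apply: (L1S (lexx a) xb).
  apply: (L1_ext (f := fun y => cexp (s * (-1) ^+ m.+1 * (Phi x - Phi y)) * J m y * q y)).
    by move=> y; rewrite /f; ring.
  apply: L1M => //; first exact: ltW.
  apply: ccontM; last exact: iter_osc_ccont.
  apply: ccont_cexp; apply: ccontM; first exact: ccont_cst.
  apply: ccontD; first exact: ccont_cst.
  by apply: ccontN; apply: ac_ccont; exact: ac_Phi.
apply: le_trans (le_cint if_) _.
(* One [K] bounds the new exponential and the rest is the constant of the induction hypothesis; the
   missing factor 2 is supplied by [le_cint]. *)
pose c := K * (K * (2 * K) ^+ m / m`!%:R).
have c0 : 0 <= c by rewrite /c !(mulr_ge0, divr_ge0, exprn_ge0)// ltW.
have ig := @mass_integrable _ a b q ab iq m.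
have ig' : mu.-integrable `[a, x] (EFin \o (fun t => Q t ^+ m * cabs (q t))).
  apply: integrableS ig => // t /=; rewrite !in_itv/= => /andP[-> h].
  exact: le_trans h xb.
have igc : mu.-integrable `[a, x] (EFin \o (fun t => c * (Q t ^+ m * cabs (q t)))).
  rewrite (_ : _ \o _ = (fun t : R => c%:E * (Q t ^+ m * cabs (q t))%R%:E)%E).
    exact: integrableZl.
  by apply/funext => t /=; rewrite EFinM.
apply: (@le_trans _ _ (2 * \int[mu]_(t in `[a, x]) (c * (Q t ^+ m * cabs (q t))))).
  rewrite ler_wpM2l//; apply: le_Rintegral => //; first exact: L1_cabs.
  move=> t; rewrite /= in_itv/= => /andP[t1 t2].
  have tab : a <= t <= b by rewrite t1 (le_trans t2).
  have h1 := HK m.+1 x t xab tab; have h2 := IH t tab.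
  rewrite (_ : c * _ = cabs (q t) * (K * (K * (2 * K) ^+ m * (Q t ^+ m / m`!%:R)))); last first.
    by rewrite /c; set w := (m`!%:R)^-1; ring.
  rewrite /f !(cabsM (_ * _)) (cabsM (q t)) -mulrA ler_wpM2l ?cabs_ge0//.
  by apply: ler_pM; rewrite ?cabs_ge0.
rewrite RintegralZl//.
have := @mass_pow _ a b q ab iq m x xab.
set I := Rintegral _ _ _ => e.
rewrite e factS natrM /c !exprS.
rewrite le_eqVlt; apply/orP; left; apply/eqP; field.
by rewrite pnatr_eq0 /= nat1r pnatr_eq0 -lt0n fact_gt0.
Qed.

Definition osc_term m x : C := (2%:R ^+ m)^-1 * J m x.
Local Notation E := osc_term.

Lemma cabs_nat (m : nat) : cabs (m%:R : C) = m%:R.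
Proof. by rewrite -(rmorph_nat (@real_complex R)) cabs_real normr_nat. Qed.

Lemma osc_term_bound : exists2 v : nat -> R, cvgn (series v) &
  forall m x, a <= x <= b -> cabs (E m x) <= v m.
Proof.
have [K K0 HK] := iter_osc_bound.
(* The powers of 2 from the integral estimate cancel [2 ^- m], which leaves the terms of the
   exponential series at [K] times the total mass. *)
exists (fun m => K * exp_coeff (K * Q b) m).
  by apply: is_cvg_seriesZ; exact: is_cvg_series_exp_coeff.
move=> m x xab; rewrite /E cabsM cabsV cabsX cabs_nat.
have /andP[Q0 Qb] := le_mass xab.
have p0 : 0 < (2 : R) ^+ m by rewrite exprn_gt0.
rewrite mulrC ler_pdivrMr//; apply: le_trans (HK m x xab) _.
rewrite (_ : K * (2 * K) ^+ m * (Q x ^+ m / m`!%:R) =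
   K * (K ^+ m * (Q x ^+ m / m`!%:R)) * 2 ^+ m); last first.
  by rewrite exprMn; set w := (m`!%:R)^-1; ring.
apply: ler_wpM2r; first exact: ltW.
apply: ler_wpM2l; first exact: ltW.
rewrite /exp_coeff /= exprMn -mulrA.
apply: ler_wpM2l; first by rewrite exprn_ge0// ltW.
apply: ler_wpM2r; first by rewrite invr_ge0.
by rewrite lerXn2r ?nnegrE// (le_trans Q0).
Qed.

Definition osc_sum x : C := csum (fun m => E m x).
Definition osc_alt x : C := csum (fun m => (-1) ^+ m * E m x).
Local Notation P := osc_sum.
Local Notation N := osc_alt.

Lemma cabs_sign m (z : C) : cabs ((-1) ^+ m * z) = cabs z.
Proof. by rewrite cabsM cabsX cabsN cabs1 expr1n mul1r. Qed.

Lemma osc_sumP x : a <= x <= b -> csums (fun m => E m x) (P x).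
Proof.
have [v cv Hv] := osc_term_bound.
by move=> xab; apply: (csums_dom _ cv) => m; exact: Hv.
Qed.

Lemma osc_altP x : a <= x <= b -> csums (fun m => (-1) ^+ m * E m x) (N x).
Proof.
have [v cv Hv] := osc_term_bound.
by move=> xab; apply: (csums_dom _ cv) => m; rewrite cabs_sign; exact: Hv.
Qed.

Let PP p x := \sum_(0 <= i < p) E i x.
Let NN p x := \sum_(0 <= i < p) (-1) ^+ i * E i x.

Let E_cont m : ccontinuous_on a b (E m).
Proof. by apply: ccontM; [exact: ccont_cst|exact: iter_osc_ccont]. Qed.

Let sum_cont (u : nat -> R -> C) p : (forall m, ccontinuous_on a b (u m)) ->
  ccontinuous_on a b (fun x => \sum_(0 <= i < p) u i x).
Proof.
move=> cu; elim: p => [|p IH].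
  by under eq_fun do rewrite big_geq//; exact: ccont_cst.
by under eq_fun do rewrite big_nat_recr//=; exact: ccontD.
Qed.

Let PP_cont p : ccontinuous_on a b (PP p).
Proof. exact: sum_cont. Qed.

Let NN_cont p : ccontinuous_on a b (NN p).
Proof. by apply: sum_cont => m; apply: ccontM => //; exact: ccont_cst. Qed.

Let sn_L1 f : ccontinuous_on a b f -> L1 `[a, b] (fun y => s * n y * f y).
Proof.
by move=> cf; apply: L1_cont; do 2 (apply: ccontM => //); exact: ccont_cst.
Qed.

Let q_L1 (c : C) f : ccontinuous_on a b f -> L1 `[a, b] (fun y => c * q y * f y).
Proof.
move=> cf; apply: (L1_ext (f := fun y => c * f y * q y)); first by move=> y; ring.
by apply: L1M => //; [exact: ltW|apply: ccontM => //; exact: ccont_cst].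
Qed.

Let E_primitive0 x : a <= x <= b -> E 0 x = 1 + cint a x (fun y => s * n y * E 0 y).
Proof.
move=> xab; rewrite /E expr0 invr1 mul1r (iter_osc_primitive ab cn iq)//.
congr (_ + _); apply: cint_eq => y _.
by rewrite /osc_rhs expr0 mulr1 addr0 mul1r.
Qed.

Let E_primitiveS m x : a <= x <= b -> E m.+1 x =
  cint a x (fun y => s * (-1) ^+ m.+1 * n y * E m.+1 y + 2%:R^-1 * q y * E m y).
Proof.
move=> xab; rewrite /E (iter_osc_primitive ab cn iq)// add0r -cintZ; last first.
  exact: L1_init (osc_rhs_L1 ab cn iq _ _) xab.
apply: cint_eq => y _; rewrite /osc_rhs exprS invfM; ring.
Qed.

(** The sign [(-1) ^ m] in the derivative exchanges plain and alternating sums. The [q] term lowers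
    the index by one, which makes the sums under it one term shorter and reverses the sign in the
    alternating equation. *)
Let partial_eq p x : a <= x <= b ->
  PP p.+1 x = 1 + cint a x (fun y => s * n y * NN p.+1 y + 2%:R^-1 * q y * PP p y) /\
  NN p.+1 x = 1 + cint a x (fun y => s * n y * PP p.+1 y + (- 2%:R^-1) * q y * NN p y).
Proof.
move=> xab; elim: p => [|p [IHP IHN]].
  have PP1 y : PP 1 y = E 0 y by rewrite /PP big_nat1.
  have NN1 y : NN 1 y = E 0 y by rewrite /NN big_nat1 expr0 mul1r.
  have PP0 y : PP 0 y = 0 by rewrite /PP big_geq.
  have NN0 y : NN 0 y = 0 by rewrite /NN big_geq.
  rewrite PP1 NN1 {1 2}E_primitive0//.
  split; congr (_ + _); apply: cint_eq => y _.
    by rewrite NN1 PP0 mulr0 addr0.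
  by rewrite PP1 NN0 mulr0 addr0.
have PPS m y : PP m.+1 y = PP m y + E m y by rewrite /PP big_nat_recr.
have NNS m y : NN m.+1 y = NN m y + (-1) ^+ m * E m y by rewrite /NN big_nat_recr.
have iE m : L1 `[a, b] (fun y => s * (-1) ^+ m.+1 * n y * E m.+1 y + 2%:R^-1 * q y * E m y).
  apply: L1D; last exact: q_L1.
  by apply: L1_cont; do 2 (apply: ccontM => //); exact: ccont_cst.
split.
  rewrite PPS IHP E_primitiveS// -addrA -cintD; last 2 first.
  - by apply: L1_init xab; apply: L1D; [exact: sn_L1|exact: q_L1].
  - exact: L1_init (iE p) xab.
  congr (_ + _); apply: cint_eq => y _; rewrite (NNS p.+1) (PPS p); ring.
rewrite NNS IHN E_primitiveS// -cintZ; last exact: L1_init (iE p) xab.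
rewrite -addrA -cintD; last 2 first.
- by apply: L1_init xab; apply: L1D; [exact: sn_L1|exact: q_L1].
- by apply: L1_init xab; apply: L1Z => //; exact: ltW.
congr (_ + _); apply: cint_eq => y _; rewrite (NNS p) (PPS p.+1).
have e2 : (-1) ^+ p.+1 * (-1) ^+ p.+1 = 1 :> C by rewrite -expr2 sqrr_sign.
rewrite mulrDr (_ : (-1) ^+ p.+1 * (s * (-1) ^+ p.+1 * n y * E p.+1 y) =
   (-1) ^+ p.+1 * (-1) ^+ p.+1 * (s * n y * E p.+1 y)); last by ring.
by rewrite e2 exprS; ring.
Qed.

Let partial_bound : exists T : R, forall p x, a <= x <= b ->
  cabs (PP p x) <= T /\ cabs (NN p x) <= T.
Proof.
have [v cv Hv] := osc_term_bound.
have v0 m : 0 <= v m by apply: le_trans (Hv m a _); rewrite ?cabs_ge0// lexx ltW.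
exists (limn (series v)).
have H (u : nat -> C) p : (forall m, cabs (u m) <= v m) ->
    cabs (\sum_(0 <= i < p) u i) <= limn (series v).
  move=> uv; apply: (@le_trans _ _ (series v p)); last first.
    by apply: nondecreasing_cvgn_le => //; exact: nondecreasing_series.
  rewrite /series /=; elim: p => [|p IH]; first by rewrite !big_geq// cabs0.
  rewrite !big_nat_recr//=; apply: le_trans (cabsD _ _) _; exact: lerD.
by move=> p x xab; split; apply: H => m; rewrite ?cabs_sign; exact: Hv.
Qed.

(** Stated for general sequences and a general [c1], because it is used for both equations, with
    [c1] equal to one half and to minus one half. Uniformly bounded partial sums give the dominating
    function, a constant plus a multiple of the modulus of [q]. *)
Let limit_eq (c1 : C) (F G : nat -> R -> C) (f g : R -> C) :
  (forall p, ccontinuous_on a b (F p)) -> (forall p, ccontinuous_on a b (G p)) ->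
  (exists T : R, forall p x, a <= x <= b -> cabs (F p x) <= T /\ cabs (G p x) <= T) ->
  (forall x, a <= x <= b -> ccvg (F ^~ x) (f x)) ->
  (forall x, a <= x <= b -> ccvg (G ^~ x) (g x)) ->
  L1 `[a, b] (fun y => s * n y * f y + c1 * q y * g y) /\
  (forall x, a <= x <= b ->
   ccvg (fun p => cint a x (fun y => s * n y * F p y + c1 * q y * G p y))
        (cint a x (fun y => s * n y * f y + c1 * q y * g y))).
Proof.
move=> cF cG [T HT] cf cg.
have [B B0 HB] := ccont_bounded (ltW ab) cn.
have key x : a <= x <= b -> L1 `[a, x] (fun y => s * n y * f y + c1 * q y * g y) /\
   ccvg (fun p => cint a x (fun y => s * n y * F p y + c1 * q y * G p y))
        (cint a x (fun y => s * n y * f y + c1 * q y * g y)).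
  move=> xab; have /andP[ax xb] := xab.
  apply: (@dominated_ccvg _ _ _ _ _
    (fun y => cabs s * B * T + cabs c1 * T * cabs (q y))).
  - move=> m; apply: L1_init xab; apply: L1D; [exact: sn_L1|exact: q_L1].
  - move=> y /andP[ay yx]; have yab : a <= y <= b by rewrite ay (le_trans yx).
    apply: ccvgD; (apply: ccvgM; first exact: ccvg_cst); [exact: cf|exact: cg].
  - have iq' := L1_cabs (L1_init iq xab).
    rewrite (_ : _ \o _ = ((EFin \o cst (cabs s * B * T)%R) \+
       (fun y : R => (cabs c1 * T)%R%:E * (cabs (q y))%:E))%E); last first.
      by apply/funext => y /=; rewrite EFinD EFinM.
    apply: integrableD => //; last exact: integrableZl.
    by apply: within_integrable => y; exact: cvg_cst.
  - move=> m y /andP[ay yx]; have yab : a <= y <= b by rewrite ay (le_trans yx).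
    have [TF TG] := HT m y yab.
    apply: le_trans (cabsD _ _) _; rewrite !cabsM; apply: lerD.
      by rewrite ler_pM ?mulr_ge0 ?cabs_ge0// ler_wpM2l ?cabs_ge0// HB.
    by rewrite -!mulrA ler_wpM2l ?cabs_ge0// mulrC ler_wpM2r ?cabs_ge0.
split; last by move=> x /key[].
by have [] := key b; rewrite ?lexx ?(ltW ab).
Qed.

(* Termwise differentiation couples the series of the terms and the alternating one:
   P' = s n N + q P / 2 and N' = s n P - q N / 2. *)
Definition sum_rhs x : C := s * n x * N x + 2%:R^-1 * q x * P x.
Definition alt_rhs x : C := s * n x * P x + (- 2%:R^-1) * q x * N x.

Theorem osc_system :
  [/\ L1 `[a, b] sum_rhs, L1 `[a, b] alt_rhs,
   (forall x, a <= x <= b -> P x = 1 + cint a x sum_rhs) &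
   (forall x, a <= x <= b -> N x = 1 + cint a x alt_rhs)].
Proof.
have [T HT] := partial_bound.
have [|||||i1 c1] := @limit_eq (2%:R^-1) (fun p => NN p.+1) PP N P.
- by move=> p; exact: NN_cont.
- exact: PP_cont.
- by exists T => p x xab; split; [have [] := HT p.+1 x xab|have [] := HT p x xab].
- by move=> x xab; exact: (ccvgS (osc_altP xab)).
- by move=> x xab; exact: osc_sumP.
have [|||||i2 c2] := @limit_eq (- 2%:R^-1) (fun p => PP p.+1) NN P N.
- by move=> p; exact: PP_cont.
- exact: NN_cont.
- by exists T => p x xab; split; [have [] := HT p.+1 x xab|have [] := HT p x xab].
- by move=> x xab; exact: (ccvgS (osc_sumP xab)).
- by move=> x xab; exact: osc_altP.
split => // x xab.
  apply: (ccvg_unique (ccvgS (osc_sumP xab))).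
  apply: (ccvg_ext _ (ccvgD (ccvg_cst 1) (c1 x xab))) => p.
  by have [<- _] := partial_eq p xab.
apply: (ccvg_unique (ccvgS (osc_altP xab))).
apply: (ccvg_ext _ (ccvgD (ccvg_cst 1) (c2 x xab))) => p.
by have [_ <-] := partial_eq p xab.
Qed.

End SummedSystem.

(** * From exponentials back to cosine and sine on the simplex *)

Section Simplex.
Context {R : realType}.
Local Notation C := R[i].
Local Notation mu := (@lebesgue_measure R).
Variables (a b : R) (n q : R -> C).
Hypothesis ab : a < b.
Hypothesis cn : ccontinuous_on a b n.
Hypothesis iq : L1 `[a, b] q.
Local Notation J := (iter_osc a n q).
Local Notation Phi := (primitive_from a n).

(** Convertible to [phase] when [n] is [nf k]; [gen_C] and [gen_S] below are likewise convertible to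
    [Cn] and [Sn] when moreover [q] is the logarithmic derivative of [bn k]. *)
Definition alt_phase (x0 x : R) (ys : seq R) : C :=
  let y := nth 0 (x0 :: rcons ys x) in
  \sum_(p < (size ys).+1) (-1) ^+ p * cint (y p) (y p.+1) n.

(** Detaches the outermost integration variable: only the segment from [y] to [x] is new, and its
    sign depends on the number of points alone. *)
Lemma alt_phase_rcons x0 x ys y :
  alt_phase x0 x (rcons ys y) =
  alt_phase x0 y ys + (-1) ^+ (size ys).+1 * cint y x n.
Proof.
pose G l p : C := (-1) ^+ p * cint (nth 0 l p) (nth 0 l p.+1) n.
have E z zs : alt_phase x0 z zs = \sum_(0 <= p < (size zs).+1) G (x0 :: rcons zs z) p.
  by rewrite big_mkord.
have N p : (p < (size ys).+2)%N ->
    nth 0 (x0 :: rcons (rcons ys y) x) p = nth 0 (x0 :: rcons ys y) p.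
  by move=> plt; rewrite -rcons_cons nth_rcons /= size_rcons plt.
rewrite !E size_rcons big_nat_recr//; apply: f_equal2.
  apply: eq_big_nat => p /andP[_ plt]; rewrite /G.
  by rewrite (N p (ltnW plt)) (N p.+1 plt).
rewrite /G (N _ (leqnn _)) (_ : nth 0 (x0 :: rcons ys y) (size ys).+1 = y); last first.
  by rewrite /= nth_rcons ltnn eqxx.
by rewrite (_ : nth 0 _ (size ys).+2 = x)//= nth_rcons size_rcons ltnn eqxx.
Qed.

Lemma eq_simplex_int m x0 x (F G : seq R -> C) :
  (forall ys, size ys = m -> F ys = G ys) -> simplex_int m x0 x F = simplex_int m x0 x G.
Proof.
elim: m x F G => [|m IH] x F G FG /=; first exact: FG.
by apply: cint_eq => y _; apply: IH => ys sy; apply: FG; rewrite size_rcons sy.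
Qed.

Lemma cint_Phi y x : a <= y -> y <= x -> x <= b -> cint y x n = Phi x - Phi y.
Proof.
move=> ay yx xb; rewrite /primitive_from (@cint_split _ a y x)//; last first.
  exact: L1S (lexx a) xb (L1_cont cn).
by rewrite addrAC subrr add0r.
Qed.

Lemma iter_integrand_L1 s m x (c : C) : a <= x <= b ->
  L1 `[a, x] (fun y => q y * cexp (s * c * (Phi x - Phi y)) * J s m y).
Proof.
move=> xab; apply: L1_init xab.
apply: (L1_ext (f := fun y => cexp (s * c * (Phi x - Phi y)) * J s m y * q y)).
  by move=> y; ring.
apply: L1M => //; first exact: ltW.
apply: ccontM; last exact: iter_osc_ccont.
apply: ccont_cexp; apply: ccontM; first exact: ccont_cst.
apply: ccontD; first exact: ccont_cst.
by apply: ccontN; apply: ac_ccont; exact: ac_Phi.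
Qed.

(** After the outermost variable [y] is detached, [q y] and the exponential of the last segment are
    constants of the inner integral. They are absorbed into [c1] and [c2], hence the induction over
    arbitrary coefficients. Treating two exponentials together dispenses with a linearity lemma for
    [simplex_int]. *)
Lemma simplex_int_exp m x (c1 c2 s1 s2 : C) : a <= x <= b ->
  simplex_int m a x (fun ys => \prod_(y <- ys) q y *
    (c1 * cexp (s1 * alt_phase a x ys) + c2 * cexp (s2 * alt_phase a x ys))) =
  c1 * J s1 m x + c2 * J s2 m x.
Proof.
elim: m x c1 c2 => [|m IH] x c1 c2 xab.
  by rewrite /= big_nil mul1r /alt_phase big_ord1 /= expr0 mul1r.
have /andP[ax xb] := xab.
pose g s y := q y * cexp (s * (-1) ^+ m.+1 * (Phi x - Phi y)) * J s m y.
have ig s : L1 `[a, x] (g s) by exact: iter_integrand_L1.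
rewrite -[J s1 m.+1 x]/(cint a x (g s1)) -[J s2 m.+1 x]/(cint a x (g s2)).
rewrite -!cintZ// -cintD; [|exact: L1Z|exact: L1Z].
apply: cint_eq => y /andP[ay yx].
have yab : a <= y <= b by rewrite ay (le_trans yx).
pose d s := q y * cexp (s * (-1) ^+ m.+1 * (Phi x - Phi y)).
rewrite (_ : c1 * g s1 y + c2 * g s2 y = (c1 * d s1) * J s1 m y + (c2 * d s2) * J s2 m y);
  last by rewrite /g /d; ring.
rewrite -IH//; apply: eq_simplex_int => ys sy.
rewrite -cats1 big_cat big_seq1 cats1 alt_phase_rcons sy cint_Phi// /d.
have e s : cexp (s * (alt_phase a y ys + (-1) ^+ m.+1 * (Phi x - Phi y))) =
    cexp (s * alt_phase a y ys) * cexp (s * (-1) ^+ m.+1 * (Phi x - Phi y)).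
  by rewrite mulrDr mulrA cexpD.
by rewrite !e /=; ring.
Qed.

Variable k : C.

Definition gen_C m x : C := (2%:R ^+ m)^-1 *
  simplex_int m a x (fun ys => \prod_(y <- ys) q y * ccos (k * alt_phase a x ys)).
Definition gen_S m x : C := (2%:R ^+ m)^-1 *
  simplex_int m a x (fun ys => \prod_(y <- ys) q y * csin (k * alt_phase a x ys)).

Local Notation Ep := (osc_term a n q ('i * k)).
Local Notation Em := (osc_term a n q (- ('i * k))).

Lemma ccosE (z : C) : ccos (k * z) =
  2%:R^-1 * cexp ('i * k * z) + 2%:R^-1 * cexp (- ('i * k) * z).
Proof. by rewrite /ccos mulNr mulrA mulrC mulrDr. Qed.

Lemma csinE (z : C) : csin (k * z) =
  (2%:R * 'i)^-1 * cexp ('i * k * z) + (- (2%:R * 'i)^-1) * cexp (- ('i * k) * z).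
Proof. by rewrite /csin !mulNr mulrA mulrC mulrBr. Qed.

Lemma gen_CE m x : a <= x <= b -> gen_C m x = 2%:R^-1 * Ep m x + 2%:R^-1 * Em m x.
Proof.
move=> xab; rewrite /gen_C (@eq_simplex_int m a x _ (fun ys => \prod_(y <- ys) q y *
    (2%:R^-1 * cexp ('i * k * alt_phase a x ys) +
     2%:R^-1 * cexp (- ('i * k) * alt_phase a x ys)))); last first.
  by move=> ys _; rewrite ccosE.
by rewrite simplex_int_exp// /osc_term; ring.
Qed.

Lemma gen_SE m x : a <= x <= b ->
  gen_S m x = (2%:R * 'i)^-1 * Ep m x + (- (2%:R * 'i)^-1) * Em m x.
Proof.
move=> xab; rewrite /gen_S (@eq_simplex_int m a x _ (fun ys => \prod_(y <- ys) q y *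
    ((2%:R * 'i)^-1 * cexp ('i * k * alt_phase a x ys) +
     (- (2%:R * 'i)^-1) * cexp (- ('i * k) * alt_phase a x ys)))); last first.
  by move=> ys _; rewrite csinE.
by rewrite simplex_int_exp// /osc_term; ring.
Qed.

Local Notation Pp := (osc_sum a n q ('i * k)).
Local Notation Pm := (osc_sum a n q (- ('i * k))).
Local Notation Np := (osc_alt a n q ('i * k)).
Local Notation Nm := (osc_alt a n q (- ('i * k))).

Lemma csums_gen_C x : a <= x <= b ->
  csums (fun m => gen_C m x) (2%:R^-1 * Pp x + 2%:R^-1 * Pm x).
Proof.
move=> xab; apply: (csums_ext (fun m => gen_CE m xab)).
by apply: csumsD; apply: csumsZ; exact: (osc_sumP ab cn iq _ xab).
Qed.

Lemma csums_gen_S x : a <= x <= b ->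
  csums (fun m => gen_S m x) ((2%:R * 'i)^-1 * Pp x + (- (2%:R * 'i)^-1) * Pm x).
Proof.
move=> xab; apply: (csums_ext (fun m => gen_SE m xab)).
by apply: csumsD; apply: csumsZ; exact: (osc_sumP ab cn iq _ xab).
Qed.

Lemma csums_alt_C x : a <= x <= b ->
  csums (fun m => (-1) ^+ m * gen_C m x) (2%:R^-1 * Np x + 2%:R^-1 * Nm x).
Proof.
move=> xab; apply: (@csums_ext _ _ (fun m => 2%:R^-1 * ((-1) ^+ m * Ep m x) +
    2%:R^-1 * ((-1) ^+ m * Em m x))); first by move=> m; rewrite gen_CE//; ring.
by apply: csumsD; apply: csumsZ; exact: (osc_altP ab cn iq _ xab).
Qed.

Lemma csums_alt_S x : a <= x <= b ->
  csums (fun m => (-1) ^+ m * gen_S m x)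
    ((2%:R * 'i)^-1 * Np x + (- (2%:R * 'i)^-1) * Nm x).
Proof.
move=> xab; apply: (@csums_ext _ _ (fun m => (2%:R * 'i)^-1 * ((-1) ^+ m * Ep m x) +
    (- (2%:R * 'i)^-1) * ((-1) ^+ m * Em m x))).
  by move=> m; rewrite gen_SE//; ring.
by apply: csumsD; apply: csumsZ; exact: (osc_altP ab cn iq _ xab).
Qed.

Definition sumC x := csum (fun m => gen_C m x).
Definition sumS x := csum (fun m => gen_S m x).
Definition altC x := csum (fun m => (-1) ^+ m * gen_C m x).
Definition altS x := csum (fun m => (-1) ^+ m * gen_S m x).

(* The Sturm-Liouville equation for U = sqrt p y and V = be y' / (k sqrt p), where
   p = be n and q = p' / p. *)
Definition osc_pair (U V : R -> C) :=
  [/\ abs_continuous a b U, abs_continuous a b V,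
   {ae mu, forall x, a < x < b -> cder U x (k * n x * V x + 2%:R^-1 * q x * U x)} &
   {ae mu, forall x, a < x < b -> cder V x (- (k * n x * U x) - 2%:R^-1 * q x * V x)}].

Lemma osc_pair_eq U V U' V' : (forall x, a <= x <= b -> U x = U' x) ->
  (forall x, a <= x <= b -> V x = V' x) -> osc_pair U V -> osc_pair U' V'.
Proof.
move=> EU EV [acU acV dU dV].
have nr (f g : R -> C) x : (forall x, a <= x <= b -> f x = g x) -> a < x < b ->
    \near x, f x = g x.
  move=> fg /andP[ax xb]; near=> y; apply: fg.
  by apply/andP; split; apply: ltW; near: y; [exact: lt_nbhsr|exact: lt_nbhsl].
split; [exact: ac_eq acU|exact: ac_eq acV| |].
  apply: ae_imply dU => x H xab; apply: cder_near (nr _ _ _ EU xab) _.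
  have /andP[ax xb] := xab.
  by rewrite -EU ?(ltW ax) ?(ltW xb)// -EV ?(ltW ax) ?(ltW xb)//; exact: H.
apply: ae_imply dV => x H xab; apply: cder_near (nr _ _ _ EV xab) _.
have /andP[ax xb] := xab.
by rewrite -EU ?(ltW ax) ?(ltW xb)// -EV ?(ltW ax) ?(ltW xb)//; exact: H.
Unshelve. all: by end_near. Qed.

Let osc_facts s : [/\ abs_continuous a b (osc_sum a n q s),
  abs_continuous a b (osc_alt a n q s),
  {ae mu, forall x, a < x < b -> cder (osc_sum a n q s) x (sum_rhs a n q s x)} &
  {ae mu, forall x, a < x < b -> cder (osc_alt a n q s) x (alt_rhs a n q s x)}].
Proof.
have [i1 i2 e1 e2] := osc_system ab cn iq s.
split; [exact: primitive_ac i1 e1|exact: primitive_ac i2 e2|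
  exact: primitive_cder i1 e1|exact: primitive_cder i2 e2].
Qed.

Let osc_init s : osc_sum a n q s a = 1 /\ osc_alt a n q s a = 1.
Proof.
have [i1 i2 e1 e2] := osc_system ab cn iq s.
by rewrite e1 ?e2 ?cint_id ?addr0// lexx ltW.
Qed.

Lemma imaginary_neq0 : Num.imaginary != 0 :> C.
Proof. exact: neq0Ci. Qed.

Lemma imaginaryM : Num.imaginary * Num.imaginary = -1 :> C.
Proof. by rewrite -expr2 sqrCi. Qed.

Let two0 : 2%:R != 0 :> C.
Proof. by rewrite pnatr_eq0. Qed.

(** For [s = +- i k] the first equation of the system reads off [V]: the factor [s] has to become
    [k], which leaves [+- i] in the coefficients. The second equation then holds because
    [i ^ 2 = -1]. *)
Let comb_pair (c c' d d' : C) : d = c * 'i -> d' = - (c' * 'i) ->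
  osc_pair (fun x => c * Pp x + c' * Pm x) (fun x => d * Np x + d' * Nm x).
Proof.
move=> -> ->.
have [acPp acNp dPp dNp] := osc_facts ('i * k).
have [acPm acNm dPm dNm] := osc_facts (- ('i * k)).
have ab' := ltW ab.
split; [by apply: acD; exact: acZ|by apply: acD; exact: acZ| |].
  apply: ae_imply (ae_and dPp dPm) => x [H1 H2] xab.
  apply: cder_eq (cderD (cderZ c (H1 xab)) (cderZ c' (H2 xab))).
  by rewrite /sum_rhs; ring.
apply: ae_imply (ae_and dNp dNm) => x [H1 H2] xab.
apply: cder_eq (cderD (cderZ (c * 'i) (H1 xab)) (cderZ (- (c' * 'i)) (H2 xab))).
rewrite /alt_rhs.
transitivity ('i * 'i * (k * n x * (c * Pp x + c' * Pm x)) -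
   2%:R^-1 * q x * (c * 'i * Np x - c' * 'i * Nm x)); first by ring.
by rewrite imaginaryM; ring.
Qed.

Lemma osc_pair1 : osc_pair sumC (fun x => - altS x).
Proof.
have e : (2%:R * 'i)^-1 = - (2%:R^-1 * 'i) :> C.
  apply: (mulIf (mulf_neq0 two0 imaginary_neq0)); rewrite mulVf ?mulf_neq0 ?imaginary_neq0//.
  transitivity (- ('i * 'i) * (2%:R^-1 * 2%:R) : C); last by ring.
  by rewrite imaginaryM opprK mulVf// mulr1.
apply: osc_pair_eq (comb_pair (c := 2%:R^-1) (c' := 2%:R^-1) erefl erefl) => x xab.
  by rewrite /sumC (csums_csum (csums_gen_C xab)).
rewrite /altS (csums_csum (csums_alt_S xab)) e. ring.
Qed.

Lemma osc_pair2 : osc_pair sumS altC.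
Proof.
have e : (2%:R * 'i)^-1 * 'i = 2%:R^-1 :> C.
  by rewrite invfM -mulrA mulVf ?imaginary_neq0// mulr1.
apply: osc_pair_eq (comb_pair (c := (2%:R * 'i)^-1) (c' := - (2%:R * 'i)^-1) erefl erefl) => x xab.
  by rewrite /sumS (csums_csum (csums_gen_S xab)).
by rewrite /altC (csums_csum (csums_alt_C xab)) -e; ring.
Qed.

Lemma osc_pair_init : [/\ sumC a = 1, altS a = 0, sumS a = 0 & altC a = 1].
Proof.
have aab : a <= a <= b by rewrite lexx ltW.
have [p1 n1] := osc_init ('i * k); have [p2 n2] := osc_init (- ('i * k)).
have h2 : 2%:R^-1 + 2%:R^-1 = 1 :> C by have := splitr (1 : C); rewrite mul1r.
rewrite /sumC /altS /sumS /altC (csums_csum (csums_gen_C aab)) (csums_csum (csums_alt_S aab)).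
rewrite (csums_csum (csums_gen_S aab)) (csums_csum (csums_alt_C aab)) p1 p2 n1 n2 !mulr1.
by rewrite h2 subrr.
Qed.

End Simplex.

(** * Branches of the roots of the coefficients *)

Section Branches.
Context {R : realType}.
Local Notation C := R[i].
Implicit Types (z : C).

(** [carg] is a choice from a set, so a witness is needed: plus or minus the arc cosine, shifted by
    a full turn when required. *)
Lemma carg_spec z : z != 0 ->
  - (pi / 2) <= carg z < 3 * pi / 2 /\ z = (cabs z)%:C * cis (carg z).
Proof.
move=> z0; apply: (@xgetPex R 0 [set t | - (pi / 2) <= t < 3 * pi / 2 /\
  z = (cabs z)%:C * cis t]).
have r0 : 0 < cabs z by rewrite cabs_gt0.
have rn0 : cabs z != 0 by rewrite gt_eqF.
pose c := Re z / cabs z; pose s := Im z / cabs z.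
have cs : c ^+ 2 + s ^+ 2 = 1.
  rewrite /c /s !exprMn -mulrDl -cabs_sqr -exprMn mulfV// expr1n//.
have c1 : -1 <= c <= 1.
  by rewrite -ler_norml -(@expr_le1 _ 2)// real_normK ?num_real// -cs lerDl sqr_ge0.
have [p0 cosp] : 0 <= acos c <= pi /\ cos (acos c) = c by exact: acos_def.
have /andP[p00 ppi] := p0.
have sinp : sin (acos c) = `|s|.
  by rewrite sin_acos// -cs [_ + _ - _]addrAC subrr add0r sqrtr_sqr.
have zE t : cos t = c -> sin t = s -> z = (cabs z)%:C * cis t.
  move=> ct st; apply: complex_eq; rewrite ?ReM ?ImM /= ct st mul0r.
    by rewrite subr0 /c mulrC divfK.
  by rewrite addr0 /s mulrC divfK.
have pi0 := pi_gt0 R.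
have [s0|s0] := leP 0 s.
  exists (acos c); split; last by apply: zE => //; rewrite sinp ger0_norm.
  by apply/andP; split; lra.
have sN : sin (- acos c) = s by rewrite sinN sinp ltr0_norm// opprK.
(* In the lower half-plane the branch cut separates the fourth quadrant, with a negative argument,
   from the third, with an argument above [pi]. *)
have [t2|t2] := leP (acos c) (pi / 2).
  exists (- acos c); split; last by apply: zE => //; rewrite cosN.
  by apply/andP; split; lra.
exists (- acos c + pi *+ 2); split.
  by rewrite -mulr_natr; apply/andP; split; lra.
by apply: zE; [rewrite cosD2pi cosN|rewrite sinD2pi].
Qed.

Lemma polar_sqr (r t : R) : (r%:C * cis t) ^+ 2 = (r ^+ 2)%:C * cis (t + t) :> C.
Proof. by rewrite cisD rmorphXn; ring. Qed.

Lemma ccont_polar (a b : R) (r t : R -> R) : {within `[a, b], continuous r} ->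
  {within `[a, b], continuous t} ->
  ccontinuous_on a b (fun x => (r x)%:C * cis (t x)).
Proof.
move=> cr ct.
have [c1 c2] : ccontinuous_on a b (fun x => cexp (0 +i* t x)).
  by apply: ccont_cexp; split => //= x; exact: cvg_cst.
have E x : cis (t x) = cexp (0 +i* t x) :> C.
  by rewrite /cexp /= expR0 mul1r.
apply: ccontM; first by split => //= x; exact: cvg_cst.
by under eq_fun do rewrite E.
Qed.

Lemma powR4 (r : R) : 0 <= r -> r `^ 4^-1 = Num.sqrt (Num.sqrt r).
Proof.
move=> r0; rewrite -!powR12_sqrt ?sqrtr_ge0//; last by rewrite powR_ge0.
by rewrite -powRrM -invfM -natrM.
Qed.

Lemma cont_sqrt (A : set R) (f : R -> R) : {within A, continuous f} ->
  {within A, continuous (fun x => Num.sqrt (f x))}.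
Proof.
move=> cf x; apply: (@continuous_comp _ _ _ (fun x => _ : R) Num.sqrt); first exact: cf.
exact: sqrt_continuous.
Qed.

(* The half-plane Re w > 0 contains at most one square root of each point, and
   it is given by Re w = sqrt ((|v| + Re v) / 2), a continuous function of v. *)
Lemma ccont_right_sqrt (a b : R) (w : R -> C) : (forall x, a <= x <= b -> 0 < Re (w x)) ->
  ccontinuous_on a b (fun x => w x ^+ 2) -> ccontinuous_on a b w.
Proof.
move=> w0 cv.
have E1 (z : C) : 0 < Re z -> Re z = Num.sqrt ((cabs (z ^+ 2) + Re (z ^+ 2)) / 2).
  move=> z0; rewrite cabsX cabs_sqr expr2 ReM.
  rewrite (_ : _ / 2 = Re z ^+ 2); last by field.
  by rewrite sqrtr_sqr gtr0_norm.
have E2 (z : C) : 0 < Re z -> Im z = Im (z ^+ 2) / (2 * Re z).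
  by move=> z0; rewrite expr2 ImM; field; rewrite gt_eqF.
have cr : ccontinuous_on a b (fun x => (Re (w x))%:C).
  apply: (@ccont_eq _ _ _ (fun x => (Num.sqrt ((cabs (w x ^+ 2) + Re (w x ^+ 2)) / 2))%:C)).
    by move=> x xab; rewrite -E1// w0.
  split => /=; last by move=> x; exact: cvg_cst.
  apply: cont_sqrt => x; apply: cvgMl; apply: cvgD.
    exact: (cont_cabs cv).
  by have [c1 _] := cv; exact: c1.
have ci : ccontinuous_on a b (fun x => (Im (w x))%:C).
  apply: (@ccont_eq _ _ _ (fun x => (Im (w x ^+ 2))%:C * (2%:R * (Re (w x))%:C)^-1)).
    move=> x xab; rewrite (E2 _ (w0 _ xab)) rmorphM fmorphV rmorphM rmorph_nat //.
  apply: ccontM.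
    by split => /=; [have [_ c2] := cv; exact: c2|move=> x; exact: cvg_cst].
  apply: ccontV; first by apply: ccontM => //; exact: ccont_cst.
  move=> x xab; rewrite mulf_neq0 ?pnatr_eq0//.
  by rewrite -cabs_eq0 cabs_real normr_eq0 gt_eqF// w0.
by split; [have [] := cr|have [] := ci].
Qed.

End Branches.

(** * Regularity of the coefficient functions and of their roots *)

Section Coefficients.
Context {R : realType}.
Local Notation C := R[i].
Local Notation mu := (@lebesgue_measure R).
Variables (xl xr : R) (al be ga : R -> C) (tha thb : R -> R) (k : C).
Hypothesis lr : xl < xr.
Hypothesis asm : sl_assumptions xl xr al be ga.
Hypothesis argA : continuous_arg xl xr al tha.
Hypothesis argB : continuous_arg xl xr be thb.
Hypothesis adm : admissible xl xr ga k.

Local Notation I x := (xl <= x <= xr).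
Let le_lr := ltW lr.

Let acA : abs_continuous xl xr al. Proof. by have [] := slA2 asm. Qed.
Lemma ac_be : abs_continuous xl xr be. Proof. by have [] := slA2 asm. Qed.
Let acB := ac_be.
Let acG : abs_continuous xl xr ga. Proof. by have [_ []] := slA5 asm. Qed.

(** The lower bound is assumed on the open interval; continuity carries it to the end points. *)
Lemma al_be_neq0 x : I x -> al x * be x != 0.
Proof.
move=> xI; have cAB : ccontinuous_on xl xr (fun x => al x * be x).
  by apply: ccontM; exact: ac_ccont.
set i := inf [set cabs (al x * be x) | x in `]xl, xr[%classic].
have i0 : 0 < i := slA3 asm.
have li y : xl < y < xr -> i <= cabs (al y * be y).
  move=> yI; apply: ge_inf; first by exists 0 => _ [t _ <-]; exact: cabs_ge0.
  by exists y.
apply/eqP => h0.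
have [d d0 Hd] := ccont_uniform le_lr cAB i0.
(* From a supposed zero [x], a short step towards the midpoint leads to an interior [y] within the
   modulus of continuity. Adding 1 in [L] avoids dividing by zero when [x] is the midpoint, and
   [t <= 1 / 2] keeps [y] strictly inside. *)
pose m := (xl + xr) / 2.
pose t := Num.min (d / 2) (1 / 2).
have t0 : 0 < t by rewrite lt_min !divr_gt0.
have t1 : t <= 1 / 2 by rewrite ge_min lexx orbT.
have td : t < d by rewrite gt_min ltr_pdivrMr// ltr_pMr// ltr1n.
pose L := `|m - x| + 1.
have L0 : 1 <= L by rewrite lerDr.
have L00 : 0 < L by exact: lt_le_trans L0.
pose y := x + t / L * (m - x).
have tL0 : 0 < t / L by rewrite divr_gt0.
have tL1 : t / L <= 1 / 2.
  by rewrite ler_pdivrMr//; apply: le_trans t1 _; rewrite ler_pMr.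
have /andP[x1 x2] := xI.
have yI : xl < y < xr.
  have e1 : y = (1 - t / L) * x + t / L * m by rewrite /y; ring.
  have h1 : xl < m by rewrite /m ltr_pdivlMr// mulr_natr mulr2n ltrD2l.
  have h2 : m < xr by rewrite /m ltr_pdivrMr// mulr_natr mulr2n ltrD2r.
  rewrite e1; set w := t / L in tL0 tL1 *.
  have w1 : 0 <= 1 - w by rewrite subr_ge0 (le_trans tL1)// ler_pdivrMr// mul1r ler1n.
  apply/andP; split; rewrite -subr_gt0.
    rewrite (_ : _ - xl = (1 - w) * (x - xl) + w * (m - xl)); last by ring.
    by apply: ltr_wpDl; [rewrite mulr_ge0// subr_ge0|rewrite mulr_gt0// subr_gt0].
  rewrite (_ : xr - _ = (1 - w) * (xr - x) + w * (xr - m)); last by ring.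
  by apply: ltr_wpDl; [rewrite mulr_ge0// subr_ge0|rewrite mulr_gt0// subr_gt0].
have := li y yI; rewrite leNgt => /negP; apply.
have /andP[y1 y2] := yI.
have -> : al y * be y = al y * be y - al x * be x by rewrite h0 subr0.
apply: Hd => //; first by rewrite !ltW.
rewrite /y addrAC subrr add0r normrM gtr0_norm// mulrAC ltr_pdivrMr//.
apply: (@le_lt_trans _ _ (t * L)); last by rewrite ltr_pM2r.
by rewrite ler_pM2l// lerDl.
Qed.

Lemma al_neq0 x : I x -> al x != 0.
Proof. by move=> /al_be_neq0; rewrite mulf_eq0 negb_or => /andP[]. Qed.
Lemma be_neq0 x : I x -> be x != 0.
Proof. by move=> /al_be_neq0; rewrite mulf_eq0 negb_or => /andP[]. Qed.

Lemma gsq_neq0 x : I x -> gsq ga k x != 0.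
Proof. by move=> xI; have [_ [h _]] := adm; apply: h; rewrite in_itv. Qed.

Lemma k_neq0 : k != 0. Proof. by have [] := adm. Qed.

Let argAE x : I x -> al x = (cabs (al x))%:C * cis (tha x).
Proof. by move=> xI; have [_ h] := argA; apply: h; rewrite in_itv. Qed.
Let argBE x : I x -> be x = (cabs (be x))%:C * cis (thb x).
Proof. by move=> xI; have [_ h] := argB; apply: h; rewrite in_itv. Qed.

Local Notation mu_ := (muf al be tha thb).
Local Notation g_ := (gf ga k).
Local Notation n_ := (nf al be ga tha thb k).
Local Notation p_ := (bn al be ga tha thb k).
Local Notation w_ := (sqrt_bn al be ga tha thb k).
Local Notation wm_ := (sqrt_bmu al be tha thb).
Local Notation wg_ := (sqrt_g ga k).

Let cabs_cont f : abs_continuous xl xr f -> {within `[xl, xr], continuous (fun x => cabs (f x))}.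
Proof. by move=> acf; apply: cont_cabs; exact: ac_ccont. Qed.

Lemma muf_sqr x : I x -> mu_ x ^+ 2 = (al x * be x)^-1.
Proof.
move=> xI; have n0 := al_be_neq0 xI.
apply: (mulIf n0); rewrite mulVf// (argAE xI) (argBE xI).
rewrite /muf polar_sqr powRN powR12_sqrt ?cabs_ge0// exprVn sqr_sqrtr ?cabs_ge0//.
rewrite (_ : - (tha x + thb x) / 2 + - (tha x + thb x) / 2 = - (tha x + thb x)); last by field.
set t := tha x + thb x.
transitivity (((cabs (al x * be x))^-1)%:C * (cabs (al x))%:C * (cabs (be x))%:C *
   (cis (- t) * (cis (tha x) * cis (thb x))) : C); first by ring.
rewrite -!cisD -/t addNr cis0 mulr1 -!rmorphM /= -mulrA -cabsM mulVf//.
by rewrite cabs_eq0.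
Qed.

Let sqr_neq0 (z y : C) : z ^+ 2 = y -> y != 0 -> z != 0.
Proof. by move=> <-; rewrite expf_eq0. Qed.

Lemma muf_neq0 x : I x -> mu_ x != 0.
Proof. by move=> xI; apply: sqr_neq0 (muf_sqr xI) _; rewrite invr_eq0 al_be_neq0. Qed.

Lemma gf_sqr x : I x -> g_ x ^+ 2 = gsq ga k x.
Proof.
move=> xI; have [_ e] := carg_spec (gsq_neq0 xI).
rewrite /gf polar_sqr powR12_sqrt ?cabs_ge0// sqr_sqrtr ?cabs_ge0//.
by rewrite -splitr -e.
Qed.

Lemma gf_neq0 x : I x -> g_ x != 0.
Proof. by move=> xI; exact: sqr_neq0 (gf_sqr xI) (gsq_neq0 xI). Qed.

Lemma muf_cont : ccontinuous_on xl xr mu_.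
Proof.
apply: ccont_polar.
  have cr : {within `[xl, xr], continuous (fun x => Num.sqrt (cabs (al x * be x)))}.
    by apply: cont_sqrt; apply: cabs_cont; exact: acM.
  apply: (@cont_ext _ _ _ (fun x => (Num.sqrt (cabs (al x * be x)))^-1)).
    by move=> x; rewrite powRN powR12_sqrt// cabs_ge0.
  move/subspace_continuousP : cr => cr; apply/subspace_continuousP => x xI.
  apply: cvgV; last exact: cr.
  by rewrite gt_eqF// sqrtr_gt0 cabs_gt0 al_be_neq0//; move: xI; rewrite /= in_itv.
have [ca _] := argA; have [cb _] := argB => x.
by apply: cvgMl; apply: cvgN; apply: cvgD; [exact: ca|exact: cb].
Qed.

Lemma muf_ac : abs_continuous xl xr mu_.
Proof.
apply: (ac_sqrt le_lr muf_cont muf_neq0).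
apply: (@ac_eq _ _ _ (fun x => (al x * be x)^-1)); first by move=> x xI; rewrite muf_sqr.
by apply: acV => //; [exact: acM|exact: al_be_neq0].
Qed.

Lemma gf_cont : ccontinuous_on xl xr g_. Proof. by have [_ [_]] := adm. Qed.

Lemma gf_ac : abs_continuous xl xr g_.
Proof.
apply: (ac_sqrt le_lr gf_cont gf_neq0).
apply: (@ac_eq _ _ _ (fun x => 1 + (k ^+ 2)^-1 * ga x)).
  by move=> x xI; rewrite gf_sqr// /gsq mulrC.
by apply: acD; [exact: ac_cst|exact: acZ].
Qed.

Lemma nf_cont : ccontinuous_on xl xr n_.
Proof. by apply: ccontM; [exact: muf_cont|exact: gf_cont]. Qed.

Lemma nf_neq0 x : I x -> n_ x != 0.
Proof. by move=> xI; rewrite mulf_neq0 ?muf_neq0 ?gf_neq0. Qed.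

(** The algebraic relation by which [n] encodes the potential; it turns the first-order system back
    into the equation with eigenvalue [- k ^ 2]. *)
Lemma nf_sqr x : I x -> al x * be x * (k * n_ x) ^+ 2 = k ^+ 2 + ga x.
Proof.
move=> xI; have -> : (k * n_ x) ^+ 2 = k ^+ 2 * (mu_ x ^+ 2 * g_ x ^+ 2) by rewrite /nf; ring.
rewrite muf_sqr// gf_sqr// /gsq.
by field; rewrite k_neq0 al_neq0// be_neq0.
Qed.

Lemma bn_ac : abs_continuous xl xr p_.
Proof. by apply: acM => //; apply: acM => //; [exact: muf_ac|exact: gf_ac]. Qed.

Lemma bn_neq0 x : I x -> p_ x != 0.
Proof. by move=> xI; rewrite mulf_neq0 ?be_neq0 ?nf_neq0. Qed.

Lemma sqrt_bmu_sqr x : I x -> wm_ x ^+ 2 = be x * mu_ x.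
Proof.
move=> xI.
have a0 : cabs (al x) != 0 by rewrite cabs_eq0 al_neq0.
rewrite /sqrt_bmu polar_sqr powR4 ?cabs_ge0// sqr_sqrtr ?sqrtr_ge0//.
rewrite {2}(argBE xI) /muf powRN powR12_sqrt ?cabs_ge0//.
rewrite (_ : (thb x - tha x) / 4 + (thb x - tha x) / 4 = thb x + - (tha x + thb x) / 2); last by field.
rewrite cisD.
rewrite [RHS](_ : _ = (cabs (be x))%:C * (Num.sqrt (cabs (al x * be x)))^-1%:C *
  (cis (thb x) * cis (- (tha x + thb x) / 2))); last by ring.
congr (_ * _); rewrite -rmorphM; congr (_%:C).
rewrite cabsM cabsV !cabsM !sqrtrM ?cabs_ge0// sqrtrV ?cabs_ge0//.
rewrite -{2}(sqr_sqrtr (cabs_ge0 (be x))); field.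
by rewrite !sqrtr_eq0 -!ltNge !cabs_gt0 al_neq0// be_neq0.
Qed.

Lemma sqrt_g_sqr x : I x -> wg_ x ^+ 2 = g_ x.
Proof.
move=> xI; rewrite /sqrt_g /gf polar_sqr powR4 ?cabs_ge0// sqr_sqrtr ?sqrtr_ge0//.
rewrite powR12_sqrt ?cabs_ge0//; congr (_ * cis _).
by field.
Qed.

Lemma sqrt_bn_sqr x : I x -> w_ x ^+ 2 = p_ x.
Proof.
move=> xI; have -> : w_ x ^+ 2 = wm_ x ^+ 2 * wg_ x ^+ 2 by rewrite /sqrt_bn; ring.
by rewrite sqrt_bmu_sqr// sqrt_g_sqr// /bn /nf mulrA.
Qed.

Lemma sqrt_bn_neq0 x : I x -> w_ x != 0.
Proof. by move=> xI; exact: sqr_neq0 (sqrt_bn_sqr xI) (bn_neq0 xI). Qed.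

Lemma sqrt_bmu_cont : ccontinuous_on xl xr wm_.
Proof.
apply: ccont_polar.
  apply: (@cont_ext _ _ _ (fun x => Num.sqrt (Num.sqrt (cabs (be x / al x))))).
    by move=> x; rewrite powR4// cabs_ge0.
  apply: cont_sqrt; apply: cont_sqrt; apply: cabs_cont; apply: acM => //.
  by apply: acV => //; exact: al_neq0.
have [ca _] := argA; have [cb _] := argB => x.
by apply: cvgMl; apply: cvgB; [exact: cb|exact: ca].
Qed.

(** A quarter of the argument lies between [- pi / 8] and [3 pi / 8], so the root stays in the right
    half-plane, and its square [g] is continuous by admissibility. No continuity of [carg] is
    involved. *)
Lemma sqrt_g_cont : ccontinuous_on xl xr wg_.
Proof.
apply: ccont_right_sqrt; last first.
  apply: (@ccont_eq _ _ _ g_); last exact: gf_cont.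
  by move=> x xI; rewrite sqrt_g_sqr.
move=> x xI; rewrite /sqrt_g ReM /= mul0r subr0.
have [/andP[h1 h2] _] := carg_spec (gsq_neq0 xI).
rewrite mulr_gt0// ?powR_gt0 ?cabs_gt0 ?gsq_neq0//.
apply: cos_gt0_pihalf; have := pi_gt0 R => pi0.
by apply/andP; split; lra.
Qed.

Lemma sqrt_bn_ac : abs_continuous xl xr w_.
Proof.
apply: (ac_sqrt le_lr _ sqrt_bn_neq0).
  by apply: ccontM; [exact: sqrt_bmu_cont|exact: sqrt_g_cont].
by apply: ac_eq bn_ac => x xI; rewrite sqrt_bn_sqr.
Qed.

Definition logder x : C := cderiv p_ x / p_ x.

Lemma logder_L1 : L1 `[xl, xr] logder.
Proof.
apply: (L1_ext (f := fun x => (p_ x)^-1 * cderiv p_ x)); first by move=> x; rewrite mulrC.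
apply: L1M => //; last exact: ac_L1 lr bn_ac.
by apply: ac_ccont; apply: acV => //; [exact: bn_ac|exact: bn_neq0].
Qed.

Lemma near_itv (P : R -> Prop) x : (forall y, I y -> P y) -> xl < x < xr -> \near x, P x.
Proof.
move=> H /andP[x1 x2]; near=> y; apply: H; apply/andP; split; apply: ltW.
  by near: y; exact: lt_nbhsr.
by near: y; exact: lt_nbhsl.
Unshelve. all: by end_near. Qed.

(** Absolute continuity provides the derivatives almost everywhere; their values follow by
    differentiating [w ^ 2 = p] and [w * w^-1 = 1]. *)
Lemma sqrt_bn_cder : {ae mu, forall x, xl < x < xr ->
  cder w_ x (2%:R^-1 * logder x * w_ x) /\
  cder (fun x => (w_ x)^-1) x (- (2%:R^-1 * logder x * (w_ x)^-1))}.
Proof.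
have acV' : abs_continuous xl xr (fun x => (w_ x)^-1).
  by apply: acV => //; [exact: sqrt_bn_ac|exact: sqrt_bn_neq0].
apply: ae_imply (ae_and (ac_cder lr bn_ac) (ae_and (ac_cder lr sqrt_bn_ac) (ac_cder lr acV'))).
move=> x [h1 [h2 h3]] xI; have {}h1 := h1 xI; have {}h2 := h2 xI; have {}h3 := h3 xI.
have xI' : I x by case/andP : xI => /ltW -> /ltW ->.
have w0 := sqrt_bn_neq0 xI'.
have e1 : cderiv p_ x = 2%:R * w_ x * cderiv w_ x.
  apply: (cder_unique h1).
  apply: (@cder_near _ (fun x => w_ x * w_ x)).
    by apply: near_itv xI => y yI; rewrite -expr2 sqrt_bn_sqr.
  by apply: cder_eq (cderM h2 h2); ring.
have e2 : cderiv w_ x = 2%:R^-1 * logder x * w_ x.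
  by rewrite /logder e1 -(sqrt_bn_sqr xI'); field.
have e3 : cderiv w_ x * (w_ x)^-1 + w_ x * cderiv (fun x => (w_ x)^-1) x = 0.
  apply: (@cder_unique _ (fun=> 1) x); last exact: cder_cst.
  apply: (@cder_near _ (fun x => w_ x * (w_ x)^-1)); last exact: cderM.
  by apply: near_itv xI => y yI; rewrite mulfV// sqrt_bn_neq0.
split; first by rewrite -e2.
rewrite (_ : - _ = cderiv (fun x => (w_ x)^-1) x)//.
apply: (mulfI w0); rewrite -[RHS](addKr (cderiv w_ x * (w_ x)^-1)) e3 addr0 e2.
by field.
Qed.

End Coefficients.

Lemma wronskian_scale (F : fieldType) (k n be w u1 u2 v1 v2 : F) : w != 0 ->
  be * n = w ^+ 2 ->
  u1 / w * (be * (k * n * v2 / w)) - be * (k * n * v1 / w) * (u2 / w) =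
  k * (u1 * v2 - v1 * u2).
Proof.
move=> w0 e; transitivity (k * (be * n) * (u1 * v2 - v1 * u2) / w ^+ 2); first by field.
by rewrite e; field.
Qed.

(** * The equation and its boundary conditions *)

Section Solutions.
Context {R : realType}.
Local Notation C := R[i].
Local Notation mu := (@lebesgue_measure R).
Variables (xl xr : R) (al be ga : R -> C) (tha thb : R -> R) (k : C).
Hypothesis lr : xl < xr.
Hypothesis asm : sl_assumptions xl xr al be ga.
Hypothesis argA : continuous_arg xl xr al tha.
Hypothesis argB : continuous_arg xl xr be thb.
Hypothesis adm : admissible xl xr ga k.

Local Notation I x := (xl <= x <= xr).
Let le_lr := ltW lr.
Local Notation n_ := (nf al be ga tha thb k).
Local Notation p_ := (bn al be ga tha thb k).
Local Notation w_ := (sqrt_bn al be ga tha thb k).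
Local Notation q_ := (logder al be ga tha thb k).

(** The solution predicate without its boundary conditions and with the derivative exposed, so that
    solutions can be combined linearly before the boundary conditions are imposed. *)
Definition sl_ode (lam : C) (y dy : R -> C) :=
  [/\ has_deriv_on xl xr y dy, abs_continuous xl xr (fun x => be x * dy x) &
  {ae mu, forall x, `]xl, xr[%classic x ->
      al x * cderiv (fun t => be t * dy t) x + ga x * y x = lam * y x}].

Let acB := ac_be asm.
Let be0 := be_neq0 lr asm.
Let al0 := al_neq0 lr asm.

Lemma sl_ode_ac lam y dy : sl_ode lam y dy -> abs_continuous xl xr y.
Proof.
move=> [hd az _]; apply: (has_deriv_ac le_lr hd).
apply: (@ccont_eq _ _ _ (fun x => (be x)^-1 * (be x * dy x))).
  by move=> x xI; rewrite mulKf// be0.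
apply: ccontM; last exact: ac_ccont.
by apply: ac_ccont; apply: acV.
Qed.

Lemma wronskian_const lam y1 dy1 y2 dy2 x : sl_ode lam y1 dy1 -> sl_ode lam y2 dy2 ->
  I x -> y1 x * (be x * dy2 x) - be x * dy1 x * y2 x =
         y1 xl * (be xl * dy2 xl) - be xl * dy1 xl * y2 xl.
Proof.
move=> s1 s2 xI; have [hd1 az1 e1] := s1; have [hd2 az2 e2] := s2.
have ay1 := sl_ode_ac s1; have ay2 := sl_ode_ac s2.
pose W x := y1 x * (be x * dy2 x) + (-1) * (be x * dy1 x * y2 x).
have acW : abs_continuous xl xr W.
  apply: acD; first exact: acM.
  by apply: acZ => //; apply: acM.
have dW : {ae mu, forall x, xl < x < xr -> cder W x 0}.
  apply: ae_imply (ae_and (ae_and e1 e2) (ae_and (ac_cder lr az1) (ac_cder lr az2))).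
  move=> t [[h1 h2] [d1 d2]] tI; have {}d1 := d1 tI; have {}d2 := d2 tI.
  have {}h1 : al t * cderiv (fun t => be t * dy1 t) t + ga t * y1 t = lam * y1 t.
    by apply: h1; rewrite /= in_itv.
  have {}h2 : al t * cderiv (fun t => be t * dy2 t) t + ga t * y2 t = lam * y2 t.
    by apply: h2; rewrite /= in_itv.
  have tI' : I t by case/andP : tI => /ltW -> /ltW ->.
  set z1' := cderiv _ t in h1 d1; set z2' := cderiv _ t in h2 d2.
  have g1 := has_deriv_cder hd1 tI; have g2 := has_deriv_cder hd2 tI.
  apply: cder_eq (cderD (cderM g1 d2) (cderZ (-1) (cderM d1 g2))).
  (* Lagrange's identity: once the equation eliminates the second derivatives, the terms with [lam]
     and [ga] cancel. *)
  have E1 : z1' = (lam * y1 t - ga t * y1 t) / al t by rewrite -h1; field; exact: al0.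
  have E2 : z2' = (lam * y2 t - ga t * y2 t) / al t by rewrite -h2; field; exact: al0.
  by rewrite E1 E2; field; exact: al0.
have L0 : L1 `[xl, xr] (fun=> 0 : C) by apply: L1_cont; exact: ccont_cst.
have := ac_primitive lr acW L0 dW xI.
have -> : cint xl x (fun=> 0) = 0 :> C.
  transitivity (cint xl x (fun=> 0 * (0 : C))).
    by apply: cint_eq => t _; rewrite mul0r.
  by rewrite (cintZ _ (L1_init L0 xI)) [LHS]mul0r.
by rewrite addr0 /W !mulN1r.
Qed.

Lemma sl_ode_lin lam y1 dy1 y2 dy2 (c s : C) : sl_ode lam y1 dy1 -> sl_ode lam y2 dy2 ->
  sl_ode lam (fun x => c * y1 x + s * y2 x) (fun x => c * dy1 x + s * dy2 x).
Proof.
move=> s1 s2; have [hd1 az1 e1] := s1; have [hd2 az2 e2] := s2.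
have acZ12 : abs_continuous xl xr (fun x => c * (be x * dy1 x) + s * (be x * dy2 x)).
  by apply: acD; apply: acZ.
have EZ : (fun x => be x * (c * dy1 x + s * dy2 x)) =
    (fun x => c * (be x * dy1 x) + s * (be x * dy2 x)) by apply/funext => x; ring.
split.
- have cd y dy : sl_ode lam y dy -> ccontinuous_on xl xr dy.
    move=> [_ az _]; apply: (@ccont_eq _ _ _ (fun x => (be x)^-1 * (be x * dy x))).
      by move=> x xI; rewrite mulKf// be0.
    by apply: ccontM; [apply: ac_ccont; apply: acV|exact: ac_ccont].
  have cdy : ccontinuous_on xl xr (fun x => c * dy1 x + s * dy2 x).
    by apply: ccontD; apply: ccontM; [exact: ccont_cst|exact: cd s1|exact: ccont_cst|exact: cd s2].
  (* The one-sided derivatives at the end points are recovered by presenting the combination as the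
     primitive of its continuous derivative. *)
  apply: (@cont_primitive_has_deriv _ _ _ (c * y1 xl + s * y2 xl) _ _ lr cdy).
  move=> x xI.
  apply: (@ac_primitive _ xl xr (fun x => c * y1 x + s * y2 x) _ x lr _ (L1_cont cdy)) => //.
    by apply: acD; apply: acZ => //; [exact: sl_ode_ac s1|exact: sl_ode_ac s2].
  apply: aeW => t tI; apply: cderD; apply: cderZ.
    exact: has_deriv_cder hd1 tI.
  exact: has_deriv_cder hd2 tI.
- by rewrite EZ.
- apply: ae_imply (ae_and (ae_and e1 e2) (ae_and (ac_cder lr az1) (ac_cder lr az2))).
  move=> t [[h1 h2] [d1 d2]] tI; have {}h1 := h1 tI; have {}h2 := h2 tI.
  have tI' : xl < t < xr by move: tI; rewrite /= in_itv.
  rewrite EZ (cder_cderiv (cderD (cderZ c (d1 tI')) (cderZ s (d2 tI')))).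
  set z1' := cderiv _ t in h1 *; set z2' := cderiv _ t in h2 *.
  transitivity (c * (al t * z1' + ga t * y1 t) + s * (al t * z2' + ga t * y2 t)); first by ring.
  by rewrite h1 h2; ring.
Qed.

(** Dividing [U] by [w] cancels its [q] term, since [w^-1] has logarithmic derivative [- q / 2]. As
    [be n = w ^ 2], the quasi-derivative equals [k w V], whose [q] terms cancel in the same way. *)
Lemma pair_ode U V : osc_pair xl xr n_ q_ k U V ->
  sl_ode (- k ^+ 2) (fun x => U x / w_ x) (fun x => k * n_ x * V x / w_ x).
Proof.
move=> [acU acV' dU dV].
have acw := sqrt_bn_ac lr asm argA argB adm.
have w0 := sqrt_bn_neq0 lr asm argA argB adm.
have wE := sqrt_bn_sqr tha k lr asm argB.
have acwi : abs_continuous xl xr (fun x => (w_ x)^-1) by apply: acV.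
have cdy : ccontinuous_on xl xr (fun x => k * n_ x * V x / w_ x).
  apply: ccontM; last exact: ac_ccont.
  apply: ccontM; last exact: ac_ccont.
  by apply: ccontM; [exact: ccont_cst|exact: nf_cont lr asm argA argB adm].
have EZ x : I x -> k * w_ x * V x = be x * (k * n_ x * V x / w_ x).
  move=> xI; apply: (mulIf (w0 x xI)).
  rewrite (_ : be x * _ * w_ x = k * V x * (be x * n_ x) * ((w_ x)^-1 * w_ x)); last by ring.
  by rewrite mulVf ?w0// -[be x * _]/(p_ x) -wE//; ring.
have acKZ : abs_continuous xl xr (fun x => k * w_ x * V x).
  by apply: acM => //; apply: acZ.
have dw := sqrt_bn_cder lr asm argA argB adm.
split.
- apply: (@cont_primitive_has_deriv _ _ _ (U xl / w_ xl) _ _ lr cdy) => x xI.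
  apply: (@ac_primitive _ xl xr (fun x => U x / w_ x) _ x lr _ (L1_cont cdy)) => //.
    exact: acM.
  apply: ae_imply (ae_and dU dw) => t [h1 h2] tI; have [_ {}h2] := h2 tI.
  by apply: cder_eq (cderM (h1 tI) h2); ring.
- exact: ac_eq EZ acKZ.
- apply: ae_imply (ae_and dV dw) => t [h1 h2] tI.
  have tI' : xl < t < xr by move: tI; rewrite /= in_itv.
  have tI2 : I t by case/andP : tI' => /ltW -> /ltW ->.
  have [{}h2 _] := h2 tI'.
  have D : cder (fun x => be x * (k * n_ x * V x / w_ x)) t (- (k ^+ 2 * n_ t * w_ t * U t)).
    apply: (@cder_near _ (fun x => k * w_ x * V x)); first exact: near_itv EZ tI'.
    by apply: cder_eq (cderM (cderZ k h2) (h1 tI')); ring.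
  rewrite (cder_cderiv D).
  have E := nf_sqr lr asm argA argB adm tI2.
  have -> : ga t = al t * be t * (k * n_ t) ^+ 2 - k ^+ 2 by rewrite E; ring.
  have W2 : be t * n_ t = w_ t ^+ 2 by rewrite wE.
  transitivity (- (al t * k ^+ 2 * n_ t * U t * w_ t) +
    al t * k ^+ 2 * n_ t * (be t * n_ t) * (U t / w_ t) - k ^+ 2 * (U t / w_ t)); first by ring.
  by rewrite W2; field; exact: w0.
Qed.

Local Notation U1 := (sumC xl n_ q_ k).
Local Notation U2 := (sumS xl n_ q_ k).
Local Notation V1 := (fun x => - altS xl n_ q_ k x).
Local Notation V2 := (altC xl n_ q_ k).

Definition fund1 x : C := U1 x / w_ x.
Definition fund2 x : C := U2 x / w_ x.
Definition dfund1 x : C := k * n_ x * - altS xl n_ q_ k x / w_ x.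
Definition dfund2 x : C := k * n_ x * altC xl n_ q_ k x / w_ x.

Let cn := nf_cont lr asm argA argB adm.
Let iq := logder_L1 lr asm argA argB adm.

Lemma fund1_ode : sl_ode (- k ^+ 2) fund1 dfund1.
Proof. exact: pair_ode (osc_pair1 lr cn iq k). Qed.

Lemma fund2_ode : sl_ode (- k ^+ 2) fund2 dfund2.
Proof. exact: pair_ode (osc_pair2 lr cn iq k). Qed.

Let k0 : k != 0 := k_neq0 adm.

Lemma fund_init : [/\ fund1 xl = (w_ xl)^-1, dfund1 xl = 0, fund2 xl = 0 &
  dfund2 xl = k * n_ xl / w_ xl].
Proof.
have [e1 e2 e3 e4] := osc_pair_init lr cn iq k.
rewrite /fund1 /dfund1 /fund2 /dfund2 e1 e2 e3 e4.
by split; rewrite ?oppr0 ?mulr0 ?mul0r ?mul1r ?mulr1.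
Qed.

Let xlI : I xl. Proof. by rewrite lexx le_lr. Qed.
Let xrI : I xr. Proof. by rewrite lexx le_lr. Qed.

(** By constancy it can be evaluated at [xl], where [k be n / w ^ 2 = k]. *)
Lemma fund_wronskian x : I x ->
  fund1 x * (be x * dfund2 x) - be x * dfund1 x * fund2 x = k.
Proof.
move=> xI; rewrite (wronskian_const fund1_ode fund2_ode xI).
have [-> -> -> ->] := fund_init.
rewrite !mulr0 subr0.
have wE := sqrt_bn_sqr tha k lr asm argB xlI.
have w0 := sqrt_bn_neq0 lr asm argA argB adm xlI.
transitivity (k * (be xl * n_ xl) / w_ xl ^+ 2); first by field.
by rewrite wE -[be xl * _]/(p_ xl) mulfK// (bn_neq0 lr asm argA argB adm).
Qed.

(** The counterpart of [cos ^ 2 + sin ^ 2 = 1], to which it reduces when [q = 0]. *)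
Lemma pair_wronskian x : I x -> U1 x * V2 x - V1 x * U2 x = 1.
Proof.
move=> xI; apply: (mulfI k0); rewrite mulr1 -[RHS](fund_wronskian xI).
have wE := sqrt_bn_sqr tha k lr asm argB xI.
have w0 := sqrt_bn_neq0 lr asm argA argB adm xI.
by rewrite /fund1 /fund2 /dfund1 /dfund2 wronskian_scale// wE.
Qed.

Lemma ode_span y dy : sl_ode (- k ^+ 2) y dy -> exists c s : C, forall x, I x ->
  y x = c * fund1 x + s * fund2 x /\ dy x = c * dfund1 x + s * dfund2 x.
Proof.
move=> so.
set W1 := y xl * (be xl * dfund1 xl) - be xl * dy xl * fund1 xl.
set W2 := y xl * (be xl * dfund2 xl) - be xl * dy xl * fund2 xl.
(* Cramer's rule: the coefficients are the constant Wronskians of [y] with the other basis solution,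
   divided by the Wronskian [k] of the basis. *)
exists (W2 / k), (- W1 / k) => x xI.
have h1 : y x * (be x * dfund1 x) - be x * dy x * fund1 x = W1 := wronskian_const so fund1_ode xI.
have h2 : y x * (be x * dfund2 x) - be x * dy x * fund2 x = W2 := wronskian_const so fund2_ode xI.
have h := fund_wronskian xI.
have b0 := be0 xI.
split; apply: (mulfI k0).
  rewrite -{1}h -h1 -h2; field; exact: k0.
rewrite -{1}h -h1 -h2; field; exact: k0.
Qed.

(** At an interior point the derivative of the zero combination also vanishes, and the Wronskian [k]
    there is nonzero. *)
Lemma fund_free (c s : C) : (forall x, I x -> c * fund1 x + s * fund2 x = 0) -> c = 0 /\ s = 0.
Proof.
move=> y0; pose m := (xl + xr) / 2.
have mI : xl < m < xr.
  by rewrite /m !midf_lt.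
have mI' : I m by case/andP : mI => /ltW -> /ltW ->.
have [hd _ _] := sl_ode_lin c s fund1_ode fund2_ode.
have dy0 : c * dfund1 m + s * dfund2 m = 0.
  apply: cder_unique (has_deriv_cder hd mI) _.
  apply: (@cder_near _ (fun=> 0)); last exact: cder_cst.
  by apply: near_itv mI => t tI; rewrite y0.
have h := fund_wronskian mI'; have e := y0 m mI'.
split; apply: (mulIf k0); rewrite mul0r -h.
  transitivity (be m * ((c * fund1 m + s * fund2 m) * dfund2 m -
    (c * dfund1 m + s * dfund2 m) * fund2 m)); first by ring.
  by rewrite e dy0; ring.
transitivity (be m * ((c * dfund1 m + s * dfund2 m) * fund1 m -
    (c * fund1 m + s * fund2 m) * dfund1 m)); first by ring.
by rewrite e dy0; ring.
Qed.

Variables (a b : 'M[C]_2).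

Definition bform (i : 'I_2) (y dy : R -> C) : C :=
  a i 0 * y xl + a i 1 * dy xl + b i 0 * y xr + b i 1 * dy xr.

Lemma bform_lin i (c s : C) y1 dy1 y2 dy2 :
  bform i (fun x => c * y1 x + s * y2 x) (fun x => c * dy1 x + s * dy2 x) =
  c * bform i y1 dy1 + s * bform i y2 dy2.
Proof. by rewrite /bform; ring. Qed.

Local Notation M1 i := (bform i fund1 dfund1).
Local Notation M2 i := (bform i fund2 dfund2).

Lemma solution_span y : sl_solution xl xr al be ga a b (- k ^+ 2) y ->
  exists c s : C, (forall x, I x -> y x = c * fund1 x + s * fund2 x) /\
    (forall i, c * M1 i + s * M2 i = 0).
Proof.
move=> [dy [hd [az [ode bc]]]].
have [|c [s H]] := @ode_span y dy; first by split.
exists c, s; split=> [x /H[]//|i].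
have := bc i; have [-> ->] := H xl xlI; have [-> ->] := H xr xrI => <-.
by rewrite -bform_lin.
Qed.

Lemma span_solution (c s : C) : (forall i, c * M1 i + s * M2 i = 0) ->
  sl_solution xl xr al be ga a b (- k ^+ 2) (fun x => c * fund1 x + s * fund2 x).
Proof.
move=> H; have [hd az ode] := sl_ode_lin c s fund1_ode fund2_ode.
exists (fun x => c * dfund1 x + s * dfund2 x); do 3 (split => //).
by move=> i; have := bform_lin i c s fund1 dfund1 fund2 dfund2; rewrite H.
Qed.

Lemma span_eigenfunction (c s : C) : (forall i, c * M1 i + s * M2 i = 0) ->
  c != 0 \/ s != 0 ->
  sl_eigenfunction xl xr al be ga a b (- k ^+ 2) (fun x => c * fund1 x + s * fund2 x).
Proof.
move=> H cs0; split; first exact: span_solution.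
have [//|nex] := pselect (exists2 x, x \in `[xl, xr] & c * fund1 x + s * fund2 x != 0).
have [] := @fund_free c s.
  move=> x xI; apply/eqP; apply: contrapT => /negP yx; apply: nex.
  by exists x => //; rewrite in_itv.
by move=> c0 s0; move: cs0; rewrite c0 s0 eqxx => -[].
Qed.

Definition bdet : C := M1 0 * M2 1 - M2 0 * M1 1.

Lemma ord2P (P : 'I_2 -> Prop) : P 0 -> P 1 -> forall i, P i.
Proof.
move=> P0 P1 i; have [->//|i0] := eqVneq i 0.
suff -> : i = 1 by [].
by apply/val_inj; case: i i0 => [[|[|]]].
Qed.

Lemma eigenvalue_bdet : sl_eigenvalue xl xr al be ga a b (- k ^+ 2) <-> bdet = 0.
Proof.
split=> [[y [ys [x]]]|d0].
  rewrite in_itv/= => xI yx.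
  have [c [s [yE H]]] := solution_span ys.
  have H0 := H 0; have H1 := H 1.
  have [c0|c0] := eqVneq c 0.
    have s0 : s != 0.
      by apply: contra_neq yx => s0; rewrite yE// c0 s0; ring.
    apply: (mulfI s0); rewrite mulr0.
    transitivity (M1 0 * (c * M1 1 + s * M2 1) - M1 1 * (c * M1 0 + s * M2 0)).
      by rewrite /bdet; ring.
    by rewrite H0 H1; ring.
  apply: (mulfI c0); rewrite mulr0.
  transitivity (M2 1 * (c * M1 0 + s * M2 0) - M2 0 * (c * M1 1 + s * M2 1)).
    by rewrite /bdet; ring.
  by rewrite H0 H1; ring.
suff [c [s [cs0 H]]] : exists c s : C, (c != 0 \/ s != 0) /\
    forall i, c * M1 i + s * M2 i = 0.
  by exists (fun x => c * fund1 x + s * fund2 x); exact: span_eigenfunction.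
(* A nonzero kernel vector is read off from the first row unless that row is zero; then from the
   second row, or [(1, 0)] when the whole first column vanishes. *)
have [z1|z1] := eqVneq (M1 0) 0; last first.
  exists (- M2 0), (M1 0); split; first by right.
  by apply: ord2P; [ring|rewrite -[RHS]d0 /bdet; ring].
have [z2|z2] := eqVneq (M2 0) 0; last first.
  exists (- M2 0), (M1 0); split; first by left; rewrite oppr_eq0.
  by apply: ord2P; [ring|rewrite -[RHS]d0 /bdet; ring].
have [z3|z3] := eqVneq (M1 1) 0.
  exists 1, 0; split; first by left; exact: oner_neq0.
  by apply: ord2P; rewrite ?z1 ?z2 ?z3; ring.
exists (- M2 1), (M1 1); split; first by right.
by apply: ord2P; [rewrite z1 z2; ring|ring].
Qed.

Lemma first_row_span : bdet = 0 -> forall i, - M2 0 * M1 i + M1 0 * M2 i = 0.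
Proof. by move=> d0; apply: ord2P; [ring|rewrite -[RHS]d0 /bdet; ring]. Qed.

(** A nonzero first row already determines its kernel up to a scalar, so every eigenfunction is a
    multiple of the one built from that row. *)
Lemma first_row_unique (c s : C) : (forall i, c * M1 i + s * M2 i = 0) ->
  - M2 0 != 0 \/ M1 0 != 0 -> exists t : C, c = t * - M2 0 /\ s = t * M1 0.
Proof.
move=> /(_ 0) H [m0|m0].
  exists (c / - M2 0); split; first by rewrite divfK.
  have m2 : M2 0 != 0 by rewrite -oppr_eq0.
  apply: (mulIf m2).
  have -> : s * M2 0 = - (c * M1 0) by apply/eqP; rewrite -addr_eq0 addrC H.
  by field.
exists (s / M1 0); split; last by rewrite divfK.
apply: (mulIf m0).
have -> : c * M1 0 = - (s * M2 0) by apply/eqP; rewrite -addr_eq0 H.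
by field.
Qed.

End Solutions.

(** * Minors of the boundary matrix and the boundary determinant *)

Section Minors.
Context {R : realType}.
Local Notation C := R[i].
Variables (a b : 'M[C]_2).

Lemma det2 (M : 'M[C]_2) : \det M = M 0 0 * M 1 1 - M 0 1 * M 1 0.
Proof.
rewrite (expand_det_row _ 0) !big_ord_recl big_ord0 /cofactor !det_mx11 !mxE /=.
rewrite expr0 expr1 addr0 mul1r mulN1r mulrN.
by congr (_ * M _ _ - M _ _ * M _ _); apply/val_inj.
Qed.

Lemma abE (r : 'I_2) : [/\ ab a b r (inord 0) = a r 0, ab a b r (inord 1) = a r 1,
  ab a b r (inord 2) = b r 0 & ab a b r (inord 3) = b r 1].
Proof.
have L (j : 'I_2) : ab a b r (lshift 2 j) = a r j by exact: row_mxEl.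
have H (j : 'I_2) : ab a b r (rshift 2 j) = b r j by exact: row_mxEr.
by split; [rewrite -(L 0)|rewrite -(L 1)|rewrite -(H 0)|rewrite -(H 1)];
  congr (ab a b r _); apply/val_inj; rewrite /= inordK.
Qed.

Lemma abmE : [/\ abm a b 1 2 = a 0 0 * a 1 1 - a 0 1 * a 1 0,
  abm a b 1 3 = a 0 0 * b 1 0 - b 0 0 * a 1 0,
  abm a b 1 4 = a 0 0 * b 1 1 - b 0 1 * a 1 0 &
  [/\ abm a b 2 3 = a 0 1 * b 1 0 - b 0 0 * a 1 1,
      abm a b 2 4 = a 0 1 * b 1 1 - b 0 1 * a 1 1 &
      abm a b 3 4 = b 0 0 * b 1 1 - b 0 1 * b 1 0]].
Proof.
have [e00 e01 e02 e03] := abE 0; have [e10 e11 e12 e13] := abE 1.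
have E (i j : nat) : abm a b i j = ab a b 0 (inord i.-1) * ab a b 1 (inord j.-1) -
    ab a b 0 (inord j.-1) * ab a b 1 (inord i.-1).
  by rewrite /abm; move: (ab a b) => A; rewrite det2 !mxE.
by rewrite !E /= e00 e01 e02 e03 e10 e11 e12 e13.
Qed.

End Minors.

(* With u1 v2 - v1 u2 = 1 the terms in the minors (1,2) and (3,4) of the boundary
   determinant no longer involve the solutions at the right end point. *)
Lemma boundary_determinant (F : fieldType) (k nl nr wl wr bl br u1 u2 v1 v2
    a00 a01 a10 a11 b00 b01 b10 b11 : F) :
  k != 0 -> nl != 0 -> nr != 0 -> wl != 0 -> wr != 0 ->
  bl * nl = wl ^+ 2 -> br * nr = wr ^+ 2 -> u1 * v2 - v1 * u2 = 1 ->
  (a00 * wl^-1 + a01 * 0 + b00 * (u1 / wr) + b01 * (k * nr * v1 / wr)) *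
  (a10 * 0 + a11 * (k * nl / wl) + b10 * (u2 / wr) + b11 * (k * nr * v2 / wr)) -
  (a00 * 0 + a01 * (k * nl / wl) + b00 * (u2 / wr) + b01 * (k * nr * v2 / wr)) *
  (a10 * wl^-1 + a11 * 0 + b10 * (u1 / wr) + b11 * (k * nr * v1 / wr)) =
  k ^+ 2 * nl * nr / (wl * wr) *
  ((br * (a00 * a11 - a01 * a10) + bl * (b00 * b11 - b01 * b10)) / (k * wl * wr) +
   ((a00 * b11 - b01 * a10) / (k * nl) * v2 +
    - ((a01 * b10 - b00 * a11) / (k * nr)) * u1) +
   ((a01 * b11 - b01 * a11) * - v1 +
    (a00 * b10 - b00 * a10) / (k ^+ 2 * nl * nr) * u2)).
Proof.
move=> k0 nl0 nr0 wl0 wr0 el er w1.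
have -> : bl = wl ^+ 2 / nl by rewrite -el mulfK.
have -> : br = wr ^+ 2 / nr by rewrite -er mulfK.
apply/eqP; rewrite -subr_eq0; apply/eqP.
(* The two sides differ by a multiple of the Wronskian relation: the determinant of the two right
   end point forms produces the minor (3,4). *)
transitivity ((b00 * b11 - b01 * b10) * k * nr / wr ^+ 2 * (u1 * v2 - v1 * u2 - 1)).
  by field; rewrite k0 nl0 nr0 wl0 wr0.
by rewrite w1 subrr mulr0.
Qed.

(** * [Delta], [C_m] and [S_m] in terms of the boundary forms *)

Section Assembly.
Context {R : realType}.
Local Notation C := R[i].
Variables (xl xr : R) (al be ga : R -> C) (tha thb : R -> R) (k : C) (a b : 'M[C]_2).
Hypothesis lr : xl < xr.
Hypothesis asm : sl_assumptions xl xr al be ga.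
Hypothesis argA : continuous_arg xl xr al tha.
Hypothesis argB : continuous_arg xl xr be thb.
Hypothesis adm : admissible xl xr ga k.

Local Notation n_ := (nf al be ga tha thb k).
Local Notation w_ := (sqrt_bn al be ga tha thb k).
Local Notation q_ := (logder al be ga tha thb k).
Let cn := nf_cont lr asm argA argB adm.
Let iq := logder_L1 lr asm argA argB adm.
Let k0 : k != 0 := k_neq0 adm.
Let xlI : xl <= xl <= xr. Proof. by rewrite lexx ltW. Qed.
Let xrI : xl <= xr <= xr. Proof. by rewrite lexx ltW. Qed.

Local Notation M1 i := (bform xl xr a b i (fund1 xl al be ga tha thb k) (dfund1 xl al be ga tha thb k)).
Local Notation M2 i := (bform xl xr a b i (fund2 xl al be ga tha thb k) (dfund2 xl al be ga tha thb k)).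
Local Notation sC := (sumC xl n_ q_ k xr).
Local Notation sS := (sumS xl n_ q_ k xr).
Local Notation aC := (altC xl n_ q_ k xr).
Local Notation aS := (altS xl n_ q_ k xr).

Let M1E i : M1 i = a i 0 * (w_ xl)^-1 + a i 1 * 0 + b i 0 * (sC / w_ xr) +
  b i 1 * (k * n_ xr * - aS / w_ xr).
Proof. by rewrite /bform; have [-> -> _ _] := fund_init lr asm argA argB adm. Qed.

Let M2E i : M2 i = a i 0 * 0 + a i 1 * (k * n_ xl / w_ xl) + b i 0 * (sS / w_ xr) +
  b i 1 * (k * n_ xr * aC / w_ xr).
Proof. by rewrite /bform; have [_ _ -> ->] := fund_init lr asm argA argB adm. Qed.

Lemma ScoefE : Scoef xl xr al be ga tha thb a b k = M1 0.
Proof.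
rewrite M1E /Scoef.
rewrite -[csum (fun n => Cn _ _ _ _ _ _ _ _ _)]/sC -[csum (fun n => _ * Sn _ _ _ _ _ _ _ _ _)]/aS.
by ring.
Qed.

Lemma CcoefE : Ccoef xl xr al be ga tha thb a b k = - M2 0.
Proof.
rewrite M2E /Ccoef.
rewrite -[csum (fun n => Sn _ _ _ _ _ _ _ _ _)]/sS -[csum (fun n => _ * Cn _ _ _ _ _ _ _ _ _)]/aC.
by ring.
Qed.

Lemma XfE x : Xf xl xr al be ga tha thb a b k x =
  - M2 0 * fund1 xl al be ga tha thb k x + M1 0 * fund2 xl al be ga tha thb k x.
Proof. by rewrite /Xf ScoefE CcoefE /fund1 /fund2 mulrAC -mulrA [in X in _ + X]mulrAC -[in X in _ + X]mulrA. Qed.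

Let csumC : csums (fun m => Cn al be ga tha thb m xl xr k) sC.
Proof.
have h := csums_gen_C lr cn iq k xrI.
by rewrite /sumC (csums_csum h); exact: h.
Qed.
Let csumS : csums (fun m => Sn al be ga tha thb m xl xr k) sS.
Proof.
have h := csums_gen_S lr cn iq k xrI.
by rewrite /sumS (csums_csum h); exact: h.
Qed.
Let csumaC : csums (fun m => (-1) ^+ m * Cn al be ga tha thb m xl xr k) aC.
Proof.
have h := csums_alt_C lr cn iq k xrI.
by rewrite /altC (csums_csum h); exact: h.
Qed.
Let csumaS : csums (fun m => (-1) ^+ m * Sn al be ga tha thb m xl xr k) aS.
Proof.
have h := csums_alt_S lr cn iq k xrI.
by rewrite /altS (csums_csum h); exact: h.
Qed.

(** Each summand of the two series splits into a plain and a [(-1) ^ n] part, so the series become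
    combinations of the four sums at [xr]. The remaining factors [2 i Xi] and [k ^ 2 n n / (w w)] do
    not vanish. *)
Lemma Delta_bdet :
  Delta xl xr al be ga tha thb a b k = 0 <-> bdet xl xr al be ga tha thb k a b = 0.
Proof.
have nl0 := nf_neq0 lr asm argA argB adm xlI.
have nr0 := nf_neq0 lr asm argA argB adm xrI.
have wl0 := sqrt_bn_neq0 lr asm argA argB adm xlI.
have wr0 := sqrt_bn_neq0 lr asm argA argB adm xrI.
have el := sqrt_bn_sqr tha k lr asm argB xlI.
have er := sqrt_bn_sqr tha k lr asm argB xrI.
have w1 := pair_wronskian lr asm argA argB adm xrI.
have [e12 e13 e14 [e23 e24 e34]] := abmE a b.
have sc : csum (fun m => cf xl xr al be ga tha thb a b m k * Cn al be ga tha thb m xl xr k) =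
    abm a b 1 4 / (k * n_ xl) * aC + - (abm a b 2 3 / (k * n_ xr)) * sC.
  apply: csums_csum; apply: (csums_ext _ (csumsD (csumsZ _ csumaC) (csumsZ _ csumC))) => m.
  by rewrite /cf; ring.
have ss : csum (fun m => sf xl xr al be ga tha thb a b m k * Sn al be ga tha thb m xl xr k) =
    abm a b 2 4 * aS + abm a b 1 3 / (k ^+ 2 * n_ xl * n_ xr) * sS.
  apply: csums_csum; apply: (csums_ext _ (csumsD (csumsZ _ csumaS) (csumsZ _ csumS))) => m.
  by rewrite /sf; ring.
have -> : bdet xl xr al be ga tha thb k a b = k ^+ 2 * n_ xl * n_ xr / (w_ xl * w_ xr) *
    (af xl xr al be ga tha thb a b k +
     (abm a b 1 4 / (k * n_ xl) * aC + - (abm a b 2 3 / (k * n_ xr)) * sC) +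
     (abm a b 2 4 * aS + abm a b 1 3 / (k ^+ 2 * n_ xl * n_ xr) * sS)).
  rewrite /bdet !M1E !M2E (boundary_determinant _ _ _ _ _ _ _ _ k0 nl0 nr0 wl0 wr0 (esym el) (esym er) w1).
  by rewrite opprK /af e12 e13 e14 e23 e24 e34.
rewrite /Delta sc ss; set X := (_ + _ + (_ + _)).
have c1 : 2%:R * 'i * Xi xl xr al be ga tha thb k != 0.
  apply: mulf_neq0; last exact: cexp_neq0.
  by apply: mulf_neq0; [rewrite pnatr_eq0|exact: imaginary_neq0].
have c2 : k ^+ 2 * n_ xl * n_ xr / (w_ xl * w_ xr) != 0.
  apply: mulf_neq0; last by rewrite invr_neq0// mulf_neq0.
  by do 2 (apply: mulf_neq0 => //); exact: expf_neq0.
by split=> /eqP; rewrite mulf_eq0 ?(negPf c1) ?(negPf c2) /= => /eqP ->; rewrite mulr0.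
Qed.

End Assembly.

Theorem theorem11 (R : realType) (xl xr : R) (al be ga : R -> R[i])
    (tha thb : R -> R) (a b : 'M[R[i]]_2) :
  xl < xr ->
  sl_assumptions xl xr al be ga ->
  continuous_arg xl xr al tha ->
  continuous_arg xl xr be thb ->
  \rank (ab a b) = 2%N ->
  boundary_case xl xr al be tha thb a b ->
  (forall k : R[i], admissible xl xr ga k ->
    (sl_eigenvalue xl xr al be ga a b (- k ^+ 2) <->
     Delta xl xr al be ga tha thb a b k = 0)) /\
  (forall kappa : R[i], admissible xl xr ga kappa ->
    Delta xl xr al be ga tha thb a b kappa = 0 ->
    let lam := - kappa ^+ 2 in
    let X := Xf xl xr al be ga tha thb a b kappa in
    sl_solution xl xr al be ga a b lam X /\
    ((Ccoef xl xr al be ga tha thb a b kappa != 0 \/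
      Scoef xl xr al be ga tha thb a b kappa != 0) ->
     sl_eigenfunction xl xr al be ga a b lam X /\
     forall y : R -> R[i], sl_eigenfunction xl xr al be ga a b lam y ->
       exists c : R[i], forall x, x \in `[xl, xr] -> y x = c * X x)).
Proof.
move=> lr asm argA argB _ _; split=> k adm.
  rewrite (Delta_bdet a b lr asm argA argB adm).
  exact: eigenvalue_bdet lr asm argA argB adm a b.
move=> /(Delta_bdet a b lr asm argA argB adm) d0 lam X.
have XE : X = fun x => - bform xl xr a b 0 (fund2 xl al be ga tha thb k) (dfund2 xl al be ga tha thb k) *
      fund1 xl al be ga tha thb k x +
    bform xl xr a b 0 (fund1 xl al be ga tha thb k) (dfund1 xl al be ga tha thb k) *
      fund2 xl al be ga tha thb k x.
  by apply/funext => x; exact: XfE.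
have H := first_row_span d0.
split; first by rewrite XE; exact: span_solution lr asm argA argB adm _ _ _ _ H.
rewrite (CcoefE _ _ lr asm argA argB adm) (ScoefE _ _ lr asm argA argB adm) => nz; split.
  by rewrite XE; exact: span_eigenfunction H nz.
move=> y [ys _]; have [c [s [yE Hcs]]] := solution_span lr asm argA argB adm ys.
(* The coefficients of [y] and those of [X] are both annihilated by the nonzero first row. *)
have [t [ct st]] := first_row_unique Hcs nz.
exists t => x; rewrite in_itv/= => xI.
by rewrite yE// XE ct st; ring.
Qed.
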